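(* Let $l>0$ and suppose that $\mathbb{E}_\mu\tau_G^{l+1}<\infty$. Then the killed process satisfies a Nash inequality with $p=\frac{l+2}{l+1}$ and $q=l+2$: there exist a constant $C>0$ and a functional $\Phi:L^2(\mathbf{1}_G\cdot\mu)\to[0,\infty]$ with $\Phi(cf)=c^2\Phi(f)$ for all $c\in\mathbb{R}$ and $f\in L^2(\mathbf{1}_G\cdot\mu)$, such that $$\|f-E_0^Gf\|^2\le C\,\mathcal{E}_G(f,f)^{1/p}\,\Phi(f)^{1/q}\qquad\text{for all } f\in\mathcal{D}(\mathcal{E}_G),$$ and $$\Phi(f)\le \|f\|_\infty^2\;\mathbb{E}_\mu\tau_G^{l+1}.$$
   Context: Let $\mathtt{E}$ be a locally compact space with countable base (LCCB), $\mu$ a Radon probability measure on $\mathtt{E}$, and $X=(X_t)_{t\ge 0}$ a $\mu$-symmetric Hunt process on $\mathtt{E}$; $\mathbb{E}_x$ is the expectation for $X$ started at $x$ and $\mathbb{E}_\mu=\int\mathbb{E}_x\,\mu(dx)$. Let $G\subseteq \mathtt{E}$ be open and let $\tau_G=\inf\{t\ge 0: X_t\notin G\}$ be the exit time from $G$, assumed almost surely finite. The killed semigroup is $P_t^G f(x)=\mathbb{E}_x[f(X_t)\mathbf{1}_{\{t<\tau_G\}}]$. It is symmetric on $L^2(\mathbf{1}_G\cdot\mu)$, whose scalar product and norm are denoted $(\cdot,\cdot)$ and $\|\cdot\|$. Its infinitesimal generator $A^G$ is a self-adjoint negative operator on $L^2(\mathbf{1}_G\cdot\mu)$. $(E_\xi^G)_{\xi\ge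 0}$ denotes the right-continuous, increasing spectral family of projections of $-A^G$; since $\tau_G<\infty$ almost surely, $E_0^G=0$. The Dirichlet form of the killed process is $\mathcal{E}_G(u,v)=\int_{[0,\infty[}\xi\,d(E_\xi^G u,v)$, with domain $\mathcal{D}(\mathcal{E}_G)$. $\|f\|_\infty$ is the essential supremum norm (possibly $+\infty$), and $0\cdot\infty=0$ by convention. *)

(* Defs.v *)
From HB Require Import structures.
From mathcomp Require Import all_boot all_order all_algebra.
From mathcomp Require Import all_classical all_reals all_analysis.
From mathcomp Require Import measurable_realfun.
Set Implicit Arguments.
Unset Strict Implicit.
Unset Printing Implicit Defensive.
Import Order.TTheory GRing.Theory Num.Theory.
Import numFieldNormedType.Exports.
Local Open Scope classical_set_scope.
Local Open Scope ring_scope.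


Definition borel (T : ptopologicalType) := g_sigma_algebraType (@open T).

Lemma open_borel (T : ptopologicalType) (G : set T) :
  open G -> measurable (G : set (borel T)).
Proof. exact: sub_sigma_algebra. Qed.

Definition lccb (E : ptopologicalType) :=
  [/\ hausdorff_space E, locally_compact [set: E] & @second_countable E].

Definition restrict_open (R : realType) (E : ptopologicalType)
    (mu : {measure set (borel E) -> \bar R}) (G : set E) (oG : open G) :
    {measure set (borel E) -> \bar R} :=
  mrestr mu (open_borel oG).

Definition radon (R : realType) (E : ptopologicalType)
    (mu : {measure set (borel E) -> \bar R}) :=
  (forall K : set E, compact K -> (mu K < +oo)%E) /\
  (forall A : set (borel E), measurable A ->
     mu A = ereal_sup [set mu K | K in [set K : set E | compact K /\ K `<=` A]]).

(** [None] is the cemetery; it is isolated when [E] is compact. *)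
Notation opc E := (one_point_compactification E).

Definition extend0 (E V : Type) (v0 : V) (f : E -> V) (z : opc E) : V :=
  if z is Some x then f x else v0.


(** Time ranges over the [t : R] with [0 <= t]; values at negative times are
    irrelevant.  The value at time [+oo] is the cemetery. *)
Definition at_time (R : realType) (E Omega : Type) (X : R -> Omega -> opc E)
    (s : \bar R) (w : Omega) : opc E :=
  if s is t%:E then X t w else None.

Definition stopping_time (R : realType) (Omega : Type)
    (F : R -> set (set Omega)) (sigma : Omega -> \bar R) :=
  (forall w, 0 <= sigma w)%E /\
  (forall t : R, 0 <= t -> F t [set w | (sigma w <= t%:E)%E]).

(** The events of the sigma-algebra of the past of a stopping time. *)
Definition stopped_event d (R : realType) (Omega : measurableType d)
    (F : R -> set (set Omega)) (sigma : Omega -> \bar R) (A : set Omega) :=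
  measurable A /\
  (forall t : R, 0 <= t -> F t (A `&` [set w | (sigma w <= t%:E)%E])).

(** Hunt processes in the sense of Fukushima, Oshima and Takeda.  The strong
    Markov property and quasi-left-continuity are required under each [P_x];
    the versions under an initial law [nu] follow by integrating over [nu].
    The filtration is not required to be complete. *)
Record hunt_process (R : realType) (E : ptopologicalType)
    d (Omega : measurableType d) := HuntProcess {
  hp_law : opc E -> probability Omega R ;
  hp_path : R -> Omega -> opc E ;
  hp_filt : R -> set (set Omega) ;
  hp_shift : R -> Omega -> Omega ;
  hp_filt_sigma : forall t : R, 0 <= t -> sigma_algebra setT (hp_filt t) ;
  hp_filt_measurable : forall (t : R) A, 0 <= t -> hp_filt t A -> measurable A ;
  hp_filt_mono : forall s t : R, 0 <= s -> s <= t -> hp_filt s `<=` hp_filt t ;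
  hp_filt_right : forall (t : R) A, 0 <= t ->
    (forall s, t < s -> hp_filt s A) -> hp_filt t A ;
  hp_adapted : forall (t : R) (B : set (borel (opc E))), 0 <= t ->
    measurable B -> hp_filt t (hp_path t @^-1` B) ;
  hp_law_measurable : forall (t : R) (B : set (borel (opc E))), 0 <= t ->
    measurable B ->
    measurable_fun setT
      (fun x : borel (opc E) => hp_law x (hp_path t @^-1` B)) ;
  hp_normal : forall x, hp_law x (hp_path 0 @^-1` [set x]) = 1%E ;
  hp_cemetery : forall t : R, 0 <= t ->
    hp_law None (hp_path t @^-1` [set None]) = 1%E ;
  hp_absorbing : forall w (s t : R), 0 <= s -> s <= t ->
    hp_path s w = None -> hp_path t w = None ;
  hp_shiftE : forall (s t : R) w, 0 <= s -> 0 <= t ->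
    hp_path s (hp_shift t w) = hp_path (s + t) w ;
  hp_right_continuous : forall w (t : R), 0 <= t ->
    hp_path s w @[s --> t^'+] --> hp_path t w ;
  hp_left_limit : forall w (t : R), 0 < t ->
    exists z : opc E, hp_path s w @[s --> t^'-] --> z ;
  hp_strong_markov : forall sigma A x (s : R) (B : set (borel (opc E))),
    stopping_time hp_filt sigma -> stopped_event hp_filt sigma A ->
    0 <= s -> measurable B ->
    hp_law x (A `&` [set w | (sigma w < +oo)%E] `&`
              [set w | B (at_time hp_path (sigma w + s%:E)%E w)]) =
    (\int[hp_law x]_(w in A `&` [set w | (sigma w < +oo)%E])
       hp_law (at_time hp_path (sigma w) w) (hp_path s @^-1` B))%E ;
  hp_quasi_left_continuous : forall (sigma : nat -> Omega -> \bar R) x,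
    (forall n, stopping_time hp_filt (sigma n)) ->
    (forall n w, (sigma n w <= sigma n.+1 w)%E) ->
    let sigmaoo w := ereal_sup (range (fun n => sigma n w)) in
    \forall w \ae hp_law x, (sigmaoo w < +oo)%E ->
      at_time hp_path (sigma n w) w @[n --> \oo] -->
      at_time hp_path (sigmaoo w) w
}.

Section Process.
Context (R : realType) (E : ptopologicalType) d (Omega : measurableType d).
Variable X : hunt_process R E Omega.

Definition symmetric_process (mu : {measure set (borel E) -> \bar R}) :=
  forall (t : R) (f g : borel E -> \bar R), 0 <= t ->
    measurable_fun setT f -> measurable_fun setT g ->
    (forall x, 0 <= f x)%E -> (forall x, 0 <= g x)%E ->
    let P h x := (\int[hp_law X (Some x)]_w extend0 0 h (hp_path X t w))%E in
    (\int[mu]_x (P f x * g x) = \int[mu]_x (f x * P g x))%E.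

Definition exit_time (G : set E) (w : Omega) : \bar R :=
  ereal_inf [set t%:E | t in
    [set t : R | 0 <= t /\ ~ (Some @` G) (hp_path X t w)]].

(** [exit_time] need only be measurable for the completions of the laws
    [P_x]; the library integral of a nonnegative function is a supremum over
    simple functions, hence it agrees with the integral for the completion. *)
Definition killed_semigroup (G : set E) (t : R)
    (f : borel E -> R) (x : borel E) : R :=
  \int[hp_law X (Some x)]_w
    (if (t%:E < exit_time G w)%E then extend0 0 f (hp_path X t w) else 0).

Definition exit_moment (mu : {measure set (borel E) -> \bar R}) (G : set E)
    (r : R) : \bar R :=
  (\int[mu]_x \int[hp_law X (Some x)]_w (exit_time G w `^ r))%E.

End Process.


(** Elements are representatives: equality in the Hilbert space L^2 is
    [_ = _ %[ae m]]. *)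
Notation L2 m := (LfunType m (lee1n 2)).

Section L2.
Context d (T : measurableType d) (R : realType).
Variable m : {measure set T -> \bar R}.

Definition dotL2 (u v : T -> R) : R := \int[m]_x (u x * v x).

Definition normL2 (u : T -> R) : \bar R := ('N[m]_2%:E[EFin \o u])%E.

(** Right-continuous increasing families of orthogonal projections indexed by
    [xi >= 0], with strong limit the identity at infinity. *)
Record spectral_family := SpectralFamily {
  sf_proj :> R -> L2 m -> L2 m ;
  sf_linear : forall xi a (u v : L2 m), 0 <= xi ->
    sf_proj xi (a *: u + v) = a *: sf_proj xi u + sf_proj xi v %[ae m] ;
  sf_idempotent : forall xi (u : L2 m), 0 <= xi ->
    sf_proj xi (sf_proj xi u) = sf_proj xi u %[ae m] ;
  sf_selfadjoint : forall xi (u v : L2 m), 0 <= xi ->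
    dotL2 (sf_proj xi u) v = dotL2 u (sf_proj xi v) ;
  sf_increasing : forall xi eta (u : L2 m), 0 <= xi -> xi <= eta ->
    dotL2 (sf_proj xi u) u <= dotL2 (sf_proj eta u) u ;
  sf_right_continuous : forall xi (u : L2 m), 0 <= xi ->
    normL2 (sf_proj eta u - sf_proj xi u) @[eta --> xi^'+] --> 0%E ;
  sf_total : forall u : L2 m,
    normL2 (sf_proj xi u - u) @[xi --> +oo] --> 0%E
}.

End L2.

Section SpectralMeasure.
Context d (T : measurableType d) (R : realType).
Variables (m : {measure set T -> \bar R}) (S : spectral_family m).

Definition spectral_cdf (u : L2 m) (xi : R) : R :=
  if 0 <= xi then dotL2 m (S xi u) u else 0.

Lemma dotL2_le_norm (f g : L2 m) :
  ((`|dotL2 m f g|)%:E <= normL2 m f * normL2 m g)%E.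
Proof.
have mf : measurable_fun setT f by [].
have mg : measurable_fun setT g by [].
have ifg : m.-integrable setT (EFin \o (f \* g)).
  by apply/Lfun1_integrable/Lfun2_mul_Lfun1; exact: LfunP.
rewrite /dotL2 EFin_normr_Rintegral//.
apply: (le_trans (le_abse_integral _ _ _)) => //; first exact: measurable_int ifg.
have := @hoelder _ _ _ m f g 2 2 mf mg (ltr0n _ 2) (ltr0n _ 2).
rewrite Lnorm1; apply; by rewrite [RHS]splitr !div1r.
Qed.

Lemma spectral_cdf_nondecreasing (u : L2 m) :
  {homo spectral_cdf u : x y / x <= y}.
Proof.
move=> x y xy; rewrite /spectral_cdf.
have [x0|x0] := leP 0 x; first by rewrite (le_trans x0 xy) sf_increasing.
case: ifPn => // y0.
have -> : dotL2 m (S y u) u = dotL2 m (S y u) (S y u).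
  rewrite -sf_selfadjoint// /dotL2 /Rintegral; congr fine.
  apply: ae_eq_integral => //; [|exact/measurable_EFinP/measurable_funM..|].
    exact/measurable_EFinP/measurable_funM.
  have := sf_idempotent S u y0.
  by apply: filterS => z /= + _ => ->.
rewrite /dotL2 Rintegral_ge0// => z _.
by rewrite -expr2 sqr_ge0.
Qed.

Lemma spectral_cdf_right_continuous (u : L2 m) :
  right_continuous (spectral_cdf u).
Proof.
move=> x; have [x0|x0] := leP 0 x; last first.
  apply: cvg_near_cst; near=> y; rewrite /spectral_cdf.
  by rewrite !leNgt x0/= ifF//; apply/negbTE; rewrite negbK; near: y;
    exact: nbhs_right_lt.
have normE (f : L2 m) : (fine (normL2 m f))%:E = normL2 m f.
  exact: finite_norm_fine.
have int2 (f g : L2 m) : m.-integrable setT (EFin \o (f \* g)).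
  by apply/Lfun1_integrable/Lfun2_mul_Lfun1; exact: LfunP.
have cdfB y : x <= y -> spectral_cdf u y - spectral_cdf u x =
    dotL2 m (S y u - S x u) u.
  move=> xy; rewrite /spectral_cdf x0 (le_trans x0 xy) /dotL2 -RintegralB//;
    [|exact: int2..].
  by apply: eq_Rintegral => z _; rewrite -mulrBl.
have rc : fine (normL2 m (S y u - S x u)) @[y --> x^'+] --> (0 : R).
  by apply: fine_cvg; exact: sf_right_continuous.
have {}rc : fine (normL2 m (S y u - S x u)) * fine (normL2 m u) @[y --> x^'+]
    --> (0 : R).
  by rewrite -(mul0r (fine (normL2 m u))); apply: cvgMr_tmp.
apply/cvgrPdist_le => e e0; near=> y.
rewrite distrC cdfB; last by near: y; exact: nbhs_right_ge.
rewrite (@le_trans _ _ (fine (normL2 m (S y u - S x u)) * fine (normL2 m u)))//.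
  by rewrite -lee_fin EFinM !normE dotL2_le_norm.
rewrite (le_trans (ler_norm _))//; near: y.
by have /cvgr0_norm_le := rc; apply.
Unshelve. all: by end_near. Qed.

HB.instance Definition _ (u : L2 m) := isCumulative.Build R _ R
  (spectral_cdf u) (@spectral_cdf_nondecreasing u)
  (@spectral_cdf_right_continuous u).

(** The measure [d (E_xi u, u)], carried by [[0, +oo[]. *)
Definition spectral_measure (u : L2 m) :
    {measure set (measurableTypeR R) -> \bar R} :=
  lebesgue_stieltjes_measure (spectral_cdf u).

(** The integral of [xi] over [[0, r]] against [d (E_xi u, v)], by
    polarization. *)
Definition spectral_integral_upto (u v : L2 m) (r : R) : R :=
  4^-1 * (\int[spectral_measure (u + v)]_(xi in `[0, r]) xi -
          \int[spectral_measure (u - v)]_(xi in `[0, r]) xi).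

(** [S] is the spectral family of [- A], for [A] given by its graph on [L2 m]:
    the domain of [A] is the set of [u] for which the integral of [xi ^+ 2]
    against [d (E_xi u, u)] is finite, and [(- A u, v)] is the integral of
    [xi] over [[0, +oo[] against [d (E_xi u, v)] for every [v]. *)
Definition spectral_family_of_opp (A : L2 m -> L2 m -> Prop) :=
  forall u g : L2 m, A u g <->
    (\int[spectral_measure u]_(xi in `[0%R, +oo[) (xi ^+ 2)%:E < +oo)%E /\
    (forall v : L2 m,
      spectral_integral_upto u v r @[r --> +oo] --> - dotL2 m g v).

(** The form [E (u, u)]; its domain is the set of [u] where it is finite. *)
Definition spectral_energy (u : L2 m) : \bar R :=
  (\int[spectral_measure u]_(xi in `[0%R, +oo[) xi%:E)%E.

End SpectralMeasure.


(** The graph of the infinitesimal generator of [P]. *)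
Definition generator d (T : measurableType d) (R : realType)
    (m : {measure set T -> \bar R}) (P : R -> (T -> R) -> T -> R)
    (u g : L2 m) :=
  normL2 m (fun x => t^-1 * (P t u x - u x) - g x) @[t --> 0^'+] --> 0%E.

(* Main.v *)
Require Import Defs.
From HB Require Import structures.
From mathcomp Require Import finmap.
From mathcomp Require Import all_boot all_order all_algebra.
From mathcomp Require Import all_classical all_reals all_analysis.
From mathcomp Require Import measurable_realfun.
From mathcomp Require Import ring lra ess_sup_inf.
Set Implicit Arguments.
Unset Strict Implicit.
Unset Printing Implicit Defensive.
Import Order.TTheory GRing.Theory Num.Theory.
Import numFieldNormedType.Exports.
Local Open Scope classical_set_scope.
Local Open Scope ring_scope.

(** Write [P_t] for the killed semigroup, [tau] for the exit time from [G] and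
    [E_xi] for the spectral projections. The functional is
    [Phi f = |f|_oo ^ 2 * E_mu tau ^ (l + 1)], and the inequality comes from cutting
    the spectrum of [f] at a frequency [xi > 0]:

      [|f - E_0 f| ^ 2 <= (|f| ^ 2 - (E_xi f, f)) + (E_xi f, f)
                       <= Energy f / xi + C * xi ^ (l + 1) * Phi f].

    The high frequencies are controlled by Chebyshev's inequality for the spectral
    measure ([spectral_energy_tail]), the low ones by [low_frequency_le]; the best
    choice of [xi] gives the exponents [1 / p] and [1 / q] ([nash_optimization]).

    Low frequencies are rare in a bounded [f] because [P_t f] decays: pointwise
    [|P_t f x| <= |f|_oo * P_x (t < tau)], so by Markov's inequality
    [|P_t f| ^ 2 <= |f|_oo ^ 2 * t ^ - (l + 1) * E_mu tau ^ (l + 1)] ([orbit_decay]),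
    whereas [P_t] hardly moves frequencies below [1 / t]. For [u] in the range of
    [E_xi] this means [|(u, f)| <= 2 * |u| * |P_t f|] with [t = 1 / (2 * xi)]
    ([orbit_bound]). The spectral family is tied to the process only through the
    generator, so instead of a functional calculus the proof uses a differential
    inequality: on the range of [E_xi] the generator is bounded by [xi]
    ([spectral_range_generator], by Riemann sums and the completeness of [L^2]);
    hence, by symmetry of [P_h], the pairings [(u, P_s f)] with unit vectors [u] of
    this range change at rate at most [xi] times their supremum, that is, by at most
    half of the supremum during [[0, t]] ([orbit_increment]). With [u = E_xi f]
    one has [|u| ^ 2 = (u, f) <= 2 * |u| * |P_t f|], up to a factor coming from the
    positive and negative parts of [f].

    What is required of the process is that [P_t] is a symmetric semigroup. Let the
    compact sets [K n] exhaust [G] ([compact_exhaustion]). Quasi-left-continuity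
    shows that, almost surely, [t < tau] if and only if the path stays in one of the
    [K n] during [[0, t]] ([surv_ae]); by right-continuity, staying in the closed set
    [K n] can be decided along dyadic times ([stay_dyadic]). Along a finite grid,
    symmetry and the semigroup property follow from those of the Hunt process
    ([markov_grid], [iter_step_symmetric]), and both survive the refinement of the
    grid ([killed_semigroup_law], [killed_symmetric]) and the passage to the union
    of the [K n] ([alive_semigroup], [alive_symmetric]).

    If the energy vanishes, all of [f] sits at frequency [0] ([spectral_energy0]).
    If [E_mu tau ^ (l + 1) = 0], the low frequency bound for the constant [1] gives
    [mu G = 0]. With these two cases settled, the right-hand side is [+oo] as soon
    as [f] is unbounded. *)

(** * The inner product of [L^2] *)

Section InnerProduct.
Context d (T : measurableType d) (R : realType).
Variable m : {measure set T -> \bar R}.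
Implicit Types u v w : L2 m.

Lemma L2_mul_integrable u v : m.-integrable setT (EFin \o (u \* v)).
Proof. by apply/Lfun1_integrable/Lfun2_mul_Lfun1; exact: LfunP. Qed.

Lemma dotL2C u v : dotL2 m u v = dotL2 m v u.
Proof. by apply: eq_Rintegral => x _; rewrite mulrC. Qed.

Lemma dotL2Dl u v w : dotL2 m (u + v) w = dotL2 m u w + dotL2 m v w.
Proof.
rewrite /dotL2 -RintegralD//; [|exact: L2_mul_integrable..].
by apply: eq_Rintegral => x _; rewrite mulrDl.
Qed.

Lemma dotL2Zl (a : R) u w : dotL2 m (a *: u) w = a * dotL2 m u w.
Proof.
rewrite /dotL2 -RintegralZl//; last exact: L2_mul_integrable.
by apply: eq_Rintegral => x _; rewrite mulrA.
Qed.

Lemma dotL2Nl u w : dotL2 m (- u) w = - dotL2 m u w.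
Proof. by rewrite -scaleN1r dotL2Zl mulN1r. Qed.

Lemma dotL2Bl u v w : dotL2 m (u - v) w = dotL2 m u w - dotL2 m v w.
Proof. by rewrite dotL2Dl dotL2Nl. Qed.

Lemma dotL2Dr u v w : dotL2 m w (u + v) = dotL2 m w u + dotL2 m w v.
Proof. by rewrite !(dotL2C w) dotL2Dl. Qed.

Lemma dotL2Zr (a : R) u w : dotL2 m w (a *: u) = a * dotL2 m w u.
Proof. by rewrite !(dotL2C w) dotL2Zl. Qed.

Lemma dotL2Nr u w : dotL2 m w (- u) = - dotL2 m w u.
Proof. by rewrite !(dotL2C w) dotL2Nl. Qed.

Lemma dotL2Br u v w : dotL2 m w (u - v) = dotL2 m w u - dotL2 m w v.
Proof. by rewrite dotL2Dr dotL2Nr. Qed.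

Lemma dotL20l w : dotL2 m (0 : L2 m) w = 0.
Proof. by rewrite -(subrr w) dotL2Bl subrr. Qed.

Lemma dotL2_suml (I : Type) (r : seq I) (F : I -> L2 m) w :
  dotL2 m ((\sum_(i <- r) F i)%R : L2 m) w = \sum_(i <- r) dotL2 m (F i) w.
Proof.
elim: r => [|i r IH]; first by rewrite !big_nil dotL20l.
by rewrite !big_cons dotL2Dl IH.
Qed.

Lemma ae_eq_dotL2 (u u' v v' : L2 m) :
  u = u' %[ae m] -> v = v' %[ae m] -> dotL2 m u v = dotL2 m u' v'.
Proof.
move=> uu' vv'; rewrite /dotL2 /Rintegral; congr fine.
have mM (f g : L2 m) : measurable_fun setT (fun x => (f x * g x)%:E).
  by apply/measurable_EFinP/measurable_funM.
apply: ae_eq_integral => //; [exact: mM..|].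
by apply: filterS2 uu' vv' => z /= + + _ => -> // ->.
Qed.

Definition nrm u : R := Num.sqrt (dotL2 m u u).

Lemma dotL2_ge0 u : 0 <= dotL2 m u u.
Proof. by rewrite /dotL2 Rintegral_ge0// => x _; rewrite -expr2 sqr_ge0. Qed.

Lemma nrm_ge0 u : 0 <= nrm u. Proof. exact: sqrtr_ge0. Qed.

Lemma nrm_sqr u : nrm u ^+ 2 = dotL2 m u u.
Proof. by rewrite sqr_sqrtr// dotL2_ge0. Qed.

Lemma nrmZ (a : R) u : nrm (a *: u) = `|a| * nrm u.
Proof.
rewrite /nrm dotL2Zl dotL2Zr mulrA -expr2 sqrtrM ?sqr_ge0//.
by rewrite sqrtr_sqr.
Qed.

Lemma normL2E u : normL2 m u = (nrm u)%:E.
Proof.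
rewrite /normL2 /nrm /dotL2 /Rintegral unlock /Lnorm/=.
under eq_integral => x _ do rewrite powR_mulrn// -normrX ger0_norm ?sqr_ge0// expr2.
rewrite -[X in (X `^ _)%E](@fineK _ (\int[m]_x _)); last first.
  by apply: integrable_fin_num => //; exact: L2_mul_integrable.
rewrite poweR_EFin; congr EFin.
by rewrite powR12_sqrt// fine_ge0// integral_ge0// => x _;
  rewrite lee_fin -expr2 sqr_ge0.
Qed.

Lemma cauchy_schwarz u v : `|dotL2 m u v| <= nrm u * nrm v.
Proof. by rewrite -lee_fin EFinM -!normL2E; exact: dotL2_le_norm. Qed.

Lemma nrmD u v : nrm (u + v) <= nrm u + nrm v.
Proof.
rewrite -lee_fin [leRHS]EFinD -(normL2E u) -(normL2E v) -(normL2E (u + v)).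
by apply: (@eminkowski _ _ _ m u v 2%:E) => //; rewrite lee1n.
Qed.

Lemma nrmN u : nrm (- u) = nrm u.
Proof. by rewrite -scaleN1r nrmZ normrN1 mul1r. Qed.

Lemma nrmB u v : nrm (u - v) <= nrm u + nrm v.
Proof. by rewrite (le_trans (nrmD _ _))// nrmN. Qed.

Lemma nrm_sum (I : Type) (r : seq I) (F : I -> L2 m) :
  nrm ((\sum_(i <- r) F i)%R : L2 m) <= \sum_(i <- r) nrm (F i).
Proof.
elim: r => [|i r IH].
  by rewrite !big_nil /nrm dotL20l sqrtr0.
by rewrite !big_cons (le_trans (nrmD _ _))// lerD2l.
Qed.

Lemma ae_eq_nrm u v : u = v %[ae m] -> nrm u = nrm v.
Proof. by move=> uv; rewrite /nrm (ae_eq_dotL2 uv uv). Qed.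

Lemma nrm_eq0 u : nrm u = 0 -> u = 0 %[ae m].
Proof.
move=> u0; apply: fine_Lnormr_eq0.
by have := normL2E u; rewrite /normL2 u0 => ->.
Qed.

Lemma nrmB_eq0 u v : nrm (u - v) = 0 -> u = v %[ae m].
Proof.
by move/nrm_eq0; apply: filterS => x /= /(_ I) /eqP; rewrite subr_eq0 => /eqP.
Qed.

End InnerProduct.

(** * Spectral projections *)

Section SpectralAlgebra.
Context d (T : measurableType d) (R : realType).
Variables (m : {measure set T -> \bar R}) (S : spectral_family m).
Implicit Types (u v w : L2 m) (a b x : R).

Lemma sf_dot_idem a u : 0 <= a -> dotL2 m (S a u) (S a u) = dotL2 m (S a u) u.
Proof.
move=> a0; rewrite -sf_selfadjoint//.
by apply: ae_eq_dotL2; [exact: sf_idempotent|exact: ae_eq_refl].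
Qed.

Lemma nrm_sf_le a u : 0 <= a -> nrm (S a u) <= nrm u.
Proof.
move=> a0; have := cauchy_schwarz (S a u) u.
rewrite -sf_dot_idem// ger0_norm ?dotL2_ge0// -nrm_sqr expr2.
have [->|n0] := eqVneq (nrm (S a u)) 0; first by rewrite nrm_ge0.
by rewrite ler_pM2l// lt_neqAle eq_sym n0 nrm_ge0.
Qed.

Lemma sfD a u v : 0 <= a -> S a (u + v) = S a u + S a v %[ae m].
Proof.
move=> a0; have := sf_linear S 1 u v a0.
by rewrite !scale1r.
Qed.

Lemma sfB a u v : 0 <= a -> S a (u - v) = S a u - S a v %[ae m].
Proof.
move=> a0; have := sf_linear S (-1) v u a0.
by rewrite !scaleN1r ![- _ + _]addrC.
Qed.

Lemma sf_ae_eq a u v : 0 <= a -> u = v %[ae m] -> S a u = S a v %[ae m].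
Proof.
move=> a0 uv; apply: nrmB_eq0; apply/eqP; rewrite eq_le nrm_ge0 andbT.
rewrite (@le_trans _ _ (nrm (S a (u - v))))//.
  by rewrite le_eqVlt; apply/orP; left; apply/eqP/ae_eq_nrm/ae_eq_sym/sfB.
rewrite (le_trans (nrm_sf_le _ a0))//.
rewrite (@ae_eq_nrm _ _ _ _ _ (0 : L2 m)) ?/nrm ?dotL20l ?sqrtr0//.
by apply: filterS uv => x uvx _; rewrite /= -[LHS]/(u x - v x) (uvx I) subrr.
Qed.

(** Monotonicity of the quadratic forms forces the ranges to be nested: for
    [w] in the range of [S a], [norm (w - S b w) ^ 2 = (w, w) - (S b w, w)] is at
    most [(w, w) - (S a w, w) = 0]. *)
Lemma sf_nested a b u : 0 <= a -> a <= b -> S b (S a u) = S a u %[ae m].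
Proof.
move=> a0 ab; have b0 := le_trans a0 ab.
set w := S a u.
apply: ae_eq_sym; apply: nrmB_eq0; apply/eqP.
rewrite -(@eqrXn2 _ 2)// ?nrm_ge0// expr0n/= nrm_sqr eq_le dotL2_ge0 andbT.
rewrite dotL2Bl !dotL2Br (dotL2C w (S b w)) sf_dot_idem// subrr subr0 subr_le0.
apply: le_trans (sf_increasing S w a0 ab).
rewrite le_eqVlt; apply/orP; left; apply/eqP/ae_eq_dotL2; last exact: ae_eq_refl.
exact/ae_eq_sym/sf_idempotent.
Qed.

Lemma dot_sf_nested a b u v : 0 <= a -> a <= b ->
  dotL2 m (S a u) (S b v) = dotL2 m (S a u) v.
Proof.
move=> a0 ab; rewrite -sf_selfadjoint ?(le_trans a0)//.
by apply: ae_eq_dotL2; [exact: sf_nested|exact: ae_eq_refl].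
Qed.

Lemma dot_sf_ge0 u a : 0 <= a -> 0 <= dotL2 m (S a u) u.
Proof. by move=> a0; rewrite -sf_dot_idem// dotL2_ge0. Qed.

Lemma dot_sf_le_nrm u a : 0 <= a -> dotL2 m (S a u) u <= nrm u ^+ 2.
Proof.
by move=> a0; rewrite -sf_dot_idem// -nrm_sqr ler_pXn2r ?nnegrE ?nrm_ge0// nrm_sf_le.
Qed.

Lemma nrm_sub_sf u a : 0 <= a -> nrm (u - S a u) ^+ 2 = nrm u ^+ 2 - dotL2 m (S a u) u.
Proof.
move=> a0; rewrite !nrm_sqr dotL2Bl !dotL2Br (dotL2C u (S a u)) sf_dot_idem//.
by rewrite subrr subr0.
Qed.

Lemma nrm_sub_sf_le u a : 0 <= a -> nrm (u - S a u) <= nrm u.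
Proof.
move=> a0; rewrite -(@ler_pXn2r _ 2) ?nnegrE ?nrm_ge0// nrm_sub_sf//.
by rewrite gerBl dot_sf_ge0.
Qed.

Lemma polarization a u v : 0 <= a ->
  4^-1 * (dotL2 m (S a (u + v)) (u + v) - dotL2 m (S a (u - v)) (u - v)) =
  dotL2 m (S a u) v.
Proof.
move=> a0.
have -> : dotL2 m (S a (u + v)) (u + v) = dotL2 m (S a u + S a v) (u + v).
  by apply: ae_eq_dotL2; [exact: sfD|exact: ae_eq_refl].
have -> : dotL2 m (S a (u - v)) (u - v) = dotL2 m (S a u - S a v) (u - v).
  by apply: ae_eq_dotL2; [exact: sfB|exact: ae_eq_refl].
rewrite !dotL2Dl !dotL2Dr !dotL2Nl !dotL2Nr.
rewrite (sf_selfadjoint S v u a0) (dotL2C v).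
lra.
Qed.

(** Spectral increments over disjoint intervals are orthogonal, so the squared
    norm of their sum telescopes. *)
Lemma nrm_sum_increments u (a b : nat -> R) (N : nat) :
  (forall i, 0 <= a i) -> (forall i, a i <= b i) -> (forall i, b i <= a i.+1) ->
  nrm ((\sum_(i < N) (S (b i) u - S (a i) u))%R : L2 m) ^+ 2 <= nrm u ^+ 2.
Proof.
move=> a0 ab ba.
have b0 i : 0 <= b i := le_trans (a0 i) (ab i).
have bmon i j : (i < j)%N -> b i <= a j.
  elim: j => // j IH; rewrite ltnS leq_eqVlt => /predU1P[->//|/IH ij].
  by rewrite (le_trans ij)// (le_trans (ab j)).
suff : nrm ((\sum_(i < N) (S (b i) u - S (a i) u))%R : L2 m) ^+ 2
    <= dotL2 m (S (a N) u) u.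
  by move/le_trans; apply; exact: dot_sf_le_nrm.
elim: N => [|N IH].
  by rewrite big_ord0 nrm_sqr dotL20l dot_sf_ge0.
rewrite big_ord_recr/=; set V : L2 m := (\sum_(i < N) _)%R in IH *.
have VD : dotL2 m V (S (b N) u - S (a N) u) = 0.
  rewrite /V dotL2_suml big1// => i _.
  have := bmon _ _ (ltn_ord i) => biN.
  have aiN : a i <= a N by rewrite (le_trans (ab i)).
  rewrite dotL2Bl !dotL2Br !dot_sf_nested//.
    by rewrite !subrr.
  - by rewrite (le_trans aiN).
  - by rewrite (le_trans biN).
have DD : dotL2 m (S (b N) u - S (a N) u) (S (b N) u - S (a N) u) =
    dotL2 m (S (b N) u) u - dotL2 m (S (a N) u) u.
  rewrite dotL2Bl !dotL2Br (dotL2C (S (b N) u) (S (a N) u)).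
  by rewrite (dot_sf_nested u _ (a0 N) (ab N)) !sf_dot_idem// subrr subr0.
move: (S (b N) u - S (a N) u) VD DD => D VD DD.
move: V IH VD => V IH VD.
rewrite nrm_sqr dotL2Dl !dotL2Dr (dotL2C D V) VD addr0 add0r DD -nrm_sqr.
have := sf_increasing S u (b0 N) (ba N).
lra.
Qed.

End SpectralAlgebra.

(** * Completeness of [L^2] for a finite measure *)

Lemma limn_einf_ub (R : realType) (u : nat -> \bar R) (c : \bar R) :
  (forall n, u n <= c)%E -> (limn_einf u <= c)%E.
Proof.
move=> uc; rewrite limn_einf_lim; apply: lime_le; first exact: is_cvg_einfs.
apply: nearW => n; apply: le_trans (uc n).
by apply: ereal_inf_lbound; exists n => /=.
Qed.

Lemma limn_einf_lb (R : realType) (u : nat -> \bar R) (c : \bar R) :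
  (forall n, c <= u n)%E -> (c <= limn_einf u)%E.
Proof.
move=> uc; rewrite limn_einf_lim; apply: lime_ge; first exact: is_cvg_einfs.
by apply: nearW => n; apply: le_ereal_inf_tmp => _ [k /= _ <-].
Qed.

Section Completeness.
Context d (T : measurableType d) (R : realType).
Variable m : {measure set T -> \bar R}.
Hypothesis mT : (m setT < +oo)%E.

Lemma bounded_L2 (f : T -> R) (M : R) : measurable_fun setT f ->
  (forall x, `|f x| <= M) -> exists g : L2 m, g = f :> (T -> R).
Proof.
move=> mf fM.
suff fL : f \in Lfun m 2%:E by exists (Lfun_Sub (lee1n 2) fL).
have mTfin : m setT \is a fin_num by rewrite ge0_fin_numE.
apply: (@Lfun_subset _ _ _ m 2%:E +oo%E _ _ mTfin) => //; rewrite ?lee1n ?leey//.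
rewrite inE/=; apply/andP; split; rewrite inE//=.
rewrite /finite_norm unlock /Lnorm; case: ifPn => // _.
rewrite (@le_lt_trans _ _ M%:E) ?ltry//.
by apply/(@ess_sup_inf.ess_supP _ _ _ m); apply: nearW => x /=; rewrite lee_fin.
Qed.

Lemma sqr_integrable_L2 (f : T -> R) : measurable_fun setT f ->
  (\int[m]_x (f x ^+ 2)%:E < +oo)%E -> exists g : L2 m, g = f :> (T -> R).
Proof.
move=> mf foo.
suff fL : f \in Lfun m 2%:E by exists (Lfun_Sub (lee1n 2) fL).
rewrite inE/=; apply/andP; split; rewrite inE//=.
rewrite /finite_norm unlock /Lnorm poweR_lty//.
apply: le_lt_trans foo; rewrite le_eqVlt; apply/orP; left; apply/eqP.
by apply: eq_integral => x _ /=; rewrite powR_mulrn// -normrX ger0_norm ?sqr_ge0.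
Qed.

Lemma nrm_sqrE (u : L2 m) : (nrm u ^+ 2)%:E = (\int[m]_x (u x ^+ 2)%:E)%E.
Proof.
rewrite nrm_sqr /dotL2 /Rintegral fineK//.
by apply: integrable_fin_num => //; exact: L2_mul_integrable.
Qed.

Lemma integral_abs_L2 : exists2 K : R, 0 <= K & forall g : L2 m,
  (\int[m]_x (`|g x|)%:E <= (K * nrm g)%:E)%E.
Proof.
have [u uE] : exists g : L2 m, g = cst 1 :> (T -> R).
  by apply: (@bounded_L2 _ 1) => // x; rewrite /= normr1.
exists (nrm u); first exact: nrm_ge0.
move=> g.
have [a aE] : exists h : L2 m, h = (fun x => `|g x|) :> (T -> R).
  apply: sqr_integrable_L2; first exact: measurableT_comp.
  under eq_integral do rewrite /= -normrX ger0_norm ?sqr_ge0//.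
  by rewrite -nrm_sqrE ltry.
have -> : nrm g = nrm a.
  rewrite /nrm /dotL2; congr Num.sqrt; apply: eq_Rintegral => x _.
  by rewrite aE/= -normrM ger0_norm// -expr2 sqr_ge0.
have /le_trans := cauchy_schwarz u a.
move=> /(_ _ (lexx _)); rewrite -lee_fin; apply: le_trans.
rewrite ger0_norm; last first.
  by apply: Rintegral_ge0 => x _; rewrite uE aE/= mul1r.
rewrite /dotL2 /Rintegral fineK; last first.
  by apply: integrable_fin_num => //; exact: L2_mul_integrable.
rewrite le_eqVlt; apply/orP; left; apply/eqP.
by apply: eq_integral => x _; rewrite uE aE/= mul1r.
Qed.

Lemma sum_geometric_half (n : nat) :
  \sum_(0 <= k < n) (2^-1 : R) ^+ k = 2 - 2 * 2^-1 ^+ n.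
Proof.
elim: n => [|n IH]; first by rewrite big_geq// expr0; lra.
rewrite big_nat_recr//= IH exprS; lra.
Qed.

Lemma L2_cauchy_telescope (g : nat -> L2 m) (C : R) : 0 <= C ->
  (forall n, nrm (g n.+1 - g n) <= C * 2^-1 ^+ n) ->
  forall n p, nrm (g n - g (n + p)%N) <= 2 * C * 2^-1 ^+ n.
Proof.
move=> C0 gC n p.
suff : nrm (g n - g (n + p)%N) <= 2 * C * 2^-1 ^+ n * (1 - 2^-1 ^+ p).
  move/le_trans; apply; rewrite -[leRHS]mulr1 ler_wpM2l//.
  by rewrite !mulr_ge0// exprn_ge0.
elim: p => [|p IH].
  by rewrite addn0 subrr /nrm dotL20l sqrtr0 expr0 subrr mulr0.
have -> : g n - g (n + p.+1)%N = (g n - g (n + p)%N) - (g (n + p).+1 - g (n + p)%N).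
  by rewrite opprB addrA subrK addnS.
rewrite (le_trans (nrmB _ _))//.
have := gC (n + p)%N; rewrite exprD exprS; move: IH.
set x := 2^-1 ^+ n; set y := 2^-1 ^+ p.
set s := nrm _; set t := nrm _ => h1 h2.
apply: le_trans (lerD h1 h2) _.
by rewrite le_eqVlt; apply/orP; left; apply/eqP; field.
Qed.

(** The increments being summable in [L^2], hence in [L^1] as the measure is
    finite, the sequence converges almost everywhere; Fatou's lemma then controls
    the distance to the pointwise limit. *)
Lemma L2_fast_cauchy_cvg (g : nat -> L2 m) (C : R) : 0 <= C ->
  (forall n, nrm (g n.+1 - g n) <= C * 2^-1 ^+ n) ->
  exists h : L2 m, forall n, nrm (g n - h) <= 2 * C * 2^-1 ^+ n.
Proof.
move=> C0 gC.
have [K K0 KP] := integral_abs_L2.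
(* [H] is finite almost everywhere and dominates the series of increments. *)
pose a k x : \bar R := (`|g k.+1 x - g k x|)%:E.
have ma k : measurable_fun setT (a k).
  by apply/measurable_EFinP/measurableT_comp => //; exact: measurable_funB.
have a0 k x : (0 <= a k x)%E by rewrite lee_fin.
pose H x := (\sum_(k <oo) a k x)%E.
have mH : measurable_fun setT H.
  rewrite /H; apply: (emeasurable_fun_cvg (fun n x => \sum_(0 <= k < n) a k x)%E).
    by move=> n; exact: emeasurable_sum.
  by move=> x _; apply: is_cvg_nneseries => *; exact: a0.
have iH : (\int[m]_x H x < +oo)%E.
  rewrite integral_nneseries//.
  apply: (@le_lt_trans _ _ (K * C * 2)%:E); last exact: ltry.
  apply: lime_le; first by apply: is_cvg_nneseries => *; exact: integral_ge0.
  apply: nearW => n.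
  apply: (@le_trans _ _ (\sum_(0 <= k < n) (K * (C * 2^-1 ^+ k))%:E)%E).
    apply: lee_sum => k _; apply: le_trans (KP (g k.+1 - g k)) _.
    by rewrite lee_fin ler_wpM2l.
  rewrite sumEFin lee_fin.
  under eq_bigr do rewrite mulrA.
  by rewrite -mulr_sumr ler_wpM2l ?mulr_ge0// sum_geometric_half gerBl
    mulr_ge0 ?exprn_ge0.
pose A := [set x | (H x < +oo)%E].
have mA : measurable A by rewrite -[A]setTI; exact: emeasurable_fun_infty_o.
have aeA : \forall x \ae m, A x.
  have H0 x : (0 <= H x)%E by apply: nneseries_ge0 => *; exact: a0.
  have : m.-integrable setT H.
    apply/integrableP; split => //.
    by under eq_integral => x _ do rewrite gee0_abs//.
  move/integrable_ae => /(_ measurableT); apply: filterS => x /= /(_ I).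
  by rewrite ge0_fin_numE.
have cvg_gA x : A x -> cvgn (fun n => g n x).
  move=> Ax; pose u : R^nat := fun n => g n x.
  have -> : (fun n => g n x) = (fun n => u 0%N + series (telescope u) n).
    by apply/funext => n; rewrite -eq_sum_telescope.
  apply: is_cvgD; first exact: is_cvg_cst.
  apply: normed_cvg; apply: nondecreasing_is_cvgn.
    by apply: nondecreasing_series => *; exact: normr_ge0.
  exists (fine (H x)) => _ [n _ <-] /=.
  have Hfin : H x \is a fin_num.
    by rewrite ge0_fin_numE//; apply: nneseries_ge0 => *; exact: a0.
  rewrite -lee_fin fineK// /series/= -sumEFin.
  by rewrite /telescope; apply: nneseries_lim_ge.
pose h x := limn (fun n => g n x * \1_A x).
have cvg_h x : g n x * \1_A x @[n --> \oo] --> h x.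
  have [Ax|nAx] := pselect (A x).
    by rewrite /h indicE mem_set//=; under eq_fun do rewrite mulr1; exact: cvg_gA.
  rewrite /h indicE memNset//=; under eq_fun do rewrite mulr0.
  exact: is_cvg_cst.
have mh : measurable_fun setT h.
  apply: (measurable_fun_cvg (h := fun n x => g n x * \1_A x)) => [n|x _].
    by apply: measurable_funM => //; exact: measurable_indic.
  exact: cvg_h.
have fatou_h n : (\int[m]_x ((g n x - h x) ^+ 2)%:E <=
    ((2 * C * 2^-1 ^+ n) ^+ 2)%:E)%E.
  pose f p x : \bar R := ((g n x - g (n + p)%N x) ^+ 2)%:E.
  have mf p : measurable_fun setT (f p).
    by apply/measurable_EFinP/measurable_funX; exact: measurable_funB.
  have f0 p x : (0 <= f p x)%E by rewrite lee_fin sqr_ge0.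
  have -> : (\int[m]_x ((g n x - h x) ^+ 2)%:E =
             \int[m]_x limn_einf (f^~ x))%E.
    apply: ge0_ae_eq_integral => //.
    - by apply/measurable_EFinP/measurable_funX; exact: measurable_funB.
    - apply: (@measurableT_comp _ _ _ _ _ _ -%E) => //.
      apply: (measurable_fun_limn_esup (f := fun p x => - f p x)%E) => p.
      exact: measurableT_comp.
    - by move=> x _; rewrite lee_fin sqr_ge0.
    - by move=> x _; exact: limn_einf_lb.
    - apply: filterS aeA => x Ax _.
      have fc : f p x @[p --> \oo] --> ((g n x - h x) ^+ 2)%:E.
        apply: cvg_EFin; first exact: nearW.
        apply: (@cvg_comp _ _ _ (fun p => g n x - g (n + p)%N x) (fun y : R => y ^+ 2)); last first.
          exact: exprn_continuous.
        apply: cvgB; first exact: cvg_cst.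
        have := cvg_h x; rewrite indicE mem_set//=.
        under eq_fun do rewrite mulr1.
        move=> gh; rewrite -(cvg_shiftn n) in gh.
        by under eq_fun do rewrite addnC.
      by have [-> _] := cvg_limn_einf_sup fc.
  apply: le_trans (fatou _ _ _ _) _ => //.
  apply: limn_einf_ub => p.
  rewrite -(nrm_sqrE (g n - g (n + p)%N)) lee_fin.
  rewrite ler_pXn2r ?nnegrE ?nrm_ge0 ?(mulr_ge0, exprn_ge0)//.
  exact: L2_cauchy_telescope.
have [w wE] : exists w : L2 m, w = (fun x => g 0%N x - h x) :> (T -> R).
  apply: sqr_integrable_L2; first exact: measurable_funB.
  by rewrite (le_lt_trans (fatou_h 0%N))// ltry.
exists (g 0%N - w) => n.
rewrite -(@ler_pXn2r _ 2) ?nnegrE ?nrm_ge0 ?(mulr_ge0, exprn_ge0)//.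
rewrite -lee_fin nrm_sqrE.
apply: le_trans (fatou_h n); rewrite le_eqVlt; apply/orP; left; apply/eqP.
apply: eq_integral => x _; congr ((_ ^+ 2)%:E).
rewrite -[LHS]/(g n x - (g 0%N x - w x)) wE; lra.
Qed.

End Completeness.

(** * The spectral integral and the generator on spectral subspaces *)

Section SpectralIntegral.
Context d (T : measurableType d) (R : realType).
Variables (m : {measure set T -> \bar R}) (S : spectral_family m).
Implicit Types (u v w : L2 m) (a b x : R).

Lemma spectral_measure_itvoc u a b : a <= b ->
  spectral_measure S u (`]a, b]%classic : set (measurableTypeR R)) = (spectral_cdf S u b - spectral_cdf S u a)%:E.
Proof.
move=> ab; rewrite /= /spectral_measure/= /lebesgue_stieltjes_measure.
rewrite /measure_extension measurable_mu_extE/=; last exact: is_ocitv.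
by rewrite wlength_itv_bnd.
Qed.

Lemma spectral_cdfE u a : 0 <= a -> spectral_cdf S u a = dotL2 m (S a u) u.
Proof. by rewrite /spectral_cdf => ->. Qed.

Lemma integrable_id_itvoc u a b :
  (spectral_measure S u).-integrable (`]a, b]%classic : set (measurableTypeR R)) (EFin \o (@idfun R)).
Proof.
have [ab|ba] := leP a b; last first.
  by rewrite set_itv_ge ?bnd_simp -?leNgt ?ltW//; exact: integrable_set0.
apply: measurable_bounded_integrable => //.
  by rewrite spectral_measure_itvoc// ltry.
  exact: measurable_id.
exists (`|a| + `|b|); split; first by rewrite num_real.
move=> M abM x /=; rewrite in_itv/= => /andP[ax xb].
rewrite ltW//; apply: le_lt_trans abM.
rewrite ler_norml; apply/andP; split.
  by rewrite (le_trans _ (ltW ax))// lerNl (le_trans (ler_norm _))// normrN lerDl.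
by rewrite (le_trans xb)// (le_trans (ler_norm _))// lerDr.
Qed.

Lemma Rintegral_itvoc_bounds u a b : a <= b ->
  a * (spectral_cdf S u b - spectral_cdf S u a) <=
    \int[spectral_measure S u]_(x in `]a, b]) x <=
  b * (spectral_cdf S u b - spectral_cdf S u a).
Proof.
move=> ab; set D := spectral_cdf S u b - spectral_cdf S u a.
have cstE c : \int[spectral_measure S u]_(x in `]a, b]) (cst c x) = c * D.
  by rewrite Rintegral_cst// spectral_measure_itvoc.
have icst c : (spectral_measure S u).-integrable (`]a, b]%classic : set (measurableTypeR R)) (EFin \o cst c).
  apply: measurable_bounded_integrable => //.
    by rewrite spectral_measure_itvoc// ltry.
  by exists `|c|; split; [rewrite num_real|move=> M cM x /= _; exact: ltW].
have iid := integrable_id_itvoc u a b.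
rewrite -!cstE; apply/andP; split; apply: le_Rintegral => //= x /=.
  by rewrite in_itv/= => /andP[/ltW].
by rewrite in_itv/= => /andP[].
Qed.

Lemma Rintegral_itvoc_cat u a b c : a <= b -> b <= c ->
  \int[spectral_measure S u]_(x in `]a, c]) x =
  \int[spectral_measure S u]_(x in `]a, b]) x +
  \int[spectral_measure S u]_(x in `]b, c]) x.
Proof.
move=> ab bc.
have E : `]a, c]%classic = `]a, b] `|` `]b, c].
  apply/seteqP; split => x /=; rewrite !in_itv/=.
    move=> /andP[ax xc]; have [xb|bx] := leP x b; [left|right].
      by rewrite ax.
    by rewrite xc.
  by case=> /andP[h1 h2]; rewrite ?h1 ?h2 ?(le_trans h2 bc) ?(le_lt_trans ab h1).
rewrite E Rintegral_setU//.
  by rewrite -E; exact: integrable_id_itvoc.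
apply/disj_setPS => x [] /=; rewrite !in_itv/= => /andP[_ xb] /andP[bx _].
by move: (lt_le_trans bx xb); rewrite ltxx.
Qed.

(** Right-endpoint Riemann sum for the integral of [xi] over [(a, b]],
    rearranged by Abel summation. In this form it is linear in the values of the
    distribution function, and therefore compatible with polarization. *)
Definition riemann_abel (F : R -> R) a b (N : nat) : R :=
  b * F b - a * F a -
  (b - a) / N%:R * \sum_(i < N) F (a + (b - a) / N%:R * i.+1%:R).

(** On each cell of the grid the integrand [xi] varies by at most the mesh, so the
    error is at most the mesh times the total increment of the distribution function. *)
Lemma riemann_abel_error u a b (N : nat) : a <= b -> (0 < N)%N ->
  `|\int[spectral_measure S u]_(x in `]a, b]) x -
    riemann_abel (spectral_cdf S u) a b N| <=
  (b - a) / N%:R * (spectral_cdf S u b - spectral_cdf S u a).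
Proof.
move=> ab N0; set F := spectral_cdf S u; set dl := (b - a) / N%:R.
have dl0 : 0 <= dl by rewrite divr_ge0// subr_ge0.
pose x k : R := a + dl * k%:R.
suff H k : 0 <= \int[spectral_measure S u]_(y in `]a, x k]) y -
    (x k * F (x k) - a * F a - dl * \sum_(i < k) F (x i.+1)) <=
    dl * (F (x k) - F a).
  have xN : x N = b by rewrite /x /dl divfK ?pnatr_eq0 -?lt0n// subrKC.
  have := H N; rewrite xN => /andP[h1 h2].
  by rewrite /riemann_abel -/dl ger0_norm.
elim: k => [|k /andP[IH1 IH2]].
  rewrite /x mulr0 addr0 big_ord0 mulr0 !subrr subr0 mulr0.
  by rewrite set_itv_ge ?bnd_simp ?ltxx// Rintegral_set0 lexx.
have ax : a <= x k by rewrite /x lerDl mulr_ge0.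
have xS : x k.+1 = x k + dl by rewrite /x -addn1 natrD mulrDr mulr1 addrA.
have xx : x k <= x k.+1 by rewrite xS lerDl.
rewrite (Rintegral_itvoc_cat u ax xx) big_ord_recr/=.
have := Rintegral_itvoc_bounds u xx; rewrite -/F => /andP[h1 h2].
move: IH1 IH2 h1 h2.
set I1 := \int[_]_(_ in _) _; set I2 := \int[_]_(_ in _) _.
set s := \sum_(i < k) _; rewrite xS.
set y := F (x k + dl); set z := F (x k).
move=> IH1 IH2 h1 h2.
apply/andP; split; nra.
Qed.

End SpectralIntegral.

Lemma eq0_half_powers (R : realType) (a K : R) :
  (forall n, `|a| <= K * 2^-1 ^+ n) -> a = 0.
Proof.
move=> aK; apply/normr0_eq0/eqP; rewrite eq_le normr_ge0 andbT.
have h : K * 2^-1 ^+ n @[n --> \oo] --> (0 : R).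
  by apply: (@cvg_geometric R K 2^-1); rewrite ger0_norm// invf_lt1// ltr1n.
rewrite -(cvg_lim _ h)//; apply: limr_ge; first by apply/cvg_ex; exists 0.
exact: nearW.
Qed.

Lemma sum_split_parity (V : nmodType) (f : nat -> V) (N : nat) :
  \sum_(j < 2 * N) f j = \sum_(i < N) f (2 * i)%N + \sum_(i < N) f (2 * i).+1.
Proof.
elim: N => [|N IH]; first by rewrite muln0 !big_ord0 addr0.
rewrite mulnS addnC addn2 !big_ord_recr/= IH -!addrA; congr (_ + _).
by rewrite addrCA.
Qed.

Section SpectralGenerator.
Context d (T : measurableType d) (R : realType).
Variables (m : {measure set T -> \bar R}) (S : spectral_family m).
Hypothesis mT : (m setT < +oo)%E.
Implicit Types (u v w : L2 m) (xi : R).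

(** Riemann sums for the integral of [x] against [d E_x u] over [[0, xi]], in the
    rearranged form of [riemann_abel], for [u] in the range of [S xi]. *)
Definition generator_sum xi u (n : nat) : L2 m :=
  xi *: u - (xi / (2 ^ n)%:R) *: (\sum_(i < 2 ^ n) S (xi / (2 ^ n)%:R * i.+1%:R) u)%R.

Lemma grid_ge0 xi (N i : nat) : 0 <= xi -> 0 <= xi / N%:R * i%:R.
Proof. by move=> xi0; rewrite mulr_ge0// divr_ge0. Qed.

Lemma grid_le xi (N i : nat) : 0 <= xi -> (i <= N)%N -> xi / N%:R * i%:R <= xi.
Proof.
move=> xi0; case: N => [|N iN]; first by rewrite leqn0 => /eqP->; rewrite mulr0.
by rewrite mulrAC ler_pdivrMr ?ltr0n// ler_wpM2l// ler_nat.
Qed.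

Lemma nrm_generator_sum xi u n : 0 <= xi -> nrm (generator_sum xi u n) <= xi * nrm u.
Proof.
move=> xi0; rewrite /generator_sum; set N := (2 ^ n)%N.
have N0 : (0 < N)%N by rewrite expn_gt0.
have -> : xi *: u - (xi / N%:R) *: (\sum_(i < N) S (xi / N%:R * i.+1%:R) u)%R =
    (xi / N%:R) *: (\sum_(i < N) (u - S (xi / N%:R * i.+1%:R) u))%R.
  rewrite big_split/= sumrN scalerDr scalerN sumr_const card_ord -[u *+ N]scaler_nat.
  by rewrite scalerA divfK// pnatr_eq0 -lt0n.
rewrite nrmZ ger0_norm ?divr_ge0//.
apply: le_trans (ler_wpM2l _ (nrm_sum _ _)) _; first by rewrite divr_ge0.
have -> : xi * nrm u = xi / N%:R * \sum_(i < N) nrm u.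
  by rewrite sumr_const card_ord -[nrm u *+ _]mulr_natl mulrA divfK// pnatr_eq0 -lt0n.
rewrite ler_wpM2l ?divr_ge0//; apply: ler_sum => i _.
by rewrite nrm_sub_sf_le// grid_ge0.
Qed.

(** Halving the mesh changes the sum by the new mesh times every second increment
    of [S x u], and these are mutually orthogonal. *)
Lemma generator_sum_cauchy xi u n : 0 <= xi ->
  nrm (generator_sum xi u n.+1 - generator_sum xi u n) <=
  xi * nrm u / 2 * 2^-1 ^+ n.
Proof.
move=> xi0; set c := xi / (2 ^ n.+1)%:R.
have c0 : 0 <= c by rewrite divr_ge0.
have c2 : xi / (2 ^ n)%:R = 2 * c.
  by rewrite /c expnS natrM invfM; field; rewrite pnatr_eq0 -lt0n expn_gt0.
have E : generator_sum xi u n.+1 - generator_sum xi u n =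
  c *: (\sum_(i < 2 ^ n) (S (c * (2 * i).+2%:R) u - S (c * (2 * i).+1%:R) u))%R.
  rewrite /generator_sum -/c c2 opprB addrC addrA subrK expnS.
  rewrite (sum_split_parity (fun j => S (c * j.+1%:R) u)) big_split/= sumrN.
  under eq_bigr => i _ do rewrite [2 * c * _]mulrAC -natrM mulrC mulnS addnC addn2.
  set Y := (\sum_(i < _) S (c * (2 * i).+1%:R) u)%R.
  set X := (\sum_(i < _) S (c * (2 * i).+2%:R) u)%R.
  rewrite scalerDr scalerBr opprD addrCA.
  by rewrite [2 * c]mulr_natl [c *+ 2]mulr2n scalerDl addrK addrC.
rewrite E nrmZ ger0_norm//.
have -> : xi * nrm u / 2 * 2^-1 ^+ n = c * nrm u.
  by rewrite /c expnS natrM natrX invfM -exprVn; ring.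
rewrite ler_wpM2l// -(@ler_pXn2r _ 2) ?nnegrE ?nrm_ge0//.
apply: (nrm_sum_increments S u (a := fun i => c * (2 * i).+1%:R)
  (b := fun i => c * (2 * i).+2%:R)) => i.
- by rewrite mulr_ge0.
- by rewrite ler_wpM2l// ler_nat.
- by rewrite ler_wpM2l// ler_nat mulnS.
Qed.

Lemma dot_generator_sum xi u v n : 0 <= xi -> S xi u = u %[ae m] ->
  dotL2 m (generator_sum xi u n) v =
  riemann_abel (fun x => dotL2 m (S x u) v) 0 xi (2 ^ n).
Proof.
move=> xi0 uxi; rewrite /riemann_abel /generator_sum dotL2Bl !dotL2Zl dotL2_suml.
rewrite mul0r !subr0; congr (_ * _ - _ * _).
  by apply: ae_eq_dotL2; [exact: ae_eq_sym|exact: ae_eq_refl].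
by apply: eq_bigr => i _; rewrite add0r.
Qed.

Lemma range_const xi u v x : 0 <= xi -> xi <= x -> S xi u = u %[ae m] ->
  dotL2 m (S x u) v = dotL2 m u v.
Proof.
move=> xi0 xix uxi; apply: ae_eq_dotL2; last exact: ae_eq_refl.
have x0 := le_trans xi0 xix.
apply: filterS3 (sf_nested S u xi0 xix) (sf_ae_eq S x0 uxi) uxi => z h1 h2 h3 _.
by rewrite -(h2 I) (h1 I) (h3 I).
Qed.

(** The spectral measures of [u + v] and [u - v] may charge [(xi, r]], but after
    polarization only [S x u] remains there, and it is constant on [[xi, r]]. *)
Lemma spectral_integral_upto_range xi u v r n : 0 <= xi -> xi <= r ->
  S xi u = u %[ae m] ->
  `|spectral_integral_upto S u v r - dotL2 m (generator_sum xi u n) v| <=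
  r * (nrm (u + v) ^+ 2 + nrm (u - v) ^+ 2) * 2^-1 ^+ n.
Proof.
move=> xi0 xir uxi.
have cdfP x : 0 <= x ->
    4^-1 * (spectral_cdf S (u + v) x - spectral_cdf S (u - v) x) = dotL2 m (S x u) v.
  by move=> x0; rewrite !spectral_cdfE// polarization.
have splitI w : \int[spectral_measure S w]_(x in `[0, r]) x =
    \int[spectral_measure S w]_(x in `]0, xi]) x +
    \int[spectral_measure S w]_(x in `]xi, r]) x.
  rewrite -Rintegral_itvoc_cat// Rintegral_mkcond [RHS]Rintegral_mkcond.
  apply: eq_Rintegral => x _; rewrite !patchE !mem_setE !in_itv/=.
  by have [|//|<-] := ltgtP 0 x; rewrite ?if_same.
rewrite /spectral_integral_upto !splitI.
have N0 : (0 < 2 ^ n)%N by rewrite expn_gt0.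
have Nn : ((2 ^ n)%:R : R)^-1 = 2^-1 ^+ n by rewrite natrX exprVn.
have e1 w := riemann_abel_error S w xi0 N0.
have e2 w := riemann_abel_error S w xir N0.
have polR a b : 0 <= a -> a <= b ->
    4^-1 * (riemann_abel (spectral_cdf S (u + v)) a b (2 ^ n) -
            riemann_abel (spectral_cdf S (u - v)) a b (2 ^ n)) =
    riemann_abel (fun x => dotL2 m (S x u) v) a b (2 ^ n).
  move=> a0 ab; rewrite /riemann_abel -!cdfP ?(le_trans a0 ab)//.
  have -> : \sum_(i < 2 ^ n) dotL2 m (S (a + (b - a) / (2 ^ n)%:R * i.+1%:R) u) v =
      4^-1 * (\sum_(i < 2 ^ n) spectral_cdf S (u + v) (a + (b - a) / (2 ^ n)%:R * i.+1%:R) -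
       \sum_(i < 2 ^ n) spectral_cdf S (u - v) (a + (b - a) / (2 ^ n)%:R * i.+1%:R)).
    rewrite -sumrB mulr_sumr; apply: eq_bigr => i _; rewrite cdfP//.
    by rewrite addr_ge0// mulr_ge0// divr_ge0// subr_ge0.
  by ring.
have tail : riemann_abel (fun x => dotL2 m (S x u) v) xi r (2 ^ n) = 0.
  rewrite /riemann_abel !(range_const _ xi0 _ uxi)//.
  under eq_bigr => i _ do rewrite (range_const _ xi0 _ uxi) ?lerDl
    ?mulr_ge0 ?divr_ge0 ?subr_ge0//.
  rewrite sumr_const card_ord -[dotL2 m u v *+ _]mulr_natl.
  by field; rewrite pnatr_eq0 -lt0n.
have r0 := le_trans xi0 xir.
have bnd w a b : 0 <= a -> a <= b ->
    spectral_cdf S w b - spectral_cdf S w a <= nrm w ^+ 2.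
  move=> a0 ab; rewrite !spectral_cdfE ?(le_trans a0)//.
  rewrite lerBlDr (le_trans (dot_sf_le_nrm S w (le_trans a0 ab)))// lerDl.
  exact: dot_sf_ge0.
rewrite dot_generator_sum// -(polR 0 xi)//.
have := polR xi r xi0 xir; rewrite tail => tail'.
pose p := nrm (u + v) ^+ 2; pose q := nrm (u - v) ^+ 2.
have p0 : 0 <= p by rewrite sqr_ge0.
have q0 : 0 <= q by rewrite sqr_ge0.
set e := 2^-1 ^+ n in Nn *.
have e0 : 0 <= e by rewrite exprn_ge0.
have err w a b : 0 <= a -> a <= b -> b <= r ->
    `|\int[spectral_measure S w]_(x in `]a, b]) x -
      riemann_abel (spectral_cdf S w) a b (2 ^ n)| <= r * nrm w ^+ 2 * e.
  move=> a0 ab br; apply: le_trans (riemann_abel_error S w ab N0) _.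
  rewrite Nn mulrAC ler_wpM2r//.
  apply: ler_pM; rewrite ?subr_ge0 ?bnd//.
    exact: spectral_cdf_nondecreasing.
  by rewrite lerBlDr (le_trans br)// lerDl.
have := err (u + v) 0 xi (lexx _) xi0 xir.
have := err (u - v) 0 xi (lexx _) xi0 xir.
have := err (u + v) xi r xi0 xir (lexx _).
have := err (u - v) xi r xi0 xir (lexx _).
rewrite -/p -/q; move: tail'.
have -> : r * (p + q) * e = r * p * e + r * q * e by ring.
have : 0 <= r * p * e by rewrite mulr_ge0// mulr_ge0.
have : 0 <= r * q * e by rewrite mulr_ge0// mulr_ge0.
move: (r * p * e) (r * q * e) => X Y Y0 X0.
move: (riemann_abel _ _ _ _) (riemann_abel _ _ _ _) (riemann_abel _ _ _ _)
  (riemann_abel _ _ _ _) (Rintegral _ _ _) (Rintegral _ _ _)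
  (Rintegral _ _ _) (Rintegral _ _ _) => k1 k2 k3 k4 i1 i2 i3 i4.
rewrite !ler_norml => t /andP[a1 a2] /andP[b1 b2] /andP[c1 c2] /andP[d1 d2].
by apply/andP; split; lra.
Qed.

End SpectralGenerator.

Section SpectralDomain.
Context d (T : measurableType d) (R : realType).
Variables (m : {measure set T -> \bar R}) (S : spectral_family m).
Hypothesis mT : (m setT < +oo)%E.
Implicit Types (u v w : L2 m) (xi : R).

(** The spectral measure of a vector in the range of [S xi] does not charge
    [(xi, +oo[]. *)
Lemma range_moment_finite xi u : 0 <= xi -> S xi u = u %[ae m] ->
  (\int[spectral_measure S u]_(x in `[0%R, +oo[) (x ^+ 2)%:E < +oo)%E.
Proof.
move=> xi0 uxi.
pose mu := spectral_measure S u.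
have null : mu (`]xi, +oo[%classic : set (measurableTypeR R)) = 0%E.
  rewrite itv_bndy_bigcup_BRight; apply/eqP; rewrite -measure_le0.
  apply: le_trans (measure_sigma_subadditive _ _ _ (@subset_refl _ _)) _ => //.
    by apply: bigcup_measurable => n _; exact: measurable_itv.
  rewrite eseries0// => n _ _; rewrite -[LHS]/(mu _) /mu.
  rewrite spectral_measure_itvoc ?lerDl// !spectral_cdfE ?addr_ge0//.
  by rewrite !(range_const _ xi0 _ uxi) ?lerDl// subrr.
have msq (D : set (measurableTypeR R)) : measurable_fun D (fun x : R => (x ^+ 2)%:E).
  by apply/measurable_EFinP/measurable_funX; exact: measurable_id.
have sq0 (D : set (measurableTypeR R)) x : D x -> (0 <= (x ^+ 2)%:E :> \bar R)%E.
  by rewrite lee_fin sqr_ge0.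
have mitv (i : interval R) : measurable ([set` i] : set (measurableTypeR R)).
  exact: measurable_itv.
rewrite (@ge0_negligible_integral _ _ _ mu _ _ _ (mitv `]xi, +oo[) (mitv `[0, +oo[)
  (msq _) (@sq0 _) null).
apply: (@le_lt_trans _ _ (\int[mu]_(x in (`](-1)%R, xi]%classic : set (measurableTypeR R))) (xi ^+ 2)%:E)%E).
  apply: (@le_trans _ _ (\int[mu]_(x in `[0%R, +oo[%classic `\` `]xi, +oo[%classic) (xi ^+ 2)%:E)%E).
    apply: ge0_le_integral.
    - by apply: measurableD; exact: mitv.
    - by move=> x _; rewrite lee_fin sqr_ge0.
    - exact: msq.
    - exact: measurable_cst.
    move=> x []/=; rewrite !in_itv/= !andbT => x0 /negP; rewrite -leNgt => xxi.
    by rewrite lee_fin ler_pXn2r ?nnegrE.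
  apply: ge0_subset_integral.
  - by apply: measurableD; exact: mitv.
  - exact: mitv.
  - exact: measurable_cst.
  - by move=> x _; rewrite lee_fin sqr_ge0.
  move=> x []/=; rewrite !in_itv/= !andbT => x0 /negP; rewrite -leNgt => ->.
  by rewrite andbT (lt_le_trans _ x0)// ltrN10.
rewrite integral_cst// spectral_measure_itvoc ?(le_trans _ xi0) ?lerN10//.
exact: ltry.
Qed.

(** The opposite of the generator is bounded by [xi] on the range of [S xi]: its
    value [g] is the limit of the Riemann sums [generator_sum], projected onto that
    range. *)
Lemma spectral_range_generator xi u : 0 <= xi -> S xi u = u %[ae m] ->
  exists g : L2 m, [/\ S xi g = g %[ae m], nrm g <= xi * nrm u,
    (\int[spectral_measure S u]_(x in `[0%R, +oo[) (x ^+ 2)%:E < +oo)%E &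
    forall v, spectral_integral_upto S u v r @[r --> +oo] --> dotL2 m g v].
Proof.
move=> xi0 uxi.
have C0 : 0 <= xi * nrm u / 2 by rewrite divr_ge0// mulr_ge0 ?nrm_ge0.
have [g0 g0P] := L2_fast_cauchy_cvg mT C0 (fun n => generator_sum_cauchy S u n xi0).
exists (S xi g0).
have dotE v n : `|dotL2 m (generator_sum S xi u n) v - dotL2 m (S xi g0) v| <=
    2 * (xi * nrm u / 2) * nrm v * 2^-1 ^+ n.
  have -> : dotL2 m (generator_sum S xi u n) v = dotL2 m (generator_sum S xi u n) (S xi v).
    rewrite !(dot_generator_sum _ _ xi0 uxi) /riemann_abel.
    have E x : 0 <= x -> x <= xi -> dotL2 m (S x u) (S xi v) = dotL2 m (S x u) v.
      by move=> x0 xxi; rewrite dot_sf_nested.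
    rewrite !mul0r E//; congr (_ - _ * _); apply: eq_bigr => i _.
    by rewrite E// add0r subr0 ?grid_ge0 ?grid_le.
  rewrite sf_selfadjoint// -dotL2Bl (le_trans (cauchy_schwarz _ _))//.
  rewrite [leRHS]mulrAC ler_pM ?nrm_ge0//.
  exact: nrm_sf_le.
split.
- exact: sf_idempotent.
- apply: le_trans (nrm_sf_le S _ xi0) _.
  apply/ler_addgt0Pr => e e0.
  have : 2 * (xi * nrm u / 2) * 2^-1 ^+ n @[n --> \oo] --> (0 : R).
    by apply: (@cvg_geometric R _ 2^-1); rewrite ger0_norm// invf_lt1// ltr1n.
  move=> /cvgr_lt /(_ _ e0) [n _ /(_ n (leqnn n)) ne].
  have -> : g0 = generator_sum S xi u n - (generator_sum S xi u n - g0).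
    by rewrite opprB addrC subrK.
  apply: le_trans (nrmB _ _) _; apply: lerD; first exact: nrm_generator_sum.
  by apply: (le_trans (g0P n)); exact: ltW.
- exact: range_moment_finite uxi.
- move=> v; apply: cvg_near_cst; near=> r.
  have xir : xi <= r by near: r; apply: nbhs_pinfty_ge; rewrite num_real.
  apply/eqP; rewrite -subr_eq0; apply/eqP.
  pose K1 := r * (nrm (u + v) ^+ 2 + nrm (u - v) ^+ 2).
  pose K2 := 2 * (xi * nrm u / 2) * nrm v.
  apply: (@eq0_half_powers _ _ (K1 + K2)) => n.
  rewrite mulrDl -(subrKA (dotL2 m (generator_sum S xi u n) v)).
  rewrite (le_trans (ler_normD _ _))// lerD//.
  exact: spectral_integral_upto_range.
Unshelve. all: by end_near. Qed.

(** Chebyshev's inequality for the spectral measure. *)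
Lemma spectral_energy_tail xi u : 0 <= xi ->
  ((xi * (nrm u ^+ 2 - dotL2 m (S xi u) u))%:E <= spectral_energy S u)%E.
Proof.
rewrite le_eqVlt => /predU1P[<-|xi0].
  by rewrite mul0r /spectral_energy integral_ge0// => x /=; rewrite in_itv/= andbT lee_fin.
apply/lee_addgt0Pr => e e0.
have xi0' := ltW xi0.
(* Up to [e / xi] the mass above [xi] lies in a bounded interval [(xi, b]]. *)
have : nrm (S b u - u) @[b --> +oo] --> (0 : R).
  have := sf_total S u; under eq_cvg do rewrite normL2E.
  by move/fine_cvg.
have e0' : 0 < Num.sqrt (e / xi) by rewrite sqrtr_gt0 divr_gt0.
move=> /cvgr_lt /(_ _ e0') near_b.
near (pinfty_nbhs R) => b.
have xib : xi <= b by near: b; apply: nbhs_pinfty_ge; rewrite num_real.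
have b0 := le_trans xi0' xib.
have tail : nrm u ^+ 2 - dotL2 m (S b u) u <= e / xi.
  rewrite -nrm_sub_sf// -nrmN opprB -(sqr_sqrtr (ltW (divr_gt0 e0 xi0))).
  rewrite ler_pXn2r ?nnegrE ?nrm_ge0 ?sqrtr_ge0// ltW//.
  by near: b.
have : ((xi * (dotL2 m (S b u) u - dotL2 m (S xi u) u))%:E <= spectral_energy S u)%E.
  rewrite -!(spectral_cdfE S)//.
  apply: (@le_trans _ _ (\int[spectral_measure S u]_(x in (`]xi, b]%classic : set (measurableTypeR R))) xi%:E)%E).
    by rewrite integral_cst// spectral_measure_itvoc// EFinM.
  apply: (@le_trans _ _ (\int[spectral_measure S u]_(x in (`]xi, b]%classic : set (measurableTypeR R))) x%:E)%E).
    apply: ge0_le_integral.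
    - exact: measurable_itv.
    - by move=> x _; rewrite lee_fin.
    - exact: measurable_cst.
    - by apply/measurable_EFinP; exact: measurable_id.
    by move=> x /=; rewrite in_itv/= lee_fin => /andP[/ltW].
  apply: ge0_subset_integral.
  - exact: measurable_itv.
  - exact: measurable_itv.
  - by apply/measurable_EFinP; exact: measurable_id.
  - by move=> x /=; rewrite in_itv/= andbT lee_fin.
  - move=> x /=; rewrite !in_itv/= andbT => /andP[xix _].
    by rewrite (le_trans xi0')// ltW.
move/(leeD2r e%:E); apply: le_trans; rewrite -EFinD lee_fin.
rewrite (le_trans (ler_wpM2l xi0' (_ : _ <= (dotL2 m (S b u) u - dotL2 m (S xi u) u) + e / xi)))//.
  by move: tail; lra.
by rewrite mulrDr mulrCA divff ?mulr1 ?gt_eqF.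
Unshelve. all: by end_near. Qed.

End SpectralDomain.

Section SpectralLimits.
Context d (T : measurableType d) (R : realType).
Variables (m : {measure set T -> \bar R}) (S : spectral_family m).
Implicit Types (u : L2 m) (xi : R).

(** By [spectral_energy_tail] the distribution function has reached [nrm u ^+ 2] at
    every [xi > 0], hence at [0] by right-continuity. *)
Lemma spectral_energy0 u : spectral_energy S u = 0%E -> nrm (u - S 0 u) = 0.
Proof.
move=> e0.
have le_cdf xi : 0 < xi -> nrm u ^+ 2 <= spectral_cdf S u xi.
  move=> xi0; have := spectral_energy_tail S u (ltW xi0).
  by rewrite e0 lee_fin pmulr_rle0// subr_le0 /spectral_cdf (ltW xi0).
have : nrm u ^+ 2 <= spectral_cdf S u 0.
  have lim := @spectral_cdf_right_continuous _ _ _ _ S u 0.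
  rewrite -(cvg_lim (@Rhausdorff R) lim).
  apply: limr_ge; first by apply/cvg_ex; exists (spectral_cdf S u 0).
  near=> xi; apply: le_cdf; near: xi; exact: nbhs_right_gt.
rewrite /spectral_cdf lexx -subr_le0 -nrm_sub_sf// => le0.
by apply/eqP; rewrite -sqrf_eq0 eq_le le0 sqr_ge0.
Unshelve. all: by end_near. Qed.

(** The frequencies above [xi] are controlled by the energy. *)
Lemma nrm_sub_sf_decomposition u xi : 0 < xi -> (spectral_energy S u < +oo)%E ->
  nrm (u - S 0 u) ^+ 2 <= fine (spectral_energy S u) / xi + dotL2 m (S xi u) u.
Proof.
move=> xi0 eoo; have := spectral_energy_tail S u (ltW xi0).
have e0 : (0 <= spectral_energy S u)%E.
  by apply: integral_ge0 => x /=; rewrite in_itv/= andbT lee_fin.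
rewrite -[X in (_ <= X)%E]fineK ?ge0_fin_numE// lee_fin mulrC -ler_pdivlMr//.
have := dot_sf_ge0 S u (lexx 0); rewrite nrm_sub_sf//; lra.
Qed.

Lemma nrm_null u : m setT = 0%E -> nrm u = 0.
Proof.
move=> m0; rewrite /nrm /dotL2 /Rintegral null_set_integral ?sqrtr0//.
exact: measurable_int (L2_mul_integrable u u).
Qed.

(** [S xi u] would vanish for every [xi > 0], while it tends to [u]. *)
Lemma nrm_eq0_of_sf u : (forall xi, 0 < xi -> dotL2 m (S xi u) u <= 0) -> nrm u = 0.
Proof.
move=> sf0.
have h : \forall xi \near +oo, ((nrm u)%:E <= normL2 m (S xi u - u)%R)%E.
  near=> xi.
  have xi0 : 0 < xi by near: xi; exact: nbhs_pinfty_gt.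
  rewrite normL2E lee_fin -(nrmN (S xi u - u)) opprB.
  have : nrm u ^+ 2 <= nrm (u - S xi u) ^+ 2.
    by rewrite nrm_sub_sf ?(ltW xi0)// lerBrDl gerDr sf0.
  by rewrite ler_pXn2r ?nnegrE ?nrm_ge0.
have lim := @sf_total _ _ _ _ S u.
have : ((nrm u)%:E <= 0)%E.
  rewrite -(cvg_lim (@ereal_hausdorff R) lim).
  by apply: lime_ge h; apply/cvg_ex; exists 0%E.
by rewrite lee_fin => le0; apply/eqP; rewrite eq_le le0 nrm_ge0.
Unshelve. all: by end_near. Qed.

End SpectralLimits.

(** * Low frequency vectors along an orbit of the semigroup *)

Section OrbitBound.
Context d (T : measurableType d) (R : realType).
Variables (m : {measure set T -> \bar R}) (S : spectral_family m).
Hypothesis mT : (m setT < +oo)%E.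
Variable P : R -> (T -> R) -> T -> R.
Hypothesis mP : forall h (u : L2 m), 0 < h -> measurable_fun setT (P h u).
Hypothesis gen : spectral_family_of_opp S (generator P).
Variables (psi : R -> L2 m) (K : R).
Hypothesis psiK : forall s, 0 <= s -> nrm (psi s) <= K.
Hypothesis sym : forall h s (u v : L2 m), 0 < h -> 0 <= s -> v = P h u :> (T -> R) ->
  dotL2 m v (psi s) = dotL2 m u (psi (s + h)).
Implicit Types (u v w : L2 m) (xi : R).

Lemma normL2_lt_L2 (f : T -> R) (e : R) : measurable_fun setT f ->
  (normL2 m f < e%:E)%E -> exists2 w : L2 m, w = f :> (T -> R) & nrm w < e.
Proof.
move=> mf fe.
have fL : f \in Lfun m 2%:E.
  rewrite inE/=; apply/andP; split; rewrite inE//=.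
  by rewrite /finite_norm (lt_trans fe)// ltry.
by exists (Lfun_Sub (lee1n 2) fL) => //; rewrite -lte_fin -normL2E.
Qed.

(** In the range of [S xi], [psi] moves in direction [u] with speed at most
    [xi] times its own size: [B u], the value of the opposite of the generator
    at [u], stays in that range and has norm at most [xi * nrm u]. *)
Lemma orbit_increment xi u (N s t : R) : 0 <= xi -> 0 <= s -> s <= t ->
  S xi u = u %[ae m] ->
  (forall v r, 0 <= r -> r <= t -> S xi v = v %[ae m] ->
     `|dotL2 m v (psi r)| <= N * nrm v) -> 0 <= N ->
  `|dotL2 m u (psi s)| <= `|dotL2 m u (psi t)| + (t - s) * (xi * N * nrm u).
Proof.
move=> xi0 s0 st uxi NP N0.
have [g [gxi gle gsq gint]] := spectral_range_generator mT xi0 uxi.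
have gu : generator P u (- g).
  by apply/gen; split => // v; rewrite dotL2Nl opprK; exact: gint.
move: st; rewrite le_eqVlt => /predU1P[<-|st]; first by rewrite subrr mul0r addr0.
have K0 : 0 <= K by rewrite (le_trans _ (psiK s0))// nrm_ge0.
apply/ler_addgt0Pr => e e0.
(* [e1] is the error allowed to the difference quotients; over [t - s], along an
   orbit of norm at most [K], it accumulates to less than [e]. *)
pose e1 := e / ((t - s) * (K + 1)).
have ts0 : 0 < t - s by rewrite subr_gt0.
have K1 : 0 < K + 1 by rewrite ltr_wpDl.
have e10 : 0 < e1 by rewrite divr_gt0// mulr_gt0.
have [dl dl0 dlP] : exists2 dl : R, 0 < dl & forall h, 0 < h -> h < dl ->
    (normL2 m (fun x => h^-1 * (P h u x - u x) - (- g) x)%R < e1%:E)%E.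
  have : \forall h \near 0^'+,
      (normL2 m (fun x => h^-1 * (P h u x - u x) - (- g) x)%R < e1%:E)%E.
    apply: (gu [set y | (y < e1%:E)%E]).
    by apply: open_nbhs_nbhs; split; [exact: open_ereal_lt_ereal|rewrite /= lte_fin].
  move=> [dl /= dl0 dlP]; exists dl => // h h0 hdl.
  by apply: dlP => //=; rewrite sub0r normrN gtr0_norm.
pose n := (Num.truncn ((t - s) / dl)).+1.
have n0 : 0 < n%:R :> R by rewrite ltr0n.
pose h := (t - s) / n%:R.
have h0 : 0 < h by rewrite divr_gt0.
have hdl : h < dl.
  by rewrite /h ltr_pdivrMr// mulrC -ltr_pdivrMr// truncnS_gt.
have mr : measurable_fun setT (fun x => h^-1 * (P h u x - u x) - (- g) x).
  apply: measurable_funB => //; apply: measurable_funM => //.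
  by apply: measurable_funB => //; exact: mP.
have [w wE wlt] := normL2_lt_L2 mr (dlP h h0 hdl).
have [v vE] : exists v : L2 m, v = P h u :> (T -> R).
  exists (u + h *: (w - g)); apply/funext => x.
  rewrite -[LHS]/(u x + h * (w x - g x)) wE -[(- g) x]/(- g x) opprK addrK.
  by rewrite mulrA divff ?gt_eqF// mul1r subrKC.
have vE' : v = u + h *: (w - g).
  apply/LfuneqP => x; rewrite vE.
  rewrite -[RHS]/(u x + h * (w x - g x)) wE -[(- g) x]/(- g x) opprK addrK.
  by rewrite mulrA divff ?gt_eqF// mul1r subrKC.
pose c := xi * N * nrm u + e1 * K.
have step r : 0 <= r -> r <= t ->
    `|dotL2 m u (psi r)| <= `|dotL2 m u (psi (r + h))| + h * c.
  move=> r0 rt.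
  have E : dotL2 m u (psi r) = dotL2 m u (psi (r + h)) + h * dotL2 m (g - w) (psi r).
    rewrite -(sym h0 r0 vE) vE' dotL2Dl dotL2Zl !dotL2Bl; ring.
  rewrite E (le_trans (ler_normD _ _))// lerD2l normrM gtr0_norm//.
  rewrite ler_pM2l// dotL2Bl (le_trans (ler_normB _ _))// lerD//.
    rewrite (le_trans (NP _ _ r0 rt gxi))//.
    by rewrite (mulrC xi) -mulrA ler_wpM2l.
  rewrite (le_trans (cauchy_schwarz _ _))// ler_pM ?nrm_ge0 ?psiK//.
  exact: ltW.
have walk k : (k <= n)%N ->
    `|dotL2 m u (psi s)| <= `|dotL2 m u (psi (s + h * k%:R))| + h * k%:R * c.
  elim: k => [_|k IH kn]; first by rewrite !mulr0 mul0r !addr0.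
  apply: (le_trans (IH (ltnW kn))).
  have k0 : 0 <= s + h * k%:R by rewrite addr_ge0// mulr_ge0// ltW.
  have kt : s + h * k%:R <= t.
    rewrite -lerBrDl /h mulrAC ler_pdivrMr// ler_pM2l// ler_nat.
    exact: ltnW.
  have := step _ k0 kt.
  rewrite -addrA -[h in _ + (_ + h)]mulr1 -mulrDr natr1.
  rewrite -[k.+1%:R]natr1 (mulrDr h) mulr1 mulrDl; lra.
have hn : h * n%:R = t - s by rewrite /h divfK// gt_eqF.
have := walk n (leqnn n); rewrite hn subrKC => /le_trans; apply.
rewrite -addrA lerD2l /c mulrDr lerD2l /e1 invfM.
rewrite [leLHS](_ : _ = e * (K / (K + 1))); last by field; rewrite !gt_eqF.
apply: ler_piMr; first exact: ltW.
by rewrite ler_pdivrMr// mul1r lerDl.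
Qed.

(** The best constant [N] in [`|(v, psi r)| <= N * nrm v], for [r <= t] and [v]
    in the range of [S xi], satisfies [N <= nrm (psi t) + xi * t * N]. *)
Lemma orbit_bound xi u (t : R) : 0 <= xi -> 0 <= t -> xi * t = 2^-1 ->
  S xi u = u %[ae m] ->
  `|dotL2 m u (psi 0)| <= 2 * nrm (psi t) * nrm u.
Proof.
move=> xi0 t0 xit uxi.
pose A := [set a | exists v r, [/\ 0 <= r, r <= t, S xi v = v %[ae m], nrm v <= 1 &
  a = `|dotL2 m v (psi r)|]].
have Aub : ubound A K.
  move=> _ [v [r [r0 rt vxi v1 ->]]].
  rewrite (le_trans (cauchy_schwarz _ _))// -[K]mul1r ler_pM ?nrm_ge0//.
  exact: psiK.
have A0 : A 0.
  exists 0, 0; rewrite dotL20l normr0 lexx; split => //.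
  - apply: nrm_eq0; apply/eqP; rewrite eq_le nrm_ge0 andbT.
    by rewrite (le_trans (nrm_sf_le _ _ _))// /nrm dotL20l sqrtr0.
  - by rewrite /nrm dotL20l sqrtr0.
have supA : has_sup A by split; [exists 0|exists K].
pose N := sup A.
have N0 : 0 <= N by apply: ub_le_sup => //; exists K.
have NP v r : 0 <= r -> r <= t -> S xi v = v %[ae m] ->
    `|dotL2 m v (psi r)| <= N * nrm v.
  move=> r0 rt vxi.
  have [v0|v0] := eqVneq (nrm v) 0.
    by rewrite v0 mulr0 (le_trans (cauchy_schwarz _ _))// v0 mul0r.
  have vp : 0 < nrm v by rewrite lt_neqAle eq_sym v0 nrm_ge0.
  rewrite -ler_pdivrMr// mulrC -[X in X * _](@ger0_norm _ (nrm v)^-1) ?invr_ge0 ?nrm_ge0//.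
  rewrite -normrM -dotL2Zl; apply: ub_le_sup; first by exists K.
  exists ((nrm v)^-1 *: v), r; split => //.
    have := sf_linear S (nrm v)^-1 v 0 xi0.
    rewrite addr0; move=> h.
    have h2 : S xi 0 = 0 %[ae m].
      apply: nrm_eq0; apply/eqP; rewrite eq_le nrm_ge0 andbT.
      by rewrite (le_trans (nrm_sf_le _ _ _))// /nrm dotL20l sqrtr0.
    apply: filterS3 h h2 vxi => x e1 e2 e3 _.
    rewrite (e1 I) -[LHS]/((nrm v)^-1 * (S xi v) x + (S xi 0) x) (e2 I) (e3 I).
    by rewrite addr0.
  by rewrite nrmZ ger0_norm ?invr_ge0 ?nrm_ge0// mulVf.
have key v s : 0 <= s -> s <= t -> S xi v = v %[ae m] -> nrm v <= 1 ->
    `|dotL2 m v (psi s)| <= nrm (psi t) + 2^-1 * N.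
  move=> s0 st vxi v1.
  apply: le_trans (orbit_increment xi0 s0 st vxi NP N0) _; apply: lerD.
    rewrite (le_trans (cauchy_schwarz _ _))// -[leRHS]mul1r ler_wpM2r ?nrm_ge0//.
  rewrite -xit (_ : xi * t * N = t * (xi * N * 1)); last by ring.
  apply: ler_pM; rewrite ?subr_ge0 ?mulr_ge0 ?nrm_ge0//; first by rewrite gerBl.
  by apply: ler_wpM2l; rewrite ?mulr_ge0.
have : N <= nrm (psi t) + 2^-1 * N.
  apply: ge_sup; first by exists 0.
  by move=> _ [v [r [r0 rt vxi v1 ->]]]; exact: key.
move=> N2; apply: le_trans (NP u 0 (lexx _) t0 uxi) _.
rewrite ler_wpM2r ?nrm_ge0//; lra.
Qed.

End OrbitBound.

(** * Exhaustion of open sets by compact sets *)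

Lemma countable_union_seq (T : Type) (B : set (set T)) : countable B ->
  exists s : nat -> set T, (forall n, B (s n) \/ s n = set0) /\
    (forall V, B V -> exists n, s n = V).
Proof.
move=> /countable_injP[f finj].
pose s n : set T := if pselect (exists V, B V /\ f V = n) is left h then
  sval (cid h) else set0.
exists s; split.
  move=> n; rewrite /s; case: pselect => [h|_]; last by right.
  by left; case: (cid h) => V [].
move=> V BV; exists (f V); rewrite /s; case: pselect => [h|]; last by case; exists V.
case: (cid h) => W [BW fW] /=.
by apply: finj => //; exact/mem_set.
Qed.

(** Local compactness and Hausdorff separation give every point of [G] a
    neighbourhood with compact closure inside [G]; the members of a countable base
    that sit in such neighbourhoods provide the exhaustion. *)
Lemma compact_exhaustion (E : ptopologicalType) (G : set E) : lccb E -> open G ->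
  exists K W : nat -> set E,
    [/\ forall n, compact (K n) /\ closed (K n),
        forall n, open (W n) /\ W n `<=` K n,
        forall n, K n `<=` K n.+1 /\ W n `<=` W n.+1,
        forall n, K n `<=` G &
        forall x, G x -> exists n, W n x].
Proof.
move=> [hE lc [B cB [Bo Bb]]] oG.
pose B' := [set V | B V /\ compact (closure V) /\ closure V `<=` G].
have cB' : countable B' by apply: sub_countable cB; apply: subset_card_le => V [].
have [s [sP sB']] := countable_union_seq cB'.
have so n : open (s n).
  by have [[/Bo]|->] := sP n => //; exact: open0.
have sc n : compact (closure (s n)).
  have [[_ []]|->] := sP n => //; rewrite closure0; exact: compact0.
have sG n : closure (s n) `<=` G.
  by have [[_ []]|->] := sP n => //; rewrite closure0.
exists (fun n => \bigcup_(i < n) closure (s i)), (fun n => \bigcup_(i < n) s i).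
split.
- move=> n; split.
    elim: n => [|n IH].
      rewrite (_ : \bigcup_(i < 0) _ = set0); first exact: compact0.
      by apply/seteqP; split => x // [].
    rewrite (_ : \bigcup_(i < n.+1) _ = \bigcup_(i < n) closure (s i) `|` closure (s n)).
      exact: compactU.
    apply/seteqP; split => x /=.
      move=> [i /=]; rewrite ltnS leq_eqVlt => /predU1P[->|ni] sx; first by right.
      by left; exists i.
    by case=> [[i ni sx]|sx]; [exists i => //=; exact: ltnW|exists n => /=].
  by apply: closed_bigcup; [exact: finite_II|move=> i _; exact: closed_closure].
- move=> n; split; first by apply: bigcup_open => i _.
  by move=> x [i ni sx]; exists i => //; exact: subset_closure.
- move=> n; split => x [i ni sx]; exists i => //=; exact: ltn_trans ni _.
- by move=> n x [i _]; exact: sG.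
- move=> x Gx.
  have [C] := lc x I; rewrite withinET => Cx [cC clC].
  have reg := compact_regular hE cC Cx.
  have [V Vx VG] : exists2 V, nbhs x V & closure V `<=` C `&` G.
    have [|V Vx cV] := reg (C `&` G); last by exists V.
    by apply: filterI => //; exact: open_nbhs_nbhs.
  have [U [BU Ux] UV] := Bb x V Vx.
  have B'U : B' U.
    split => //; split.
      apply: (@subclosed_compact _ _ C) => //; first exact: closed_closure.
      by move=> y /(closureS UV) /VG[].
    by move=> y /(closureS UV) /VG[].
  have [n sn] := sB' _ B'U.
  by exists n.+1, n => //=; rewrite sn.
Qed.

(** * The one-point compactification as a measurable space *)

Section PointAtInfinity.
Context (E : ptopologicalType).

Lemma closed_some (K : set E) : compact K -> closed K ->
  closed (Some @` K : set (opc E)).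
Proof.
move=> cK clK; rewrite -openC openE => -[x|] /=.
  move=> nKx; rewrite /interior/=.
  have : nbhs x (~` K).
    apply: open_nbhs_nbhs; split; first exact: closed_openC.
    by move=> Kx; apply: nKx; exists x.
  by apply: filterS => y nKy /= [z Kz [zy]]; apply: nKy; rewrite -zy.
move=> _; rewrite /interior/=; exists K => //.
by move=> z [[y nKy <-]|->] /= [k Kk //] [ky]; apply: nKy; rewrite -ky.
Qed.

Lemma measurable_some (A : set (borel E)) : measurable A ->
  measurable (Some @` A : set (borel (opc E))).
Proof.
pose D := [set A : set (borel E) | measurable (Some @` A : set (borel (opc E)))].
suff : <<s @open E >> `<=` D by exact.
apply: smallest_sub.
  split; rewrite /D/=.
  - by rewrite image_set0; exact: measurable0.
  - move=> B mB /=.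
    have -> : Some @` (setT `\` B) = Some @` [set: E] `\` (Some @` B) :> set (option E).
      apply/seteqP; split => x /=.
        by move=> [y [_ nBy] <-]; split; [exists y|move=> [z Bz [zy]]; apply: nBy; rewrite -zy].
      by move=> [[y _ <-] nB]; exists y => //; split => // By; apply: nB; exists y.
    apply: measurableD => //; apply: sub_sigma_algebra.
    exact/one_point_compactification_open_some/openT.
  - move=> F mF /=; rewrite image_bigcup; exact: bigcup_measurable.
move=> B oB; apply: sub_sigma_algebra.
exact: one_point_compactification_open_some.
Qed.

Lemma measurable_cemetery : measurable ([set None] : set (borel (opc E))).
Proof.
rewrite (_ : [set None] = ~` (Some @` [set: borel E])).
  by apply: measurableC; exact: measurable_some.
by apply/seteqP; split => [_ -> [//]|[x|//] /= h]; exfalso; apply: h; exists x.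
Qed.

Lemma measurable_point (z : opc E) : hausdorff_space E ->
  measurable ([set z] : set (borel (opc E))).
Proof.
move=> hE; case: z => [x|]; last exact: measurable_cemetery.
rewrite -(image_set1 Some x); apply: measurable_some.
rewrite -(setCK [set x]); apply: measurableC; apply: open_borel; apply: closed_openC.
exact/accessible_closed_set1/hausdorff_accessible.
Qed.

Lemma measurable_fun_some :
  measurable_fun setT (Some : borel E -> borel (opc E)).
Proof.
apply: (@measurability _ _ (borel E) (borel (opc E)) setT Some (@open (opc E))) => //.
move=> _ [B oB <-]; rewrite setTI; apply: sub_sigma_algebra.
by have /continuousP/(_ B oB) := @one_point_compactification_some_continuous E.
Qed.

Lemma measurable_fun_extend0 d' (V : measurableType d') (v0 : V) (f : borel E -> V) :
  measurable_fun setT f ->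
  measurable_fun setT (extend0 v0 f : borel (opc E) -> V).
Proof.
move=> mf _ B mB; rewrite setTI.
have mfB : measurable (f @^-1` B) by rewrite -[_ @^-1` _]setTI; exact: mf.
have := measurable_some mfB.
have mNone := measurable_cemetery.
have [Bv0|nBv0] := pselect (B v0) => mS.
  rewrite (_ : _ @^-1` _ = Some @` (f @^-1` B) `|` [set None]).
    exact: measurableU.
  apply/seteqP; split => [[x|]|[x|]] /=.
  - by left; exists x.
  - by right.
  - by move=> [[y By [<-]]|].
  - by [].
rewrite (_ : _ @^-1` _ = Some @` (f @^-1` B))//.
apply/seteqP; split => [[x|]|[x|]] /=.
- by exists x.
- by [].
- by move=> [y By [<-]].
- by move=> [].
Qed.

End PointAtInfinity.

(** * Exit times and survival events *)

Lemma sigma_algebra_bigcapT (T : Type) (F : set (set T)) (A : nat -> set T) :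
  sigma_algebra setT F -> (forall n, F (A n)) -> F (\bigcap_n A n).
Proof.
move=> [F0 FC FU] FA; rewrite -[\bigcap_n _]setCK setC_bigcap -setTD.
by apply: (FC); apply: FU => n; rewrite -setTD; exact: FC.
Qed.

Section Paths.
Context (R : realType) (E : ptopologicalType) d (Omega : measurableType d).
Variable X : hunt_process R E Omega.
Local Notation F := (hp_filt X).
Local Notation path := (hp_path X).
Implicit Types (K W G : set E) (t s r : R) (w : Omega).

Definition stay K t : set Omega :=
  [set w | forall r, 0 <= r -> r <= t -> (Some @` K) (path r w)].

Lemma stay_mono K t s : s <= t -> stay K t `<=` stay K s.
Proof. by move=> st w Kw r r0 rs; apply: Kw => //; exact: le_trans st. Qed.

Lemma stay_sub K K' t : K `<=` K' -> stay K t `<=` stay K' t.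
Proof. by move=> KK w Kw r r0 rt; have [x Kx <-] := Kw r r0 rt; exists x => //; exact: KK. Qed.

Lemma path_right_open (U : set (opc E)) t w : 0 <= t -> open U -> U (path t w) ->
  exists2 e, 0 < e & forall r, t <= r -> r < t + e -> U (path r w).
Proof.
move=> t0 oU Ut.
have : \forall r \near t^'+, U (path r w).
  have : nbhs (path t w) U by exact: open_nbhs_nbhs.
  exact: (hp_right_continuous t0).
move=> [e /= e0 eP]; exists e => // r; rewrite le_eqVlt => /predU1P[<-//|tr re].
by apply: eP => //=; rewrite ltr0_norm ?subr_lt0// opprB ltrBlDl.
Qed.

(** Right-continuity reduces the uncountable condition to dyadic times. *)
Lemma stay_dyadic K t : closed (Some @` K : set (opc E)) -> 0 <= t ->
  stay K t = \bigcap_m \bigcap_(i in [set i | (i <= 2 ^ m)%N])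
    (path (t / (2 ^ m)%:R * i%:R) @^-1` (Some @` K)).
Proof.
move=> cK t0; apply/seteqP; split => w.
  by move=> Kw m _ i /= im; apply: Kw; [exact: grid_ge0|exact: grid_le].
move=> Kw r r0; rewrite le_eqVlt => /predU1P[->|rt].
  have := Kw 0%N I 1%N (leqnn _); by rewrite /= expn0 invr1 !mulr1.
apply: contrapT => nK.
have tp : 0 < t := le_lt_trans r0 rt.
have [e e0 eP] := path_right_open r0 (closed_openC cK) nK.
have [m me] : exists m, t / (2 ^ m)%:R < e.
  have : t * 2^-1 ^+ n @[n --> \oo] --> (0 : R).
    by apply: (@cvg_geometric R t 2^-1); rewrite ger0_norm// invf_lt1// ltr1n.
  move=> /cvgr_lt /(_ _ e0) [m _ /(_ m (leqnn m)) tm]; exists m.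
  by rewrite natrX -exprVn.
set N := (2 ^ m)%N in me.
have N0 : 0 < N%:R :> R by rewrite ltr0n expn_gt0.
pose i := (Num.truncn (r / (t / N%:R))).+1.
have dt0 : 0 < t / N%:R by rewrite divr_gt0.
have ri : r < t / N%:R * i%:R.
  by rewrite mulrC -ltr_pdivrMr// truncnS_gt.
have ir : t / N%:R * i%:R <= r + t / N%:R.
  rewrite /i -natr1 mulrDr mulr1 lerD2r mulrC -ler_pdivlMr//.
  by rewrite truncn_le// divr_ge0// ltW.
have iN : (i <= N)%N.
  rewrite /i -(ltr_nat R).
  apply: (@le_lt_trans _ _ (r / (t / N%:R))); first by rewrite truncn_le divr_ge0// ltW.
  by rewrite invf_div mulrA ltr_pdivrMr// mulrC ltr_pM2l.
apply: (eP (t / N%:R * i%:R)); first exact: ltW.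
  by rewrite (le_lt_trans ir)// ltrD2l.
exact: (Kw m I i iN).
Qed.

Lemma filt_stay K t : closed (Some @` K : set (opc E)) -> 0 <= t ->
  F t (stay K t).
Proof.
move=> cK t0; rewrite stay_dyadic//.
have sF := hp_filt_sigma X t0.
apply: sigma_algebra_bigcapT => // m.
rewrite (_ : \bigcap_(i in _) _ = \bigcap_i
   (if (i <= 2 ^ m)%N then path (t / (2 ^ m)%:R * i%:R) @^-1` (Some @` K) else setT)).
  apply: sigma_algebra_bigcapT => // i; case: ifPn => im.
    have g0 : 0 <= t / (2 ^ m)%:R * i%:R by exact: grid_ge0.
    apply: (hp_filt_mono g0 (grid_le t0 im)).
    apply: hp_adapted => //; rewrite -[Some @` K]setCK; apply: measurableC.
    by apply: sub_sigma_algebra; exact: closed_openC.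
  by case: sF => F0 FC _; rewrite -(setD0 setT); exact: FC.
apply/seteqP; split => w /= h i.
  by move=> _; case: ifPn => // im; exact: h.
by move=> /= im; have := h i I; rewrite im.
Qed.

Lemma measurable_stay K t : closed (Some @` K : set (opc E)) -> 0 <= t ->
  measurable (stay K t).
Proof. by move=> cK t0; exact: hp_filt_measurable t0 (filt_stay cK t0). Qed.

Lemma exit_time_ge0 G w : (0 <= exit_time X G w)%E.
Proof. by apply: le_ereal_inf_tmp => _ [t [t0 _] <-]; rewrite lee_fin. Qed.

Lemma exit_time_gt_stay G t w : (t%:E < exit_time X G w)%E -> stay G t w.
Proof.
move=> tG r r0 rt; apply: contrapT => nG.
move: tG; rewrite ltNge => /negP; apply.
apply: (@le_trans _ _ r%:E); last by rewrite lee_fin.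
by apply: ereal_inf_lbound; exists r.
Qed.

Lemma stay_exit_time_ge G t w : stay G t w -> (t%:E <= exit_time X G w)%E.
Proof.
move=> Gt; apply: le_ereal_inf_tmp => _ [r [r0 nG] <-].
by rewrite lee_fin leNgt; apply/negP => rt; apply: nG; apply: Gt => //; exact: ltW.
Qed.

(** The inequality is strict because the path, being in the open set [G] at time
    [t], remains there for some time by right-continuity. *)
Lemma stay_exit_time_gt K G t w : 0 <= t -> open G -> K `<=` G -> stay K t w ->
  (t%:E < exit_time X G w)%E.
Proof.
move=> t0 oG KG /(stay_sub KG) Gt.
have [e e0 eP] := path_right_open t0 (one_point_compactification_open_some G oG)
  (Gt t t0 (lexx _)).
apply: (@lt_le_trans _ _ (t + e / 2)%:E); first by rewrite lte_fin ltrDl divr_gt0.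
apply: stay_exit_time_ge => r r0 rt.
have [rt'|tr] := leP r t; first exact: Gt.
apply: eP; first exact: ltW.
by rewrite (le_lt_trans rt)// ltrD2l ltr_pdivrMr// ltr_pMr// ltr1n.
Qed.

Lemma exit_time_mono K G w : K `<=` G -> (exit_time X K w <= exit_time X G w)%E.
Proof.
move=> KG; apply: ereal_inf_le_tmp => _ [t [t0 nG] <-]; exists t => //; split => //.
by move=> [x Kx xE]; apply: nG; exists x => //; exact: KG.
Qed.

(** The exit time of a closed set is a stopping time: [exit_time > t] means that
    the path stays in [K] until some time strictly after [t], and the filtration
    is right-continuous. *)
Lemma stopping_exit_time K : closed (Some @` K : set (opc E)) ->
  stopping_time F (exit_time X K).
Proof.
move=> cK; split; first exact: exit_time_ge0.
move=> t t0; apply: hp_filt_right => // s ts.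
have s0 : 0 <= s by rewrite (le_trans t0)// ltW.
have [F0 FC FU] := hp_filt_sigma X s0.
have [k0 k0P] : exists k0, t + k0.+1%:R^-1 < s.
  exists (Num.truncn (s - t)^-1).
  by rewrite -ltrBrDl -[ltRHS]invrK ltf_pV2 ?posrE ?invr_gt0 ?subr_gt0 ?ltr0n// truncnS_gt.
rewrite (_ : [set w | _] = setT `\` \bigcup_k stay K (t + (k0 + k).+1%:R^-1)).
  apply: FC; apply: FU => k.
  have h0 : 0 <= t + (k0 + k).+1%:R^-1 by rewrite addr_ge0.
  apply: (hp_filt_mono h0); last exact: filt_stay.
  rewrite ltW// (le_lt_trans _ k0P)// lerD2l lef_pV2 ?posrE ?ltr0n//.
  by rewrite ler_nat ltnS leq_addr.
apply/seteqP; split => w /=.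
  move=> Kt; split => // -[k _ /stay_exit_time_ge h].
  move: (le_trans h Kt); rewrite lee_fin gerDl leNgt invr_gt0 ltr0n//.
move=> [_ nK]; rewrite leNgt; apply/negP => tK; apply: nK.
have [u tu uK] : exists2 u, t < u & (u%:E <= exit_time X K w)%E.
  move: tK; case: (exit_time X K w) => [u|_|//]; last by exists (t + 1); rewrite ?ltrDl ?leey.
  by rewrite lte_fin => tu; exists u.
exists (Num.truncn (u - t)^-1) => //.
apply: exit_time_gt_stay; apply: lt_le_trans uK; rewrite lte_fin -ltrBrDl.
rewrite -[ltRHS]invrK ltf_pV2 ?posrE ?invr_gt0 ?subr_gt0 ?ltr0n//.
rewrite (lt_le_trans (truncnS_gt _))// ler_nat ltnS leq_addl//.
Qed.

End Paths.

Section Survival.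
Context (R : realType) (E : ptopologicalType) d (Omega : measurableType d).
Variable X : hunt_process R E Omega.
Variables (G : set E) (K W : nat -> set E).
Hypothesis oG : open G.
Hypothesis KP : forall n, compact (K n) /\ closed (K n).
Hypothesis WP : forall n, open (W n) /\ W n `<=` K n.
Hypothesis KWS : forall n, K n `<=` K n.+1 /\ W n `<=` W n.+1.
Hypothesis KG : forall n, K n `<=` G.
Hypothesis GW : forall x, G x -> exists n, W n x.
Local Notation path := (hp_path X).

Lemma closed_some_exhaustion n : closed (Some @` K n : set (opc E)).
Proof. by have [] := KP n; exact: closed_some. Qed.

Lemma exhaustion_le n m : (n <= m)%N -> K n `<=` K m /\ W n `<=` W m.
Proof.
elim: m => [|m IH]; first by rewrite leqn0 => /eqP ->; split.
rewrite leq_eqVlt => /predU1P[->|]; [by split|]; rewrite ltnS => /IH[nK nW].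
by have [mK mW] := KWS m; split => x; [move/nK/mK|move/nW/mW].
Qed.

(** Quasi-left-continuity excludes that the path leaves every [K n] before [t]
    while staying in [G] up to [t]: at the limit of the exit times of the [K n]
    the path is outside every [W n]. *)
Lemma exit_time_exhaustion x t :
  \forall w \ae hp_law X x, (t%:E < exit_time X G w)%E -> exists n, stay X (K n) t w.
Proof.
have := @hp_quasi_left_continuous _ _ _ _ X (fun n => exit_time X (K n)) x
  (fun n => stopping_exit_time X (@closed_some_exhaustion n))
  (fun n w => exit_time_mono X w (KWS n).1).
apply: filterS => w /=; set soo := ereal_sup _ => qlc tG.
apply: contrapT => /forallNP nK.
have sn_le n : (exit_time X (K n) w <= t%:E)%E.
  by rewrite leNgt; apply/negP => /exit_time_gt_stay; exact: nK.
have soo_le : (soo <= t%:E)%E by apply: ge_ereal_sup => _ [n _ <-]; exact: sn_le.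
have soo_ge0 : (0 <= soo)%E.
  apply: (@le_trans _ _ (exit_time X (K 0%N) w)); first exact: exit_time_ge0.
  by apply: ereal_sup_ubound; exists 0%N.
have [s sE] : exists s, soo = s%:E.
  by move: soo_le soo_ge0; case: (soo) => [s _ _|//|//]; exists s.
have {qlc} := qlc (le_lt_trans soo_le (ltry _)); rewrite sE /= => cvg_s.
have s0 : 0 <= s by move: soo_ge0; rewrite sE lee_fin.
(* By right-continuity the path has left the open set [W n] when it exits [K n]. *)
have exit_W n : ~ (Some @` W n) (at_time path (exit_time X (K n) w) w).
  have : (0 <= exit_time X (K n) w)%E by exact: exit_time_ge0.
  have := @exit_time_gt_stay _ _ _ _ X (K n)^~ w.
  have := @stay_exit_time_ge _ _ _ _ X (K n)^~ w.
  case E1 : (exit_time X (K n) w) => [r||] //= h1 h2; last by move=> _ [].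
  rewrite lee_fin => r0 Wr.
  have [oW WK] := WP n.
  have [e e0 eP] := path_right_open r0 (one_point_compactification_open_some (W n) oW) Wr.
  have : (( r + e / 2)%:E <= r%:E)%E.
    apply: h1 => u u0 ue; have [ur|ru] := ltP u r.
      by apply: (h2 u) => //; rewrite lte_fin.
    have [|y Wy <-] := eP u ru; last by exists y => //; exact: WK.
    by rewrite (le_lt_trans ue)// ltrD2l ltr_pdivrMr// ltr_pMr// ltr1n.
  by rewrite lee_fin gerDl leNgt divr_gt0.
have nGs : ~ (Some @` G) (path s w).
  move=> [y Gy yE].
  have [n Wn] := GW Gy.
  have [oW _] := WP n.
  have nb : nbhs (path s w) (Some @` W n).
    apply: open_nbhs_nbhs; split.
      exact: one_point_compactification_open_some.
    by exists y.
  have [M _ MP] := cvg_s _ nb.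
  have := MP (maxn M n) (leq_maxl _ _) => -[z Wz zE].
  apply: (exit_W (maxn M n)); exists z => //.
  exact: (exhaustion_le (leq_maxr M n)).2.
have : (exit_time X G w <= s%:E)%E by apply: ereal_inf_lbound; exists s.
rewrite leNgt => /negP; apply; apply: le_lt_trans tG.
by rewrite -sE.
Qed.

(** The event [t < exit_time], which need not be measurable, has this measurable
    version by [surv_ae]. *)
Definition surv t : set Omega := \bigcup_n stay X (K n) t.

Lemma surv_exit_time t w : 0 <= t -> surv t w -> (t%:E < exit_time X G w)%E.
Proof. by move=> t0 [n _]; apply: stay_exit_time_gt => //; exact: KG. Qed.

Lemma surv_ae x t : 0 <= t ->
  \forall w \ae hp_law X x, (t%:E < exit_time X G w)%E = `[< surv t w >].
Proof.
move=> t0; apply: filterS (exit_time_exhaustion x t) => w h.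
apply/idP/asboolP; first by case/h => n Kn; exists n.
exact: surv_exit_time.
Qed.

End Survival.

(** * The Markov property for nonnegative functions *)

Section MeasurableInduction.
Import HBNNSimple.

(** What is preserved by nonnegative linear combinations and monotone limits passes
    from indicators to nonnegative measurable functions. *)
Lemma ge0_measurable_ind d (T : measurableType d) (R : realType)
    (P : (T -> \bar R) -> Prop) :
  (forall A, measurable A -> P (fun x => (\1_A x)%:E)) ->
  (forall (a : R) (f : T -> \bar R), 0 <= a -> measurable_fun setT f -> (forall x, 0 <= f x)%E ->
     P f -> P (fun x => a%:E * f x)%E) ->
  (forall f g : T -> \bar R, measurable_fun setT f -> (forall x, 0 <= f x)%E ->
     measurable_fun setT g -> (forall x, 0 <= g x)%E ->
     P f -> P g -> P (fun x => f x + g x)%E) ->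
  (forall (f : nat -> T -> \bar R) (g : T -> \bar R), (forall n, measurable_fun setT (f n)) ->
     (forall n x, 0 <= f n x)%E ->
     (forall x, nondecreasing_seq (fun n => f n x)) ->
     (forall x, f n x @[n --> \oo] --> g x) -> (forall n, P (f n)) -> P g) ->
  forall f : T -> \bar R, measurable_fun setT f -> (forall x, 0 <= f x)%E -> P f.
Proof.
move=> P1 PZ PD Plim f mf f0.
pose h := nnsfun_approx measurableT mf.
apply: (Plim (fun n x => (h n x)%:E)).
- by move=> n; exact/measurable_EFinP.
- by move=> n x /=; rewrite lee_fin.
- move=> x n m nm /=; rewrite lee_fin.
  by have /lefP/(_ x) := nd_nnsfun_approx measurableT mf nm.
- move=> x; exact: cvg_nnsfun_approx.
move=> n.
have mpre (r : R) : measurable (h n @^-1` [set r]) by exact: measurable_funPTI.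
have mterm (r : R) : measurable_fun setT
    (fun x => (r%:E * (\1_(h n @^-1` [set r]) x)%:E)%E).
  by apply/measurable_EFinP; apply: measurable_funM => //; exact: measurable_indic.
have -> : (fun x => (h n x)%:E) = (fun x =>
    \sum_(r <- fset_set (range (h n))) (r%:E * (\1_(h n @^-1` [set r]) x)%:E))%E.
  by apply/funext => x /=; rewrite fimfunE fsbig_finite//= -sumEFin.
have sge0 r : r \in (fset_set (range (h n)) : seq R) -> 0 <= r.
  by rewrite in_fset_set; [move=> /set_mem[x _ <-]|exact: fimfunP].
move: (enum_fset (fset_set (range (h n)))) sge0.
elim=> [_|r s IH sge0].
  rewrite (_ : (fun x => _) = (fun x => 0%:E * (\1_setT x)%:E)%E); last first.
    by apply/funext => x; rewrite big_nil mul0e.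
  apply: PZ => //; last exact: P1.
  by apply/measurable_EFinP; exact: measurable_indic.
rewrite (_ : (fun x => _) = (fun x =>
    r%:E * (\1_(h n @^-1` [set r]) x)%:E +
    \sum_(r <- s) (r%:E * (\1_(h n @^-1` [set r]) x)%:E))%E); last first.
  by apply/funext => x; rewrite big_cons.
have r0 : 0 <= r by apply: sge0; rewrite mem_head.
have s0 y : y \in s -> 0 <= y by move=> ys; apply: sge0; rewrite in_cons ys orbT.
apply: PD.
- exact: mterm.
- by move=> x; rewrite mule_ge0// lee_fin.
- by apply: emeasurable_sum => i; exact: mterm.
- move=> x; rewrite big_seq; apply: sume_ge0 => y ys.
  by rewrite mule_ge0// lee_fin ?s0.
- apply: PZ; [exact: r0| |by move=> x; rewrite lee_fin|exact: P1].
  by apply/measurable_EFinP; exact: measurable_indic.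
- exact: IH.
Qed.

End MeasurableInduction.

Section Markov.
Context (R : realType) (E : ptopologicalType) d (Omega : measurableType d).
Variable X : hunt_process R E Omega.
Local Notation path := (hp_path X).
Local Notation law := (hp_law X).
Local Notation opcE := (borel (opc E)).
Implicit Types (F H : opcE -> \bar R) (A : set Omega) (s t h : R).

Lemma measurable_path t : 0 <= t -> measurable_fun setT (path t : Omega -> opcE).
Proof.
move=> t0 _ B mB; rewrite setTI.
exact: (hp_filt_measurable t0 (hp_adapted X t0 mB)).
Qed.

Lemma measurable_comp_path t F : 0 <= t -> measurable_fun setT F ->
  measurable_fun setT (fun w => F (path t w)).
Proof. by move=> t0 mF; exact: measurableT_comp mF (measurable_path t0). Qed.

Definition transition h F (z : opc E) : \bar R := (\int[law z]_w F (path h w))%E.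

Lemma transition_ge0 h F z : (forall y, 0 <= F y)%E -> (0 <= transition h F z)%E.
Proof. by move=> F0; apply: integral_ge0. Qed.

Lemma measurable_transition h F : 0 <= h -> measurable_fun setT F ->
  (forall y, 0 <= F y)%E -> measurable_fun setT (transition h F : opcE -> \bar R).
Proof.
move=> h0 mF F0.
pose mp := isMeasurableFun.Build _ _ _ _ _ (measurable_path h0).
pose p : {mfun Omega >-> opcE} := HB.pack (path h : Omega -> opcE) mp.
rewrite (_ : transition h F = fun z => (\int[distribution (law z) p]_y F y)%E).
  pose l (z : opcE) : {measure set opcE -> \bar R} := distribution (law z) p.
  have ml U : measurable U -> measurable_fun setT (fun z : opcE => l z U).
    by move=> mU; exact: hp_law_measurable.
  exact: (@measurable_fun_integral_kernel _ _ opcE opcE R l ml F F0 mF).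
by apply/funext => z; rewrite /distribution ge0_integral_pushforward// preimage_setT.
Qed.

(** The strong Markov property at a deterministic time, passed from indicators to
    functions. *)
Lemma simple_markov s h x A F : 0 <= s -> 0 <= h -> hp_filt X s A ->
  measurable_fun setT F -> (forall y, 0 <= F y)%E ->
  (\int[law x]_(w in A) F (path (s + h) w) =
   \int[law x]_(w in A) transition h F (path s w))%E.
Proof.
move=> s0 h0 FA.
have sh0 : 0 <= s + h by rewrite addr_ge0.
have mA : measurable A := hp_filt_measurable s0 FA.
have mTF F' : measurable_fun setT F' -> (forall y, 0 <= F' y)%E ->
    measurable_fun A (fun w => transition h F' (path s w)).
  move=> mF' F'0; apply: measurable_funTS; apply: measurable_comp_path => //.
  exact: measurable_transition.
have mFA F' : measurable_fun setT F' -> measurable_fun A (fun w => F' (path (s + h) w)).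
  by move=> mF'; apply: measurable_funTS; exact: measurable_comp_path.
move: F; apply: ge0_measurable_ind.
- move=> B mB.
  have stop : stopping_time (hp_filt X) (fun _ => s%:E).
    split; first by move=> _; rewrite lee_fin.
    move=> t t0; have [F0 FC _] := hp_filt_sigma X t0.
    have [st|ts] := leP s t.
      rewrite (_ : [set _ | _] = setT `\` set0); first exact: FC.
      apply/seteqP; split => w /=; [by split|by move=> _; rewrite lee_fin].
    rewrite (_ : [set _ | _] = set0)//; apply/seteqP; split => // w /=.
    by rewrite lee_fin leNgt ts.
  have stopA : stopped_event (hp_filt X) (fun _ => s%:E) A.
    split => // t t0; have [F0 FC _] := hp_filt_sigma X t0.
    have [st|ts] := leP s t.
      rewrite (_ : A `&` _ = A); first exact: hp_filt_mono FA.
      by apply/seteqP; split => [w []//|w Aw]; split => //=; rewrite lee_fin.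
    rewrite (_ : A `&` _ = set0)//; apply/seteqP; split => // w [_ /=].
    by rewrite lee_fin leNgt ts.
  have := hp_strong_markov x stop stopA h0 mB.
  have -> : A `&` [set w : Omega | (s%:E < +oo :> \bar R)%E] = A.
    by apply/seteqP; split => [w []//|w Aw]; split => //=; rewrite ltry.
  move=> mk.
  transitivity (law x (A `&` [set w | B (at_time path (s%:E + h%:E)%E w)])).
    rewrite (eq_integral (fun w => (\1_(path (s + h) @^-1` B) w)%:E))//.
    rewrite integral_indic//; first by rewrite setIC.
    by rewrite -[_ @^-1` _]setTI; exact: measurable_path.
  rewrite mk; apply: eq_integral => w _ /=.
  rewrite /transition (eq_integral (fun w => (\1_(path h @^-1` B) w)%:E))//.
  rewrite integral_indic ?setIT//.
  by rewrite -[_ @^-1` _]setTI; exact: measurable_path.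
- move=> a f a0 mf f0 IH.
  rewrite ge0_integralZl_EFin//; last exact: mFA.
  rewrite IH -ge0_integralZl_EFin//; [|by move=> *; exact: transition_ge0|exact: mTF].
  apply: eq_integral => w _; rewrite /transition ge0_integralZl_EFin//.
  exact: measurable_comp_path.
- move=> f g mf f0 mg g0 IHf IHg.
  rewrite ge0_integralD//; [|exact: mFA..].
  rewrite IHf IHg -ge0_integralD//;
    [|by move=> *; exact: transition_ge0|exact: mTF|by move=> *; exact: transition_ge0|exact: mTF].
  apply: eq_integral => w _; rewrite /transition ge0_integralD//; exact: measurable_comp_path.
- move=> f g mf f0 ndf fg IH.
  have gE y : g y = limn (fun n => f n y) by apply/esym/cvg_lim; [|exact: fg].
  under eq_integral do rewrite gE.
  rewrite monotone_convergence//; last by move=> n; exact: mFA.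
  under eq_fun do rewrite IH.
  rewrite -monotone_convergence//; last 3 first.
  + by move=> n; exact: mTF.
  + by move=> n w _; exact: transition_ge0.
  + move=> w _ n m nm; apply: ge0_le_integral => //; try exact: measurable_comp_path.
    by move=> w' _; exact: ndf.
  apply: eq_integral => w _; rewrite /transition.
  under [RHS]eq_integral do rewrite gE.
  rewrite monotone_convergence//.
  by move=> n; exact: measurable_comp_path.
Qed.

End Markov.

(** * The process killed on leaving a closed set *)

Lemma sigma_algebra_setI (T : Type) (F : set (set T)) (A B : set T) :
  sigma_algebra setT F -> F A -> F B -> F (A `&` B).
Proof.
move=> sF FA FB.
rewrite (_ : A `&` B = \bigcap_n (if n is 0%N then A else B)).
  by apply: sigma_algebra_bigcapT => // -[|n].
apply/seteqP; split => x; first by move=> [Ax Bx] [|n] _.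
by move=> h; split; [exact: (h 0%N)|exact: (h 1%N)].
Qed.

Lemma measurable_patch d (T : measurableType d) (R : realType)
    (f : T -> \bar R) (D : set T) :
  measurable D -> measurable_fun setT f -> measurable_fun setT (f \_ D).
Proof.
move=> mD mf; apply/(measurable_restrictT f mD).
exact: measurable_funTS.
Qed.

Lemma bounded_integrable_cst d (T : measurableType d) (R : realType)
    (P : {measure set T -> \bar R}) (M : R) (D : set T) : (P setT < +oo)%E ->
  measurable D -> P.-integrable D (cst M%:E).
Proof.
move=> PT mD.
apply: (@measurable_bounded_integrable _ _ _ P (cst M)) => //.
  apply: le_lt_trans PT; apply: le_measure; [exact/mem_set|exact/mem_set|].
  exact: subsetT.
by exists `|M|; split; [rewrite num_real|move=> N MN x /= _; exact: ltW].
Qed.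

Lemma cvg_integral_bigcap d (T : measurableType d) (R : realType)
    (P : {measure set T -> \bar R}) (f : T -> \bar R) (M : R) (B : nat -> set T) :
  (P setT < +oo)%E -> measurable_fun setT f -> (forall x, 0 <= f x <= M%:E)%E ->
  (forall m, measurable (B m)) -> (forall m, B m.+1 `<=` B m) ->
  (\int[P]_(x in B m) f x @[m --> \oo] --> \int[P]_(x in \bigcap_m B m) f x)%E.
Proof.
move=> PT mf fM mB BS.
have Bmono m n : (m <= n)%N -> B n `<=` B m.
  elim: n => [|n IH]; first by rewrite leqn0 => /eqP ->.
  rewrite leq_eqVlt => /predU1P[->//|]; rewrite ltnS => mn.
  by apply: subset_trans (IH mn); exact: BS.
have mcap : measurable (\bigcap_m B m) by exact: bigcap_measurable.
rewrite integral_mkcond; under eq_cvg do rewrite integral_mkcond.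
have [||||| _ _ lim] := @dominated_convergence _ _ _ P setT measurableT
  (fun m => f \_ (B m)) (f \_ (\bigcap_m B m)) (cst M%:E).
- by move=> m; exact: measurable_patch.
- exact: measurable_patch.
- apply: nearW => x _; have [Bx|nBx] := pselect ((\bigcap_m B m) x).
    rewrite patchE mem_set//; apply: cvg_near_cst; apply: nearW => m.
    by rewrite patchE mem_set//; exact: Bx.
  rewrite patchE memNset//; apply: cvg_near_cst.
  have [m nBm] : exists m, ~ B m x.
    by apply/existsNP => h; apply: nBx => m _; exact: h.
  exists m => // n /= mn; rewrite patchE memNset// => Bn.
  by apply: nBm; exact: Bmono Bn.
- exact: bounded_integrable_cst.
- apply: nearW => x m _; have /andP[f0 fM'] := fM x.
  rewrite patchE; case: ifPn => _; first by rewrite gee0_abs.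
  by rewrite abse0; exact: le_trans fM'.
exact: lim.
Qed.

Section KilledKernel.
Context (R : realType) (E : ptopologicalType) d (Omega : measurableType d).
Variable X : hunt_process R E Omega.
Local Notation path := (hp_path X).
Local Notation law := (hp_law X).
Local Notation opcE := (borel (opc E)).
Variable K : set E.
Hypothesis clK : closed (Some @` K : set (opc E)).
Hypothesis closed_pt : forall z : opc E, measurable ([set z] : set opcE).
Local Notation C := (Some @` K : set opcE).
Implicit Types (F H : opcE -> \bar R) (A : set Omega) (s t h : R) (z : opc E).

Lemma measurable_target : measurable C.
Proof.
rewrite -[C]setCK; apply: measurableC; apply: sub_sigma_algebra.
exact: closed_openC.
Qed.

Lemma patch_nneg F (D : set opcE) : (forall y, 0 <= F y)%E ->
  (forall y, 0 <= (F \_ D) y)%E.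
Proof. by move=> F0 y; rewrite patchE; case: ifPn. Qed.

Lemma measurable_restrict_target F : measurable_fun setT F ->
  measurable_fun setT (F \_ C).
Proof. by move=> mF; apply: measurable_patch => //; exact: measurable_target. Qed.

(** One step of the chain observed at multiples of [h] and killed when it is found
    outside [K]. *)
Definition step h F := transition X h (F \_ C).

Lemma step_ge0 h F z : (forall y, 0 <= F y)%E -> (0 <= step h F z)%E.
Proof. by move=> F0; apply: transition_ge0; exact: patch_nneg. Qed.

Lemma measurable_step h F : 0 <= h -> measurable_fun setT F ->
  (forall y, 0 <= F y)%E -> measurable_fun setT (step h F : opcE -> \bar R).
Proof.
move=> h0 mF F0; apply: measurable_transition => //.
  exact: measurable_restrict_target.
exact: patch_nneg.
Qed.

Lemma iter_step h F n : 0 <= h -> measurable_fun setT F -> (forall y, 0 <= F y)%E ->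
  measurable_fun setT (iter n (step h) F : opcE -> \bar R) /\
  (forall y, 0 <= iter n (step h) F y)%E.
Proof.
move=> h0 mF F0; elim: n => [//|n [mI I0]]; split => /=.
  exact: measurable_step.
by move=> y; exact: step_ge0.
Qed.

Lemma iter_step_le h F n (M : R) : 0 <= h -> 0 <= M -> measurable_fun setT F ->
  (forall y, 0 <= F y <= M%:E)%E -> (forall y, 0 <= iter n (step h) F y <= M%:E)%E.
Proof.
move=> h0 M0 mF FM.
have F0 y : (0 <= F y)%E by have /andP[] := FM y.
elim: n => [//|n IH] y /=; apply/andP; split.
  by apply: step_ge0 => z; have /andP[] := IH z.
have [mI I0] := iter_step n h0 mF F0.
rewrite /step /transition (@le_trans _ _ (\int[law y]_w (cst M%:E w))%E)//.
  apply: ge0_le_integral => //.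
  - by move=> w _; exact: patch_nneg.
  - by apply: measurable_comp_path => //; exact: measurable_restrict_target.
  - by move=> w _; rewrite patchE; case: ifPn => // _; have /andP[] := IH (path h w).
rewrite integral_cst// -[leRHS]mule1 lee_wpmul2l ?lee_fin//.
exact: probability_le1.
Qed.

Definition visits s h n : set Omega :=
  [set w | forall i, (i < n)%N -> C (path (s + h * i.+1%:R) w)].

Lemma visitsS s h n : visits s h n.+1 =
  visits s h n `&` path (s + h * n.+1%:R) @^-1` C.
Proof.
apply/seteqP; split => w.
  by move=> v; split => [i ni|]; apply: v; rewrite ltnS// ltnW.
move=> [v vn] i; rewrite ltnS leq_eqVlt => /predU1P[->//|]; exact: v.
Qed.

Lemma filt_visits s h n : 0 <= s -> 0 <= h ->
  hp_filt X (s + h * n%:R) (visits s h n).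
Proof.
move=> s0 h0; elim: n => [|n IH].
  rewrite mulr0 addr0; have [F0 FC _] := hp_filt_sigma X s0.
  rewrite (_ : visits s h 0 = setT `\` set0); first exact: FC.
  by apply/seteqP; split => w; [split|move=> _ i].
have le1 : h * n%:R <= h * n.+1%:R by rewrite ler_wpM2l// ler_nat.
have n0 : 0 <= s + h * n%:R by rewrite addr_ge0// mulr_ge0.
have S0 : 0 <= s + h * n.+1%:R by rewrite addr_ge0// mulr_ge0.
rewrite visitsS; apply: sigma_algebra_setI.
- exact: hp_filt_sigma.
- by apply: hp_filt_mono IH => //; rewrite lerD2l.
- by apply: hp_adapted => //; exact: measurable_target.
Qed.

(** Iterating the Markov property along a grid of mesh [h]. *)
Lemma markov_grid s h n A F z : 0 <= s -> 0 <= h -> hp_filt X s A ->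
  measurable_fun setT F -> (forall y, 0 <= F y)%E ->
  (\int[law z]_(w in A `&` visits s h n) F (path (s + h * n%:R) w) =
   \int[law z]_(w in A) (iter n (step h) F) (path s w))%E.
Proof.
move=> s0 h0 FA; elim: n F => [|n IH] F mF F0.
  rewrite mulr0 addr0 /= (_ : A `&` _ = A)//.
  by apply/seteqP; split => [w []|w].
have n0 : 0 <= s + h * n%:R by rewrite addr_ge0// mulr_ge0.
rewrite iterSr -IH; [|exact: measurable_step|by move=> y; exact: step_ge0].
have FAn : hp_filt X (s + h * n%:R) (A `&` visits s h n).
  apply: sigma_algebra_setI; first exact: hp_filt_sigma.
    by apply: hp_filt_mono FA => //; rewrite lerDl mulr_ge0.
  exact: filt_visits.
rewrite -(simple_markov _ n0 h0 FAn); first last.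
- exact: patch_nneg.
- exact: measurable_restrict_target.
rewrite visitsS setIA.
have -> : s + h * n.+1%:R = s + h * n%:R + h.
  by rewrite -natr1 mulrDr mulr1 addrA.
rewrite integral_mkcondr; apply: eq_integral => w _.
by rewrite !patchE; congr (if _ then _ else _).
Qed.

Lemma visits_half s t m : visits s (t / (2 ^ m.+1)%:R) (2 ^ m.+1) `<=`
  visits s (t / (2 ^ m)%:R) (2 ^ m).
Proof.
move=> w v i im; have := v (2 * i).+1.
have -> : t / (2 ^ m.+1)%:R * (2 * i).+2%:R = t / (2 ^ m)%:R * i.+1%:R.
  rewrite (_ : (2 * i).+2 = 2 * i.+1)%N; last by rewrite mulnS.
  by rewrite expnS !natrM invfM; field; rewrite pnatr_eq0 -lt0n expn_gt0.
by apply; rewrite expnS -[(_ < _)%N]/((2 * i).+2 <= _)%N -[X in (X <= _)%N]addn2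
  addnC -mulnS leq_mul2l.
Qed.

(** Up to time [s] the path is observed continuously, afterwards on finer and finer
    grids; right-continuity of the shifted path makes this equivalent. *)
Lemma stay_visits s t : 0 <= s -> 0 <= t -> stay X K (s + t) =
  \bigcap_m (stay X K s `&` visits s (t / (2 ^ m)%:R) (2 ^ m)).
Proof.
move=> s0 t0; apply/seteqP; split => w.
  move=> Kw m _; split; first by apply: stay_mono Kw; rewrite lerDl.
  move=> i im; apply: Kw; first by rewrite addr_ge0// grid_ge0.
  by rewrite lerD2l grid_le.
move=> Kw.
have Ks : stay X K s w by have [] := Kw 0%N I.
have Kt : stay X K t (hp_shift X s w).
  rewrite stay_dyadic// => m _ [|i] /= im; rewrite hp_shiftE ?grid_ge0//.
    by rewrite mulr0 add0r; exact: Ks.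
  by rewrite addrC; have [_] := Kw m I; exact.
move=> r r0 rst; have [rs|sr] := leP r s; first exact: Ks.
have rs0 : 0 <= r - s by rewrite subr_ge0 ltW.
have := Kt (r - s) rs0; rewrite hp_shiftE// subrK; apply => //.
by rewrite lerBlDl.
Qed.

(** The transition function of the process killed on leaving [K]. *)
Definition killed t F z : \bar R := (\int[law z]_(w in stay X K t) F (path t w))%E.

Lemma killed_ge0 t F z : (forall y, 0 <= F y)%E -> (0 <= killed t F z)%E.
Proof. by move=> F0; apply: integral_ge0. Qed.

(** The events that the path visits [K] along the dyadic grids decrease to the
    event that it stays in [K], and [markov_grid] computes their contribution. *)
Lemma cvg_iter_step s t F (M : R) z : 0 <= s -> 0 <= t -> measurable_fun setT F ->
  (forall y, 0 <= F y <= M%:E)%E ->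
  (\int[law z]_(w in stay X K s) iter (2 ^ m) (step (t / (2 ^ m)%:R)) F (path s w)
   @[m --> \oo] --> killed (s + t) F z)%E.
Proof.
move=> s0 t0 mF FM.
have F0 y : (0 <= F y)%E by have /andP[] := FM y.
have st0 : 0 <= s + t by rewrite addr_ge0.
have th m : 0 <= t / (2 ^ m)%:R by rewrite divr_ge0.
have E1 m : (\int[law z]_(w in stay X K s)
     iter (2 ^ m) (step (t / (2 ^ m)%:R)) F (path s w) =
   \int[law z]_(w in stay X K s `&` visits s (t / (2 ^ m)%:R) (2 ^ m))
     F (path (s + t) w))%E.
  rewrite -(markov_grid _ _ s0)//; last exact: filt_stay.
  by rewrite divfK// pnatr_eq0 -lt0n expn_gt0.
under eq_cvg do rewrite E1.
rewrite /killed stay_visits//; apply: (@cvg_integral_bigcap _ _ _ _ _ M) => //.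
- exact: (le_lt_trans (probability_le1 _ measurableT) (ltry _)).
- exact: measurable_comp_path.
- move=> m; apply: measurableI; first exact: measurable_stay.
  have := @filt_visits s (t / (2 ^ m)%:R) (2 ^ m) s0 (th m).
  by apply: hp_filt_measurable; rewrite addr_ge0// mulr_ge0.
- by move=> m; apply: setIS; exact: visits_half.
Qed.

Lemma start_ae z : \forall w \ae law z, path 0 w = z.
Proof.
exists (~` (path 0 @^-1` [set z])); split => //.
  apply: measurableC; rewrite -[_ @^-1` _]setTI.
  exact: measurable_path.
rewrite probability_setC; last first.
  by rewrite -[_ @^-1` _]setTI; exact: measurable_path.
by rewrite hp_normal subee.
Qed.

Lemma integral_start F z : measurable_fun setT F -> (forall y, 0 <= F y)%E ->
  (\int[law z]_(w in stay X K 0) F (path 0 w) = (F \_ C) z)%E.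
Proof.
move=> mF F0.
have -> : stay X K 0 = path 0 @^-1` C.
  apply/seteqP; split => w; first by move=> h; apply: h.
  by move=> h r r0 r1; rewrite (_ : r = 0)//; apply/eqP; rewrite eq_le r0 r1.
rewrite integral_mkcond.
rewrite (_ : (fun w => F (path 0 w)) \_ (path 0 @^-1` C) = (F \_ C) \o path 0); last first.
  by apply/funext => w; rewrite !patchE/= !patchE.
rewrite (ge0_ae_eq_integral (g := cst ((F \_ C) z)))//.
- rewrite integral_cst// -[RHS]mule1; congr (_ * _)%E.
  exact: probability_setT.
- apply: measurable_comp_path => //; exact: measurable_restrict_target.
- by move=> w _; exact: patch_nneg.
- by move=> w _; exact: patch_nneg.
- by apply: filterS (start_ae z) => w /= -> .
Qed.

Lemma cvg_killed t F (M : R) z : 0 <= t -> measurable_fun setT F ->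
  (forall y, 0 <= F y <= M%:E)%E ->
  ((iter (2 ^ m) (step (t / (2 ^ m)%:R)) F \_ C) z @[m --> \oo] --> killed t F z)%E.
Proof.
move=> t0 mF FM.
have F0 y : (0 <= F y)%E by have /andP[] := FM y.
have := cvg_iter_step (z := z) (lexx 0) t0 mF FM; rewrite add0r.
have th m : 0 <= t / (2 ^ m)%:R by rewrite divr_ge0.
under eq_cvg => m.
  have [mI I0] := iter_step (2 ^ m) (th m) mF F0.
  rewrite integral_start//; over.
exact.
Qed.

Lemma measurable_killed t F (M : R) : 0 <= t -> measurable_fun setT F ->
  (forall y, 0 <= F y <= M%:E)%E -> measurable_fun setT (killed t F : opcE -> \bar R).
Proof.
move=> t0 mF FM.
have F0 y : (0 <= F y)%E by have /andP[] := FM y.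
have th m : 0 <= t / (2 ^ m)%:R by rewrite divr_ge0.
apply: (emeasurable_fun_cvg
  (fun m => (iter (2 ^ m) (step (t / (2 ^ m)%:R)) F : opcE -> \bar R) \_ C)) => [m|z _].
  by apply: measurable_restrict_target; have [] := iter_step (2 ^ m) (th m) mF F0.
exact: cvg_killed FM.
Qed.

Lemma killed_le t F (M : R) z : 0 <= t -> 0 <= M -> measurable_fun setT F ->
  (forall y, 0 <= F y <= M%:E)%E -> (0 <= killed t F z <= M%:E)%E.
Proof.
move=> t0 M0 mF FM.
have F0 y : (0 <= F y)%E by have /andP[] := FM y.
rewrite killed_ge0//=.
rewrite /killed (@le_trans _ _ (\int[law z]_w (cst M%:E w))%E)//.
  rewrite (@le_trans _ _ (\int[law z]_w F (path t w))%E)//.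
    apply: ge0_subset_integral => //; first exact: measurable_stay.
    exact: measurable_comp_path.
  apply: ge0_le_integral => //; first exact: measurable_comp_path.
  by move=> w _; have /andP[] := FM (path t w).
rewrite integral_cst// -[leRHS]mule1 lee_wpmul2l ?lee_fin//.
exact: probability_le1.
Qed.

(** Both sides are the limit of the same expression, in which the path is observed
    continuously up to [s] and along grids after [s]. *)
Lemma killed_semigroup_law s t F (M : R) z : 0 <= s -> 0 <= t -> 0 <= M ->
  measurable_fun setT F -> (forall y, 0 <= F y <= M%:E)%E ->
  killed (s + t) F z = killed s (killed t F) z.
Proof.
move=> s0 t0 M0 mF FM.
have F0 y : (0 <= F y)%E by have /andP[] := FM y.
have th m : 0 <= t / (2 ^ m)%:R by rewrite divr_ge0.
have lim1 := cvg_iter_step (z := z) s0 t0 mF FM.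
have mS : measurable (stay X K s) by exact: measurable_stay.
have [||||| _ _ lim2] := @dominated_convergence _ _ _ (law z) (stay X K s) mS
  (fun m w => iter (2 ^ m) (step (t / (2 ^ m)%:R)) F (path s w))
  (fun w => killed t F (path s w)) (cst M%:E).
- move=> m; apply: measurable_funTS; apply: measurable_comp_path => //.
  by have [] := iter_step (2 ^ m) (th m) mF F0.
- apply: measurable_funTS; apply: measurable_comp_path => //.
  exact: measurable_killed FM.
- apply: nearW => w Kw; have Cs : C (path s w) by exact: Kw.
  have := cvg_killed (z := path s w) t0 mF FM.
  by under eq_cvg do rewrite patchE mem_set//.
- apply: bounded_integrable_cst => //.
  exact: (le_lt_trans (probability_le1 _ measurableT) (ltry _)).
- apply: nearW => w m _.
  have /andP[i0 iM] := iter_step_le (2 ^ m) (th m) M0 mF FM (path s w).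
  by rewrite gee0_abs.
exact: (cvg_unique (@ereal_hausdorff R) lim1 lim2).
Qed.

End KilledKernel.

Section KilledSymmetry.
Context (R : realType) (E : ptopologicalType) d (Omega : measurableType d).
Variables (X : hunt_process R E Omega) (mu : probability (borel E) R).
Hypothesis hX : symmetric_process X mu.
Local Notation path := (hp_path X).
Local Notation law := (hp_law X).
Local Notation opcE := (borel (opc E)).
Variable K : set E.
Hypothesis clK : closed (Some @` K : set (opc E)).
Hypothesis closed_pt : forall z : opc E, measurable ([set z] : set opcE).
Local Notation C := (Some @` K : set opcE).
Local Notation step := (step X K).
Implicit Types (F H : opcE -> \bar R) (s t h : R) (z : opc E).

Lemma measurable_comp_some F : measurable_fun setT F ->
  measurable_fun setT (fun x : borel E => F (Some x)).
Proof. by move=> mF; exact: measurableT_comp mF (measurable_fun_some (E := E)). Qed.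

Lemma restrict_target_extend F :
  extend0 0%E (fun x => (F \_ C) (Some x)) = F \_ C.
Proof.
apply/funext => -[x//|] /=; rewrite patchE memNset//.
by move=> [].
Qed.

Lemma patch_swap F H z : ((F \_ C) z * H z = F z * (H \_ C) z)%E.
Proof. by rewrite !patchE; case: ifPn => // _; rewrite mul0e mule0. Qed.

Lemma transition_symmetric h F H : 0 <= h -> measurable_fun setT F ->
  measurable_fun setT H -> (forall y, 0 <= F y)%E -> (forall y, 0 <= H y)%E ->
  (\int[mu]_x ((F \_ C) (Some x) * step h H (Some x)) =
   \int[mu]_x (step h F (Some x) * (H \_ C) (Some x)))%E.
Proof.
move=> h0 mF mH F0 H0.
have mT (D : opcE -> \bar R) : measurable_fun setT D ->
    measurable_fun setT (fun x : borel E => (D \_ C) (Some x)).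
  by move=> mD; apply: measurable_comp_some; exact: measurable_restrict_target.
have := hX h0 (mT _ mF) (mT _ mH) (fun x => patch_nneg _ F0 _)
  (fun x => patch_nneg _ H0 _).
by rewrite /= !restrict_target_extend => ->.
Qed.

Lemma iter_step_symmetric h F H n : 0 <= h -> measurable_fun setT F ->
  measurable_fun setT H -> (forall y, 0 <= F y)%E -> (forall y, 0 <= H y)%E ->
  (\int[mu]_x ((F \_ C) (Some x) * iter n (step h) H (Some x)) =
   \int[mu]_x (iter n (step h) F (Some x) * (H \_ C) (Some x)))%E.
Proof.
move=> h0; elim: n F H => [|n IH] F H mF mH F0 H0.
  by apply: eq_integral => x _; rewrite patch_swap.
have [mI I0] := iter_step X clK n h0 mH H0.
rewrite iterS transition_symmetric//.
under eq_integral => x _ do rewrite -patch_swap.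
rewrite IH//; [|exact: measurable_step|by move=> y; exact: step_ge0].
by rewrite iterSr.
Qed.

Lemma cvg_integral_mul_killed t F H (M : R) : 0 <= t -> 0 <= M ->
  measurable_fun setT F -> measurable_fun setT H ->
  (forall y, 0 <= F y <= M%:E)%E -> (forall y, 0 <= H y <= M%:E)%E ->
  (\int[mu]_x ((F \_ C) (Some x) * iter (2 ^ m) (step (t / (2 ^ m)%:R)) H (Some x))
   @[m --> \oo] --> \int[mu]_x (F (Some x) * killed X K t H (Some x)))%E.
Proof.
move=> t0 M0 mF mH FM HM.
have F0 y : (0 <= F y)%E by have /andP[] := FM y.
have H0 y : (0 <= H y)%E by have /andP[] := HM y.
have th m : 0 <= t / (2 ^ m)%:R by rewrite divr_ge0.
under eq_cvg => m do under eq_integral => x _ do rewrite patch_swap.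
have [||||| _ _ lim] := @dominated_convergence _ _ _ mu setT measurableT
  (fun m x => F (Some x) *
    ((iter (2 ^ m) (step (t / (2 ^ m)%:R)) H : opcE -> \bar R) \_ C) (Some x))%E
  (fun x => F (Some x) * killed X K t H (Some x))%E (cst (M * M)%:E).
- move=> m; apply: emeasurable_funM; first exact: measurable_comp_some.
  apply: measurable_comp_some; apply: measurable_restrict_target => //.
  by have [] := iter_step X clK (2 ^ m) (th m) mH H0.
- apply: emeasurable_funM; first exact: measurable_comp_some.
  by apply: measurable_comp_some; exact: measurable_killed HM.
- apply: nearW => x _; apply: cvgeZl; last exact: cvg_killed HM.
  by rewrite ge0_fin_numE// (le_lt_trans (andP (FM _)).2)// ltry.
- apply: bounded_integrable_cst => //.
  exact: (le_lt_trans (probability_le1 _ measurableT) (ltry _)).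
- apply: nearW => x m _.
  have /andP[i0 iM] := iter_step_le X clK (2 ^ m) (th m) M0 mH HM (Some x).
  have /andP[f0 fM] := FM (Some x).
  rewrite patchE; case: ifPn => _; last by rewrite mule0 abse0 lee_fin mulr_ge0.
  by rewrite gee0_abs ?mule_ge0// EFinM lee_pmul.
exact: lim.
Qed.

(** The steps of the chains along grids are symmetric, as restriction to [K] before
    and after a transition is; the limit inherits this. *)
Lemma killed_symmetric t F H (M : R) : 0 <= t -> 0 <= M ->
  measurable_fun setT F -> measurable_fun setT H ->
  (forall y, 0 <= F y <= M%:E)%E -> (forall y, 0 <= H y <= M%:E)%E ->
  (\int[mu]_x (F (Some x) * killed X K t H (Some x)) =
   \int[mu]_x (killed X K t F (Some x) * H (Some x)))%E.
Proof.
move=> t0 M0 mF mH FM HM.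
have F0 y : (0 <= F y)%E by have /andP[] := FM y.
have H0 y : (0 <= H y)%E by have /andP[] := HM y.
have th m : 0 <= t / (2 ^ m)%:R by rewrite divr_ge0.
have lim1 := cvg_integral_mul_killed t0 M0 mF mH FM HM.
have E1 m : (\int[mu]_x ((H \_ C) (Some x) *
      iter (2 ^ m) (step (t / (2 ^ m)%:R)) F (Some x)) =
    \int[mu]_x ((F \_ C) (Some x) *
      iter (2 ^ m) (step (t / (2 ^ m)%:R)) H (Some x)))%E.
  rewrite iter_step_symmetric//.
  by apply: eq_integral => x _; rewrite muleC.
have := cvg_integral_mul_killed t0 M0 mH mF HM FM.
rewrite (funext E1) => lim2.
rewrite (cvg_unique (@ereal_hausdorff R) lim1 lim2).
by apply: eq_integral => x _; rewrite muleC.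
Qed.

End KilledSymmetry.

(** * The process killed on leaving an open set *)

Lemma cvg_truncate (R : realType) (a : \bar R) : (0 <= a)%E ->
  mine a n%:R%:E @[n --> \oo] --> a.
Proof.
case: a => [r| |//] _; last first.
  have -> : (fun n => mine +oo%E n%:R%:E) = (fun n => n%:R%:E : \bar R).
    by apply/funext => n; rewrite minEle leye_eq.
  by apply/cvgeryP; exact: cvgr_idn.
apply: cvg_near_cst; near=> n.
apply/min_idPl; rewrite lee_fin; near: n.
exact: nbhs_infty_ger.
Unshelve. all: by end_near. Qed.

Lemma nondecreasing_truncate (R : realType) (a : \bar R) :
  nondecreasing_seq (fun n => mine a n%:R%:E).
Proof. by move=> n m nm; rewrite le_min2// lee_fin ler_nat. Qed.

Section SurvivalKernel.
Context (R : realType) (E : ptopologicalType) d (Omega : measurableType d).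
Variables (X : hunt_process R E Omega) (mu : probability (borel E) R).
Hypothesis hX : symmetric_process X mu.
Local Notation path := (hp_path X).
Local Notation law := (hp_law X).
Local Notation opcE := (borel (opc E)).
Variable K : nat -> set E.
Hypothesis clK : forall n, closed (Some @` (K n) : set (opc E)).
Hypothesis KS : forall n, K n `<=` K n.+1.
Hypothesis closed_pt : forall z : opc E, measurable ([set z] : set opcE).
Implicit Types (F H : opcE -> \bar R) (s t h : R) (z : opc E).

(** The transition function of the process killed on leaving the union of the
    [K n]. *)
Definition alive t F z : \bar R := (\int[law z]_(w in surv X K t) F (path t w))%E.

Lemma alive_ge0 t F z : (forall y, 0 <= F y)%E -> (0 <= alive t F z)%E.
Proof. by move=> F0; apply: integral_ge0. Qed.

Lemma nondecreasing_stay t : nondecreasing_seq (fun n => stay X (K n) t).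
Proof. by apply/nondecreasing_seqP => n; rewrite subsetEset; exact: stay_sub. Qed.

Lemma measurable_alive_event t : 0 <= t -> measurable (surv X K t).
Proof.
by move=> t0; apply: bigcup_measurable => n _; exact: (measurable_stay X (@clK n) t0).
Qed.

Lemma nondecreasing_killed t F z : 0 <= t -> measurable_fun setT F ->
  (forall y, 0 <= F y)%E -> nondecreasing_seq (fun n => killed X (K n) t F z).
Proof.
move=> t0 mF F0; apply: ge0_nondecreasing_set_nondecreasing_integral => //.
- exact: nondecreasing_stay.
- by move=> n; exact: (measurable_stay X (@clK n) t0).
- by move=> n; apply: measurable_funTS; exact: measurable_comp_path.
Qed.

Lemma cvg_alive t F z : 0 <= t -> measurable_fun setT F -> (forall y, 0 <= F y)%E ->
  (killed X (K n) t F z @[n --> \oo] --> alive t F z)%E.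
Proof.
move=> t0 mF F0; apply: ge0_nondecreasing_set_cvg_integral => //.
- exact: nondecreasing_stay.
- by move=> n; exact: (measurable_stay X (@clK n) t0).
- by move=> n; apply: measurable_funTS; exact: measurable_comp_path.
Qed.

Lemma alive_le t F (M : R) z : 0 <= t -> 0 <= M -> measurable_fun setT F ->
  (forall y, 0 <= F y <= M%:E)%E -> (0 <= alive t F z <= M%:E)%E.
Proof.
move=> t0 M0 mF FM.
have F0 y : (0 <= F y)%E by have /andP[] := FM y.
rewrite alive_ge0//=.
have cv := cvg_alive (z := z) t0 mF F0.
rewrite -(cvg_lim _ cv)//; apply: lime_le; first by apply/cvg_ex; exists (alive t F z).
by apply: nearW => n; have /andP[] := killed_le X (@clK n) z t0 M0 mF FM.
Qed.

Lemma measurable_alive_bounded t F (M : R) : 0 <= t -> measurable_fun setT F ->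
  (forall y, 0 <= F y <= M%:E)%E -> measurable_fun setT (alive t F : opcE -> \bar R).
Proof.
move=> t0 mF FM.
have F0 y : (0 <= F y)%E by have /andP[] := FM y.
apply: (emeasurable_fun_cvg (fun n => killed X (K n) t F : opcE -> \bar R)) => [n|z _].
  exact: measurable_killed FM.
exact: cvg_alive.
Qed.

Lemma truncate_bounded F n : (forall y, 0 <= F y)%E ->
  (forall y, 0 <= mine (F y) n%:R%:E <= (n%:R : R)%:E)%E.
Proof. by move=> F0 y; rewrite le_min F0 lee_fin ler0n ge_min lexx orbT. Qed.

Lemma measurable_truncate F n : measurable_fun setT F ->
  measurable_fun setT (fun y => mine (F y) (n%:R : R)%:E).
Proof. by move=> mF; exact: measurable_mine. Qed.

Lemma cvg_alive_truncate t F z : 0 <= t -> measurable_fun setT F ->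
  (forall y, 0 <= F y)%E ->
  (alive t (fun y => mine (F y) n%:R%:E) z @[n --> \oo] --> alive t F z)%E.
Proof.
move=> t0 mF F0.
have E1 : alive t F z = (\int[law z]_(w in surv X K t)
    limn (fun n => mine (F (path t w)) n%:R%:E))%E.
  by apply: eq_integral => w _; apply/esym/cvg_lim => //; exact: cvg_truncate.
rewrite E1; apply: cvg_monotone_convergence.
- exact: measurable_alive_event.
- move=> n; apply: measurable_funTS.
  exact: (measurable_comp_path X t0 (measurable_truncate n mF)).
- by move=> n w _; have /andP[] := truncate_bounded n F0 (path t w).
- by move=> w _; exact: nondecreasing_truncate.
Qed.

Lemma nondecreasing_alive_truncate t F z : 0 <= t -> measurable_fun setT F ->
  (forall y, 0 <= F y)%E ->
  nondecreasing_seq (fun n => alive t (fun y => mine (F y) n%:R%:E) z).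
Proof.
move=> t0 mF F0 n m nm; apply: ge0_le_integral.
- exact: measurable_alive_event.
- by move=> w _; have /andP[] := truncate_bounded n F0 (path t w).
- by apply: measurable_funTS; exact: (measurable_comp_path X t0 (measurable_truncate n mF)).
- by apply: measurable_funTS; exact: (measurable_comp_path X t0 (measurable_truncate m mF)).
- by move=> w _; exact: nondecreasing_truncate.
Qed.

Lemma measurable_alive t F : 0 <= t -> measurable_fun setT F ->
  (forall y, 0 <= F y)%E -> measurable_fun setT (alive t F : opcE -> \bar R).
Proof.
move=> t0 mF F0.
apply: (emeasurable_fun_cvg
  (fun n => alive t (fun y => mine (F y) n%:R%:E) : opcE -> \bar R)) => [n|z _].
  exact: (measurable_alive_bounded t0 (measurable_truncate n mF) (truncate_bounded n F0)).
exact: cvg_alive_truncate.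
Qed.

Lemma alive_symmetric_bounded t F H (M : R) : 0 <= t -> 0 <= M ->
  measurable_fun setT F -> measurable_fun setT H ->
  (forall y, 0 <= F y <= M%:E)%E -> (forall y, 0 <= H y <= M%:E)%E ->
  (\int[mu]_x (F (Some x) * alive t H (Some x)) =
   \int[mu]_x (alive t F (Some x) * H (Some x)))%E.
Proof.
move=> t0 M0 mF mH FM HM.
have F0 y : (0 <= F y)%E by have /andP[] := FM y.
have H0 y : (0 <= H y)%E by have /andP[] := HM y.
have lim F' H' : measurable_fun setT F' -> measurable_fun setT H' ->
    (forall y, 0 <= F' y <= M%:E)%E -> (forall y, 0 <= H' y <= M%:E)%E ->
    (\int[mu]_x (F' (Some x) * killed X (K n) t H' (Some x)) @[n --> \oo] -->
     \int[mu]_x (F' (Some x) * alive t H' (Some x)))%E.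
  move=> mF' mH' FM' HM'.
  have F'0 y : (0 <= F' y)%E by have /andP[] := FM' y.
  have H'0 y : (0 <= H' y)%E by have /andP[] := HM' y.
  have F'fin y : F' y \is a fin_num.
    by rewrite ge0_fin_numE// (le_lt_trans (andP (FM' _)).2)// ltry.
  have E1 : (\int[mu]_x (F' (Some x) * alive t H' (Some x)) =
      \int[mu]_x limn (fun n => F' (Some x) * killed X (K n) t H' (Some x)))%E.
    apply: eq_integral => x _; apply/esym/cvg_lim => //.
    by apply: cvgeZl => //; exact: cvg_alive.
  rewrite E1; apply: cvg_monotone_convergence => //.
  - move=> n; apply: emeasurable_funM; first exact: measurable_comp_some.
    by apply: measurable_comp_some; exact: measurable_killed HM'.
  - by move=> n x _; rewrite mule_ge0// killed_ge0.
  - move=> x _ n m nm; rewrite lee_wpmul2l//.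
    exact: nondecreasing_killed.
have lim1 := lim F H mF mH FM HM.
have := lim H F mH mF HM FM.
have E1 n : (\int[mu]_x (H (Some x) * killed X (K n) t F (Some x)) =
    \int[mu]_x (F (Some x) * killed X (K n) t H (Some x)))%E.
  rewrite (killed_symmetric hX (@clK n) closed_pt t0 M0 mF mH FM HM).
  by apply: eq_integral => x _; rewrite muleC.
rewrite (funext E1) => lim2.
rewrite (cvg_unique (@ereal_hausdorff R) lim1 lim2).
by apply: eq_integral => x _; rewrite muleC.
Qed.

(** Reduces to bounded functions by truncating [F]. *)
Lemma alive_symmetric t F H (M : R) : 0 <= t -> 0 <= M ->
  measurable_fun setT F -> measurable_fun setT H ->
  (forall y, 0 <= F y)%E -> (forall y, 0 <= H y <= M%:E)%E ->
  (\int[mu]_x (F (Some x) * alive t H (Some x)) =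
   \int[mu]_x (alive t F (Some x) * H (Some x)))%E.
Proof.
move=> t0 M0 mF mH F0 HM.
have H0 y : (0 <= H y)%E by have /andP[] := HM y.
have Hfin y : H y \is a fin_num.
  by rewrite ge0_fin_numE// (le_lt_trans (andP (HM _)).2)// ltry.
have aH z := alive_le z t0 M0 mH HM.
have aHfin z : alive t H z \is a fin_num.
  by have /andP[a0 aM] := aH z; rewrite ge0_fin_numE// (le_lt_trans aM)// ltry.
have mA := measurable_alive_bounded t0 mH HM.
have -> : (\int[mu]_x (F (Some x) * alive t H (Some x)) =
    \int[mu]_x limn (fun n => mine (F (Some x)) n%:R%:E * alive t H (Some x)))%E.
  apply: eq_integral => x _; apply/esym/cvg_lim => //.
  by apply: cvgeZr => //; exact: cvg_truncate.
have -> : (\int[mu]_x (alive t F (Some x) * H (Some x)) =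
    \int[mu]_x limn (fun n => alive t (fun y => mine (F y) n%:R%:E) (Some x) * H (Some x)))%E.
  apply: eq_integral => x _; apply/esym/cvg_lim => //.
  by apply: cvgeZr => //; exact: cvg_alive_truncate.
have tr0 n y : (0 <= mine (F y) n%:R%:E)%E by have /andP[] := truncate_bounded n F0 y.
rewrite !monotone_convergence//.
- congr (limn _); apply/funext => n.
  have Mn : (M <= M + n%:R :> R) by rewrite lerDl.
  have nM : (n%:R <= M + n%:R :> R) by rewrite lerDr.
  apply: (@alive_symmetric_bounded t (fun y => mine (F y) n%:R%:E) H (M + n%:R)) => //.
  + by rewrite addr_ge0.
  + exact: measurable_truncate.
  + move=> y; have /andP[-> /=] := truncate_bounded n F0 y.
    by move/le_trans; apply; rewrite lee_fin.
  + move=> y; have /andP[-> /=] := HM y.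
    by move/le_trans; apply; rewrite lee_fin.
- move=> n; apply: emeasurable_funM; last exact: measurable_comp_some.
  apply: measurable_comp_some.
  exact: (measurable_alive_bounded t0 (measurable_truncate n mF) (truncate_bounded n F0)).
- by move=> n x _; rewrite mule_ge0// alive_ge0.
- move=> x _ n m nm; rewrite lee_wpmul2r//.
  exact: nondecreasing_alive_truncate.
- move=> n; apply: emeasurable_funM; last exact: measurable_comp_some.
  exact: (measurable_comp_some (measurable_truncate n mF)).
- by move=> n x _; rewrite mule_ge0//; have /andP[] := aH (Some x).
- move=> x _ n m nm; rewrite lee_wpmul2r//; first by have /andP[] := aH (Some x).
  exact: nondecreasing_truncate.
Qed.

Lemma alive_semigroup s t F (M : R) z : 0 <= s -> 0 <= t -> 0 <= M ->
  measurable_fun setT F -> (forall y, 0 <= F y <= M%:E)%E ->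
  alive (s + t) F z = alive s (alive t F) z.
Proof.
move=> s0 t0 M0 mF FM.
have F0 y : (0 <= F y)%E by have /andP[] := FM y.
have st0 : 0 <= s + t by rewrite addr_ge0.
have lim1 := cvg_alive (z := z) st0 mF F0.
have mq n := measurable_killed X (@clK n) closed_pt t0 mF FM.
pose g n w : \bar R := ((fun w => killed X (K n) t F (path s w)) \_ (stay X (K n) s)) w.
have mg n : measurable_fun setT (g n).
  apply: measurable_patch; first exact: (measurable_stay X (@clK n) s0).
  exact: measurable_comp_path.
have g0 n w : (0 <= g n w)%E.
  by rewrite /g patchE; case: ifPn => // _; exact: killed_ge0.
have ndg w : nondecreasing_seq (fun n => g n w).
  move=> n m nm; rewrite /g !patchE; case: ifPn => [/set_mem wn|_]; last first.
    by case: ifPn => // _; exact: killed_ge0.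
  rewrite mem_set; first exact: nondecreasing_killed.
  by have := nondecreasing_stay s nm; rewrite subsetEset; apply.
have lim2 : (\int[law z]_w g n w @[n --> \oo] --> alive s (alive t F) z)%E.
  rewrite /alive integral_mkcond.
  have E1 : (\int[law z]_w ((fun w => alive t F (path s w)) \_ (surv X K s)) w =
      \int[law z]_w limn (fun n => g n w))%E.
    apply: eq_integral => w _; apply/esym/cvg_lim => //.
    rewrite patchE; case: ifPn => [/set_mem[k _ wk]|/negP nw].
      apply: cvg_trans (cvg_alive (z := path s w) t0 mF F0).
      apply: near_eq_cvg; exists k => // n /= kn.
      rewrite /g patchE mem_set//.
      by have := nondecreasing_stay s kn; rewrite subsetEset; apply.
    apply: cvg_near_cst; apply: nearW => n; rewrite /g patchE memNset// => wn.
    by apply: nw; apply/mem_set; exists n.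
  rewrite -/(alive t F) E1; exact: cvg_monotone_convergence.
have E2 n : killed X (K n) (s + t) F z = (\int[law z]_w g n w)%E.
  rewrite (killed_semigroup_law X (@clK n) closed_pt _ s0 t0 M0 mF FM).
  by rewrite /killed integral_mkcond.
rewrite (funext E2) in lim1.
exact: (cvg_unique (@ereal_hausdorff R) lim1 lim2).
Qed.

Lemma alive_out t F z : 0 <= t -> measurable_fun setT F -> (forall y, 0 <= F y)%E ->
  (forall n, ~ (Some @` K n) z) -> alive t F z = 0%E.
Proof.
move=> t0 mF F0 nK.
rewrite /alive (ge0_ae_eq_integral (g := cst 0%E))//.
- exact: integral0.
- exact: measurable_alive_event.
- by apply: measurable_funTS; exact: measurable_comp_path.
- apply: filterS (start_ae X closed_pt z) => w wz [n _ Kw].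
  by exfalso; apply: (nK n); rewrite -wz; apply: Kw.
Qed.

End SurvivalKernel.

(** * The killed semigroup on [L^2] *)

Section NonmeasurableIntegral.
Import HBNNSimple.
Context d (T : measurableType d) (R : realType).
Variable P : {measure set T -> \bar R}.

(** Comparison holds without measurability of the integrands: a simple function
    below [f] becomes a simple function below [g] once it is set to [0] on the
    exceptional null set, and its integral does not change. *)
Lemma ge0_le_ae_integral (f g : T -> \bar R) :
  (forall x, 0 <= f x)%E -> (forall x, 0 <= g x)%E ->
  (\forall x \ae P, (f x <= g x)%E) -> (\int[P]_x f x <= \int[P]_x g x)%E.
Proof.
move=> f0 g0 [N [mN N0 fgN]].
rewrite !ge0_integralTE//; apply: ge_ereal_sup => _ [h hf <-].
pose k := mul_nnsfun h (indic_nnsfun R (measurableC mN)).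
have kE x : k x = h x * \1_(~` N) x by [].
apply: le_ereal_sup_tmp; exists (sintegral P k).
  exists k => // x; rewrite kE indicE.
  have [Nx|nNx] := pselect (N x).
    by rewrite memNset ?mulr0//; apply.
  rewrite mem_set// mulr1; apply: (le_trans (hf x)).
  by apply: contrapT => nfg; apply: nNx; exact: fgN.
rewrite -!integralT_nnsfun le_eqVlt; apply/orP; left; apply/eqP.
apply: ge0_ae_eq_integral => //.
- exact/measurable_EFinP.
- exact/measurable_EFinP.
- by move=> x _; rewrite lee_fin.
- by move=> x _; rewrite lee_fin.
exists N; split => // x /= h1; apply: contrapT => nNx; apply: h1 => _.
by congr EFin; rewrite -[RHS]/(h x * \1_(~` N) x) indicE mem_set// mulr1.
Qed.

Lemma ge0_eq_ae_integral (f g : T -> \bar R) :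
  (forall x, 0 <= f x)%E -> (forall x, 0 <= g x)%E ->
  (\forall x \ae P, f x = g x) -> (\int[P]_x f x = \int[P]_x g x)%E.
Proof.
move=> f0 g0 fg; apply/eqP; rewrite eq_le; apply/andP; split.
  by apply: ge0_le_ae_integral => //; apply: filterS fg => x ->.
by apply: ge0_le_ae_integral => //; apply: filterS fg => x ->.
Qed.

End NonmeasurableIntegral.

Lemma integral_restrict_open (R : realType) (E : ptopologicalType)
    (mu : {measure set (borel E) -> \bar R}) (G : set E) (oG : open G)
    (f : borel E -> \bar R) :
  measurable_fun setT f -> (forall x, 0 <= f x)%E ->
  (\int[restrict_open mu oG]_x f x = \int[mu]_x (f \_ G) x)%E.
Proof.
have mG := open_borel oG.
move: f; apply: ge0_measurable_ind.
- move=> A mA; rewrite integral_indic// setIT -integral_mkcond.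
  by rewrite integral_indic.
- move=> a f a0 mf f0 IH; rewrite ge0_integralZl_EFin// IH -ge0_integralZl_EFin//.
  + by apply: eq_integral => x _; rewrite !patchE; case: ifPn => //; rewrite mule0.
  + by move=> x _; rewrite patchE; case: ifPn.
  + exact: measurable_patch.
- move=> f g mf f0 mg g0 IHf IHg; rewrite ge0_integralD// IHf IHg -ge0_integralD//.
  + by apply: eq_integral => x _; rewrite !patchE; case: ifPn => //; rewrite adde0.
  + by move=> x _; rewrite patchE; case: ifPn.
  + exact: measurable_patch.
  + by move=> x _; rewrite patchE; case: ifPn.
  + exact: measurable_patch.
- move=> f g mf f0 ndf fg IH.
  have gE y : g y = limn (fun n => f n y) by apply/esym/cvg_lim; [|exact: fg].
  have gE' y : (g \_ G) y = limn (fun n => (f n \_ G) y).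
    rewrite patchE; case: ifPn => yG.
      by rewrite gE; congr (limn _); apply/funext => n; rewrite patchE yG.
    apply/esym/cvg_lim => //; apply: cvg_near_cst; apply: nearW => n.
    by rewrite patchE (negbTE yG).
  under eq_integral do rewrite gE.
  under [RHS]eq_integral do rewrite gE'.
  rewrite !monotone_convergence//.
  + by congr (limn _); apply/funext => n; exact: IH.
  + by move=> n; exact: measurable_patch.
  + by move=> n x _; rewrite patchE; case: ifPn.
  + by move=> x _ n m nm; rewrite !patchE; case: ifPn => // _; exact: ndf.
Qed.

Section KilledSemigroup.
Context (R : realType) (E : ptopologicalType) d (Omega : measurableType d).
Variables (X : hunt_process R E Omega).
Local Notation path := (hp_path X).
Local Notation law := (hp_law X).
Local Notation opcE := (borel (opc E)).
Variables (G : set E) (K W : nat -> set E).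
Hypothesis oG : open G.
Hypothesis KP : forall n, compact (K n) /\ closed (K n).
Hypothesis WP : forall n, open (W n) /\ W n `<=` K n.
Hypothesis KWS : forall n, K n `<=` K n.+1 /\ W n `<=` W n.+1.
Hypothesis KG : forall n, K n `<=` G.
Hypothesis GW : forall x, G x -> exists n, W n x.

Definition lift (f : E -> R) : opcE -> \bar R := extend0 0%E (EFin \o f).

Lemma lift_ge0 f : (forall x, 0 <= f x) -> (forall z, 0 <= lift f z)%E.
Proof. by move=> f0 [x|] //=; rewrite lee_fin. Qed.

Lemma measurable_lift (f : borel E -> R) : measurable_fun setT f ->
  measurable_fun setT (lift f).
Proof. by move=> mf; apply: measurable_fun_extend0; exact/measurable_EFinP. Qed.

Lemma lift_le f (M : R) : 0 <= M -> (forall x, 0 <= f x <= M) ->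
  (forall z, 0 <= lift f z <= M%:E)%E.
Proof. by move=> M0 fM [x|] /=; rewrite ?lexx ?lee_fin. Qed.

Definition pos_part (f : E -> R) x : R := Num.max (f x) 0.
Definition neg_part (f : E -> R) x : R := Num.max (- f x) 0.

(** The two parts may be integrated over the measurable event [surv], which is
    almost surely [t < exit_time]. *)
Lemma killed_semigroupE t (f : borel E -> R) x : 0 <= t ->
  killed_semigroup X G t f x =
  fine (alive X K t (lift (pos_part f)) (Some x) -
        alive X K t (lift (neg_part f)) (Some x)).
Proof.
move=> t0; rewrite /killed_semigroup /Rintegral; congr fine.
have surv_t := surv_ae X oG KP WP KWS KG GW (Some x) t0.
rewrite integralE; congr (_ - _)%E.
  rewrite /alive [RHS]integral_mkcond; apply: ge0_eq_ae_integral.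
  - by move=> w; exact: funepos_ge0.
  - move=> w; rewrite patchE; case: ifPn => // _.
    by apply: lift_ge0 => y; rewrite /pos_part le_max lexx orbT.
  apply: filterS surv_t => w; rewrite funeposE /= => ->.
  rewrite patchE; case: asboolP => [sw|nsw].
    by rewrite mem_set//; case: (path t w) => [y|] /=; rewrite /pos_part ?EFin_max ?maxxx.
  by rewrite memNset// maxxx.
rewrite /alive [RHS]integral_mkcond; apply: ge0_eq_ae_integral.
- by move=> w; exact: funeneg_ge0.
- move=> w; rewrite patchE; case: ifPn => // _.
  by apply: lift_ge0 => y; rewrite /neg_part le_max lexx orbT.
apply: filterS surv_t => w; rewrite funenegE /= => ->.
rewrite patchE; case: asboolP => [sw|nsw].
  by rewrite mem_set//; case: (path t w) => [y|] /=; rewrite /neg_part ?oppr0 ?EFin_max ?maxxx.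
by rewrite memNset// oppr0 maxxx.
Qed.

End KilledSemigroup.

Section Estimate.
Context (R : realType) (E : ptopologicalType) d (Omega : measurableType d).
Variables (X : hunt_process R E Omega) (mu : probability (borel E) R).
Hypothesis hX : symmetric_process X mu.
Local Notation path := (hp_path X).
Local Notation law := (hp_law X).
Local Notation opcE := (borel (opc E)).
Variables (G : set E) (K W : nat -> set E).
Hypothesis oG : open G.
Hypothesis closed_pt : forall z : opc E, measurable ([set z] : set opcE).
Hypothesis KP : forall n, compact (K n) /\ closed (K n).
Hypothesis WP : forall n, open (W n) /\ W n `<=` K n.
Hypothesis KWS : forall n, K n `<=` K n.+1 /\ W n `<=` W n.+1.
Hypothesis KG : forall n, K n `<=` G.
Hypothesis GW : forall x, G x -> exists n, W n x.
Local Notation muG := (restrict_open mu oG).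
Local Notation aliveK := (alive X K).
Implicit Types (f phi : borel E -> R) (s t h : R).

Lemma restrict_open_finite : (muG setT < +oo)%E.
Proof.
apply: (@le_lt_trans _ _ 1%E); last exact: ltry.
apply: probability_le1; apply: measurableI => //; exact: open_borel.
Qed.

Let clK n : closed (Some @` (K n) : set (opc E)).
Proof. by have [] := KP n; exact: closed_some. Qed.

Let KS n : K n `<=` K n.+1 := (KWS n).1.

Lemma alive_outside t (F : opcE -> \bar R) x : 0 <= t -> measurable_fun setT F ->
  (forall y, 0 <= F y)%E -> ~ G x -> aliveK t F (Some x) = 0%E.
Proof.
move=> t0 mF F0 nG; apply: alive_out => //.
by move=> n [y Ky [yx]]; apply: nG; rewrite -yx; exact: KG Ky.
Qed.

Lemma alive_start (F : opcE -> \bar R) x : measurable_fun setT F ->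
  (forall y, 0 <= F y)%E -> G x -> aliveK 0 F (Some x) = F (Some x).
Proof.
move=> mF F0 Gx; have [n0 Wx] := GW Gx.
have Kx n : (n0 <= n)%N -> (Some @` K n) (Some x).
  move=> n0n; exists x => //.
  exact: (exhaustion_le KWS n0n).1 ((WP n0).2 x Wx).
apply: (cvg_unique (@ereal_hausdorff R) (cvg_alive (z := Some x) (@clK) KS (lexx 0) mF F0)).
apply: cvg_near_cst; exists n0 => // n /= n0n.
rewrite /killed (integral_start X (@clK n) closed_pt)// patchE mem_set//.
exact: Kx.
Qed.

(** Symmetry on [L^2(1_G mu)]: outside [G] the killed kernel vanishes. *)
Lemma alive_symmetric_restrict h s (F H : opcE -> \bar R) (M : R) :
  0 <= h -> 0 <= s -> 0 <= M -> measurable_fun setT F -> measurable_fun setT H ->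
  (forall y, 0 <= F y)%E -> (forall y, 0 <= H y <= M%:E)%E ->
  (\int[muG]_x (aliveK h F (Some x) * aliveK s H (Some x)) =
   \int[muG]_x (F (Some x) * aliveK (h + s) H (Some x)))%E.
Proof.
move=> h0 s0 M0 mF mH F0 HM.
have H0 y : (0 <= H y)%E by have /andP[] := HM y.
have hs0 : 0 <= h + s by rewrite addr_ge0.
have mAH r : 0 <= r -> measurable_fun setT (aliveK r H : opcE -> \bar R).
  by move=> r0; exact: measurable_alive.
have mAF : measurable_fun setT (aliveK h F : opcE -> \bar R) by exact: measurable_alive.
rewrite !integral_restrict_open//; first last.
- by move=> x; rewrite mule_ge0// alive_ge0.
- by apply: emeasurable_funM; apply: measurable_comp_some => //; exact: mAH.
- by move=> x; rewrite mule_ge0// alive_ge0.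
- by apply: emeasurable_funM; apply: measurable_comp_some => //; exact: mAH.
transitivity (\int[mu]_x (aliveK h F (Some x) * aliveK s H (Some x)))%E.
  apply: eq_integral => x _; rewrite patchE; case: ifPn => //.
  by move=> /negP nG; rewrite alive_outside ?mul0e// => Gx; apply: nG; exact/mem_set.
rewrite -(alive_symmetric hX (@clK) KS closed_pt h0 M0 mF (mAH s s0) F0); last first.
  by move=> y; exact: alive_le.
apply: eq_integral => x _.
rewrite -(alive_semigroup X (@clK) KS closed_pt _ h0 s0 M0 mH HM) patchE.
case: ifPn => // /negP nG; rewrite [aliveK _ _ _]alive_outside ?mule0// => Gx.
by apply: nG; exact/mem_set.
Qed.

(** By symmetry against the constant [1], the integral of [aliveK h F] over [G] is at
    most that of [F]. *)
Lemma alive_ae_finite h (F : opcE -> \bar R) : 0 <= h -> measurable_fun setT F ->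
  (forall y, 0 <= F y)%E -> (\int[muG]_x F (Some x) < +oo)%E ->
  \forall x \ae muG, aliveK h F (Some x) \is a fin_num.
Proof.
move=> h0 mF F0 iF.
have mA : measurable_fun setT (fun x : borel E => aliveK h F (Some x)).
  by apply: measurable_comp_some; exact: measurable_alive.
suff : muG.-integrable setT (fun x : borel E => aliveK h F (Some x)).
  by move=> /integrable_ae => /(_ measurableT); apply: filterS => x; apply.
apply/integrableP; split => //.
apply: le_lt_trans iF.
under eq_integral => x _ do rewrite gee0_abs ?alive_ge0//.
have one01 y : (0 <= (cst 1%E : opcE -> \bar R) y <= 1%:E)%E by rewrite /= lee01 lexx.
have := @alive_symmetric_restrict h 0 F (cst 1%E) 1 h0 (lexx 0) ler01 mF
  (measurable_cst _) F0 one01.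
rewrite addr0.
have m1 : measurable_fun setT (aliveK h (cst 1%E) : opcE -> \bar R).
  by apply: measurable_alive => // y; rewrite lee01.
have m0 : measurable_fun setT (aliveK 0 (cst 1%E) : opcE -> \bar R).
  by apply: measurable_alive => // y; rewrite lee01.
move=> E1.
apply: (@le_trans _ _ (\int[muG]_x (aliveK h F (Some x) * aliveK 0 (cst 1%E) (Some x)))%E).
  rewrite (integral_restrict_open mu oG mA); last by move=> x; exact: alive_ge0.
  rewrite integral_restrict_open; first last.
  - by move=> x; rewrite mule_ge0 ?alive_ge0// => y; rewrite lee01.
  - by apply: emeasurable_funM => //; exact: measurable_comp_some.
  rewrite le_eqVlt; apply/orP; left; apply/eqP; apply: eq_integral => x _.
  rewrite !patchE; case: ifPn => // /set_mem Gx.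
  by rewrite alive_start ?mule1// => y; rewrite lee01.
rewrite E1; apply: ge0_le_integral => //.
- by move=> x _; rewrite mule_ge0 ?alive_ge0// => y; rewrite lee01.
- by apply: emeasurable_funM; exact: measurable_comp_some.
- exact: measurable_comp_some.
- move=> x _; rewrite -[leRHS]mule1 lee_wpmul2l//.
  by have /andP[] := alive_le X (@clK) KS (Some x) h0 ler01 (measurable_cst _) one01.
Qed.

Lemma measurable_pos_part f : measurable_fun setT f -> measurable_fun setT (pos_part f : borel E -> R).
Proof. by move=> mf; exact: measurable_maxr. Qed.

Lemma measurable_neg_part f : measurable_fun setT f -> measurable_fun setT (neg_part f : borel E -> R).
Proof. by move=> mf; apply: measurable_maxr => //; exact: measurableT_comp. Qed.

Lemma pos_part_ge0 f x : 0 <= pos_part f x.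
Proof. by rewrite /pos_part le_max lexx orbT. Qed.

Lemma neg_part_ge0 f x : 0 <= neg_part f x.
Proof. by rewrite /neg_part le_max lexx orbT. Qed.

Lemma pos_neg_part f x : f x = pos_part f x - neg_part f x.
Proof.
by rewrite /pos_part /neg_part; case: (leP (f x) 0); case: (leP (- f x) 0); lra.
Qed.

Lemma measurable_killed_semigroup h (f : borel E -> R) : 0 <= h ->
  measurable_fun setT f -> measurable_fun setT (killed_semigroup X G h f : borel E -> R).
Proof.
move=> h0 mf.
rewrite (_ : killed_semigroup X G h f = fun x =>
  fine (aliveK h (lift (pos_part f)) (Some x) - aliveK h (lift (neg_part f)) (Some x))%E).
  apply: (@measurableT_comp _ _ _ _ _ _ fine); first exact: (fine_measurable measurableT).
  apply: emeasurable_funB; apply: measurable_comp_some; apply: measurable_alive => //.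
  - by apply: measurable_lift; exact: measurable_pos_part.
  - exact/lift_ge0/pos_part_ge0.
  - by apply: measurable_lift; exact: measurable_neg_part.
  - exact/lift_ge0/neg_part_ge0.
apply/funext => x.
exact: (killed_semigroupE X oG KP WP KWS KG GW).
Qed.

End Estimate.

Section Decay.
Context (R : realType) (E : ptopologicalType) d (Omega : measurableType d).
Variables (X : hunt_process R E Omega) (mu : probability (borel E) R).
Hypothesis hX : symmetric_process X mu.
Local Notation path := (hp_path X).
Local Notation law := (hp_law X).
Local Notation opcE := (borel (opc E)).
Variables (G : set E) (K W : nat -> set E).
Hypothesis oG : open G.
Hypothesis closed_pt : forall z : opc E, measurable ([set z] : set opcE).
Hypothesis KP : forall n, compact (K n) /\ closed (K n).
Hypothesis WP : forall n, open (W n) /\ W n `<=` K n.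
Hypothesis KWS : forall n, K n `<=` K n.+1 /\ W n `<=` W n.+1.
Hypothesis KG : forall n, K n `<=` G.
Hypothesis GW : forall x, G x -> exists n, W n x.
Local Notation muG := (restrict_open mu oG).
Local Notation aliveK := (alive X K).
Implicit Types (u v : L2 muG) (s t h : R).

Let clK n : closed (Some @` (K n) : set (opc E)).
Proof. by have [] := KP n; exact: closed_some. Qed.

Let KS n : K n `<=` K n.+1 := (KWS n).1.

Let mT : (muG setT < +oo)%E := restrict_open_finite mu oG.

Lemma integral_part_finite u (w : borel E -> R) : measurable_fun setT w ->
  (forall x, 0 <= w x <= `|u x|) -> (\int[muG]_x (w x)%:E < +oo)%E.
Proof.
move=> mw wu; have [c c0 cP] := integral_abs_L2 mT.
apply: (@le_lt_trans _ _ (c * nrm u)%:E); last exact: ltry.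
apply: le_trans (cP u); apply: ge0_le_integral => //.
- by move=> x _; rewrite lee_fin; have /andP[] := wu x.
- exact/measurable_EFinP.
- by apply/measurable_EFinP; exact: measurableT_comp.
- by move=> x _; rewrite lee_fin; have /andP[] := wu x.
Qed.

Section Orbit.
Variables (phi : borel E -> R) (M : R).
Hypothesis mphi : measurable_fun setT phi.
Hypothesis M0 : 0 <= M.
Hypothesis phiM : forall x, 0 <= phi x <= M.
Variable psi : R -> L2 muG.
Hypothesis psiE : forall s, 0 <= s ->
  psi s = (fun x => fine (aliveK s (lift phi) (Some x))) :> (borel E -> R).

Lemma orbit_EFin s x : 0 <= s -> (psi s x)%:E = aliveK s (lift phi) (Some x).
Proof.
move=> s0; rewrite psiE// fineK//.
have /andP[a0 aM] := alive_le X (@clK) KS (Some x) s0 M0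
  (measurable_lift mphi) (lift_le M0 phiM).
by rewrite ge0_fin_numE// (le_lt_trans aM)// ltry.
Qed.

Lemma orbit_bounds s x : 0 <= s -> 0 <= psi s x <= M.
Proof.
move=> s0; rewrite -!lee_fin orbit_EFin//.
exact: (alive_le X (@clK) KS (Some x) s0 M0 (measurable_lift mphi) (lift_le M0 phiM)).
Qed.

Lemma part_symmetric h s (w : borel E -> R) : 0 <= h -> 0 <= s ->
  measurable_fun setT w -> (forall x, 0 <= w x) ->
  (\int[muG]_x (w x)%:E < +oo)%E ->
  let a (x : borel E) : R := fine (aliveK h (lift w) (Some x)) in
  [/\ \forall x \ae muG, (a x)%:E = aliveK h (lift w) (Some x),
      muG.-integrable setT (fun x => (a x * psi s x)%:E),
      muG.-integrable setT (fun x => (w x * psi (s + h) x)%:E) &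
      (\int[muG]_x (a x * psi s x)%:E = \int[muG]_x (w x * psi (s + h) x)%:E)%E].
Proof.
move=> h0 s0 mw w0 iw a.
have sh0 : 0 <= s + h by rewrite addr_ge0.
have mA : measurable_fun setT (fun x : borel E => aliveK h (lift w) (Some x)).
  apply: measurable_comp_some; apply: measurable_alive => //.
    exact: measurable_lift.
  exact: lift_ge0.
have ma : measurable_fun setT (a : borel E -> R).
  by apply: (@measurableT_comp _ _ _ _ _ _ fine) => //; exact: (fine_measurable measurableT).
have aeA : \forall x \ae muG, (a x)%:E = aliveK h (lift w) (Some x).
  have := @alive_ae_finite _ _ _ _ X mu hX G K W oG closed_pt KP WP KWS KG GW h (lift w)
    h0 (measurable_lift mw) (lift_ge0 w0) iw.
  have FF : Filter (nbhs (almost_everywhere muG)) by exact: ae_filter_ringOfSetsType.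
  by apply: filterS => x fx; rewrite /a fineK.
have E1 : (\int[muG]_x (a x * psi s x)%:E = \int[muG]_x (w x * psi (s + h) x)%:E)%E.
  transitivity (\int[muG]_x (aliveK h (lift w) (Some x) * aliveK s (lift phi) (Some x)))%E.
    apply: ae_eq_integral => //.
    - by apply/measurable_EFinP; exact: measurable_funM.
    - apply: emeasurable_funM => //; apply: measurable_comp_some.
      apply: measurable_alive => //; first exact: measurable_lift.
      by apply: lift_ge0 => x; have /andP[] := phiM x.
    by move: aeA; apply: filterS => x aE _; rewrite EFinM aE orbit_EFin.
  rewrite (alive_symmetric_restrict hX oG closed_pt KP KWS KG h0 s0 M0
    (measurable_lift mw) (measurable_lift mphi) (lift_ge0 w0) (lift_le M0 phiM)).
  by apply: eq_integral => x _; rewrite EFinM orbit_EFin// addrC.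
have psi0 r x : 0 <= r -> 0 <= psi r x by move=> r0; have /andP[] := orbit_bounds x r0.
have iw' : muG.-integrable setT (fun x => (w x * psi (s + h) x)%:E).
  apply/integrableP; split; first by apply/measurable_EFinP; exact: measurable_funM.
  apply: (@le_lt_trans _ _ (\int[muG]_x (M%:E * (w x)%:E))%E).
    apply: ge0_le_integral => //.
    - by apply: measurableT_comp => //; apply/measurable_EFinP; exact: measurable_funM.
    - by apply/measurable_EFinP; apply: measurable_funM.
    - move=> x _ /=; rewrite ger0_norm; last by rewrite mulr_ge0// psi0.
      rewrite lee_fin mulrC ler_wpM2r//.
      by have /andP[] := orbit_bounds x sh0.
  rewrite ge0_integralZl_EFin//; first last.
  - exact/measurable_EFinP.
  - by move=> x _; rewrite lee_fin.
  by rewrite lte_mul_pinfty ?lee_fin.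
split; [exact: aeA| |exact: iw'|exact: E1].
apply/integrableP; split.
  by apply/measurable_EFinP; exact: measurable_funM.
have a0 x : 0 <= a x by rewrite fine_ge0// alive_ge0//; exact: lift_ge0.
under eq_integral => x _ do rewrite gee0_abs ?lee_fin ?mulr_ge0 ?psi0//.
rewrite E1; apply: integrable_lty => //.
Qed.

(** Symmetry and the semigroup property, applied to the positive and negative parts
    of [u]. The pairings are finite because [psi s] is bounded and, the measure being
    finite, [u] is integrable. *)
Lemma alive_dot_symmetric h s u v : 0 < h -> 0 <= s ->
  v = killed_semigroup X G h u :> (borel E -> R) ->
  dotL2 muG v (psi s) = dotL2 muG u (psi (s + h)).
Proof.
move=> hp s0 vE; have h0 := ltW hp.
have mu_ : measurable_fun setT u by [].
have [|aeP iP iP' EP] := part_symmetric h0 s0 (measurable_pos_part mu_) (pos_part_ge0 u).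
  apply: (@integral_part_finite u); first exact: measurable_pos_part.
  by move=> x; rewrite pos_part_ge0 /pos_part ge_max ler_norm normr_ge0.
have [|aeN iN iN' EN] := part_symmetric h0 s0 (measurable_neg_part mu_) (neg_part_ge0 u).
  apply: (@integral_part_finite u); first exact: measurable_neg_part.
  by move=> x; rewrite neg_part_ge0 /neg_part ge_max -normrN ler_norm normr_ge0.
rewrite {1}/dotL2.
set a := fun x : borel E => fine (aliveK h (lift (pos_part u)) (Some x)) in aeP iP EP.
set b := fun x : borel E => fine (aliveK h (lift (neg_part u)) (Some x)) in aeN iN EN.
have -> : \int[muG]_x (v x * psi s x) = \int[muG]_x (a x * psi s x - b x * psi s x).
  rewrite /Rintegral; congr fine; apply: ae_eq_integral => //.
  - by apply/measurable_EFinP; exact: measurable_funM.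
  - apply/measurable_EFinP; apply: measurable_funB; apply/measurable_EFinP.
      exact: measurable_int iP.
    exact: measurable_int iN.
  have FF : Filter (nbhs (almost_everywhere muG)) by exact: ae_filter_ringOfSetsType.
  apply: filterS2 aeP aeN => x aE bE _; rewrite vE.
  rewrite (killed_semigroupE X oG KP WP KWS KG GW)// -aE -bE.
  by rewrite -mulrBl.
rewrite RintegralB// /Rintegral EP EN -/(Rintegral _ _ _) -/(Rintegral _ _ _).
rewrite -[X in X - _ = _]/(\int[muG]_x (pos_part u x * psi (s + h) x)).
rewrite -[X in _ - X = _]/(\int[muG]_x (neg_part u x * psi (s + h) x)).
rewrite -RintegralB// /dotL2; apply: eq_Rintegral => x _.
by rewrite -mulrBl -pos_neg_part.
Qed.

(** Pointwise [psi t x <= M * P_x (t < exit_time)], and a probability dominates its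
    square; Markov's inequality for [exit_time `^ r] bounds the integral. *)
Lemma orbit_decay (t r : R) : 0 < t -> 0 < r ->
  ((nrm (psi t) ^+ 2)%:E <= (M ^+ 2 * t `^ (- r))%:E * exit_moment X mu G r)%E.
Proof.
move=> tp r0; have t0 := ltW tp.
pose p (x : borel E) : \bar R := aliveK t (cst 1%E) (Some x).
have mp : measurable_fun setT p.
  by apply: measurable_comp_some; apply: measurable_alive => // y; rewrite lee01.
have p0 x : (0 <= p x)%E by apply: alive_ge0 => y; rewrite lee01.
have one01 y : (0 <= (cst 1%E : opcE -> \bar R) y <= 1%:E)%E by rewrite /= lee01 lexx.
have p1 x : (p x <= 1)%E.
  by have /andP[] := alive_le X (@clK) KS (Some x) t0 ler01 (measurable_cst _) one01.
have pE x : p x = law (Some x) (surv X K t).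
  rewrite /p /alive integral_cst ?mul1e//.
  exact: (measurable_alive_event X (@clK)).
have psi_le x : ((psi t x ^+ 2)%:E <= (M ^+ 2)%:E * p x)%E.
  have /andP[q0 q1] := orbit_bounds x t0.
  have qp : ((psi t x)%:E <= M%:E * p x)%E.
    rewrite orbit_EFin// /p /alive -ge0_integralZl_EFin//; last first.
      exact: (measurable_alive_event X (@clK)).
    have msv := measurable_alive_event X (@clK) t0.
    apply: ge0_le_integral => //.
    - by move=> w _; have /andP[] := lift_le M0 phiM (path t w).
    - apply: measurable_funTS; apply: measurable_comp_path => //.
      exact: measurable_lift.
    - by move=> w _; rewrite /= mule1; have /andP[] := lift_le M0 phiM (path t w).
  rewrite !expr2 !EFinM.
  rewrite -muleA; apply: lee_pmul => //; rewrite ?lee_fin//.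
rewrite nrm_sqrE.
apply: (@le_trans _ _ (\int[muG]_x ((M ^+ 2)%:E * p x))%E).
  apply: ge0_le_integral => //.
  - by move=> x _; rewrite lee_fin sqr_ge0.
  - by apply/measurable_EFinP; exact: measurable_funX.
  - by apply: emeasurable_funM.
rewrite ge0_integralZl_EFin ?sqr_ge0// (EFinM (M ^+ 2)) -(muleA (M ^+ 2)%:E) lee_wpmul2l ?lee_fin ?sqr_ge0//.
rewrite integral_restrict_open//.
have tr0 : 0 < t `^ r by rewrite powR_gt0.
rewrite powRN -[leLHS](mul1e) -(mulVf (lt0r_neq0 tr0)) EFinM -muleA.
rewrite lee_wpmul2l ?lee_fin ?invr_ge0 ?(ltW tr0)//.
rewrite -ge0_integralZl_EFin ?(ltW tr0)//; [|by move=> x _; rewrite patchE; case: ifPn|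
  by apply: measurable_patch => //; exact: open_borel].
rewrite /exit_moment; apply: ge0_le_ae_integral => [x|x|].
- by rewrite mule_ge0 ?lee_fin ?(ltW tr0)// patchE; case: ifPn.
- by apply: integral_ge0 => w _; exact: poweR_ge0.
apply: nearW => x.
apply: (@le_trans _ _ ((t `^ r)%:E * p x)%E).
  by rewrite lee_wpmul2l ?lee_fin ?(ltW tr0)// patchE; case: ifPn.
have msv := measurable_alive_event X (@clK) t0.
rewrite pE -integral_cst// integral_mkcond.
apply: ge0_le_ae_integral => [w|w|].
- by rewrite patchE; case: ifPn => //; rewrite lee_fin (ltW tr0).
- exact: poweR_ge0.
apply: nearW => w; rewrite patchE; case: ifPn => [/set_mem sw|_]; last exact: poweR_ge0.
have := surv_exit_time oG KG t0 sw.
case: (exit_time X G w) (exit_time_ge0 X G w) => [q| |] //; last first.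
  by rewrite poweRyr ?leey ?gt_eqF.
rewrite !lee_fin lte_fin => q0 tq; rewrite ?lee_fin.
by rewrite ge0_ler_powR ?nnegrE ?(ltW tq) ?(ltW r0).
Qed.

End Orbit.

End Decay.

(** * Low frequencies of bounded functions *)

Lemma nrm_le_sqrt d (T : measurableType d) (R : realType)
    (m : {measure set T -> \bar R}) (a : R) (u : L2 m) :
  nrm u ^+ 2 <= a -> nrm u <= Num.sqrt a.
Proof. by move=> ua; rewrite -[leLHS]ger0_norm ?nrm_ge0// -sqrtr_sqr ler_wsqrtr. Qed.

Lemma negligible_outside (R : realType) (E : ptopologicalType)
    (mu : {measure set (borel E) -> \bar R}) (G : set E) (oG : open G) :
  \forall x \ae restrict_open mu oG, G x.
Proof.
have mG := open_borel oG.
exists (~` G); split; [exact: measurableC| |by []].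
by rewrite /= /mrestr setICl measure0.
Qed.

Section LowFrequency.
Context (R : realType) (E : ptopologicalType) d (Omega : measurableType d).
Variables (X : hunt_process R E Omega) (mu : probability (borel E) R).
Hypothesis hX : symmetric_process X mu.
Local Notation opcE := (borel (opc E)).
Variables (G : set E) (K W : nat -> set E).
Hypothesis oG : open G.
Hypothesis closed_pt : forall z : opc E, measurable ([set z] : set opcE).
Hypothesis KP : forall n, compact (K n) /\ closed (K n).
Hypothesis WP : forall n, open (W n) /\ W n `<=` K n.
Hypothesis KWS : forall n, K n `<=` K n.+1 /\ W n `<=` W n.+1.
Hypothesis KG : forall n, K n `<=` G.
Hypothesis GW : forall x, G x -> exists n, W n x.
Local Notation muG := (restrict_open mu oG).
Local Notation aliveK := (alive X K).
Variable S : spectral_family muG.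
Hypothesis hS : spectral_family_of_opp S (generator (killed_semigroup X G)).
Implicit Types (u v : L2 muG) (s t h xi : R).

Let clK n : closed (Some @` (K n) : set (opc E)).
Proof. by have [] := KP n; exact: closed_some. Qed.

Let KS n : K n `<=` K n.+1 := (KWS n).1.

Let mT : (muG setT < +oo)%E := restrict_open_finite mu oG.

Lemma orbit_exists (phi : borel E -> R) (M : R) : measurable_fun setT phi -> 0 <= M ->
  (forall x, 0 <= phi x <= M) -> exists psi : R -> L2 muG, forall s, 0 <= s ->
  psi s = (fun x => fine (aliveK s (lift phi) (Some x))) :> (borel E -> R).
Proof.
move=> mphi M0 phiM.
suff : forall s : R, exists g : L2 muG, 0 <= s ->
    g = (fun x => fine (aliveK s (lift phi) (Some x))) :> (borel E -> R).
  by move=> /choice[psi psiP]; exists psi.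
move=> s; have [s0|] := leP 0 s; last by exists 0.
have mA : measurable_fun setT (fun x : borel E => fine (aliveK s (lift phi) (Some x))).
  apply: (@measurableT_comp _ _ _ _ _ _ fine); first exact: (fine_measurable measurableT).
  apply: measurable_comp_some; apply: measurable_alive => //; first exact: measurable_lift.
  by apply: lift_ge0 => x; have /andP[] := phiM x.
have [|g gE] := bounded_L2 (M := M) mT mA; last by exists g.
move=> x.
have /andP[a0 aM] := alive_le X (@clK) KS (Some x) s0 M0 (measurable_lift mphi) (lift_le M0 phiM).
have af : aliveK s (lift phi) (Some x) \is a fin_num.
  by rewrite ge0_fin_numE// (le_lt_trans aM)// ltry.
by rewrite ger0_norm ?fine_ge0// -lee_fin fineK.
Qed.

(** The orbit starts at [phi] and has decayed by time [(2 * xi)^-1]; over so short a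
    time its pairing with a vector of frequencies at most [xi] cannot have changed
    much, which is [orbit_bound]. *)
Lemma dot_low_frequency_le (phi : borel E -> R) (M xi r : R) u :
  measurable_fun setT phi -> 0 <= M -> (forall x, 0 <= phi x <= M) ->
  0 < xi -> 0 < r -> (exit_moment X mu G r < +oo)%E ->
  S xi u = u %[ae muG] ->
  `|dotL2 muG u phi| <=
  2 * Num.sqrt (M ^+ 2 * (2 * xi) `^ r * fine (exit_moment X mu G r)) * nrm u.
Proof.
move=> mphi M0 phiM xi0 r0 mom uxi.
have [psi psiE] := orbit_exists mphi M0 phiM.
have psi_bd := orbit_bounds KP KWS mphi M0 phiM psiE.
have psiK s : 0 <= s -> nrm (psi s) <= Num.sqrt (M ^+ 2 * fine (muG setT)).
  move=> s0; apply: nrm_le_sqrt; rewrite -lee_fin nrm_sqrE.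
  rewrite EFinM fineK ?ge0_fin_numE//.
  rewrite -integral_cst//; apply: ge0_le_integral => //.
  - by move=> x _; rewrite lee_fin sqr_ge0.
  - by apply/measurable_EFinP; exact: measurable_funX.
  - move=> x _ /=; rewrite lee_fin; have /andP[p0 p1] := psi_bd s x s0.
    by rewrite ler_pXn2r ?nnegrE.
pose t : R := (2 * xi)^-1.
have t0 : 0 < t by rewrite invr_gt0 mulr_gt0.
have xit : xi * t = 2^-1 by rewrite /t invfM mulrCA mulfV ?mulr1 ?gt_eqF.
have phi_ae : dotL2 muG u phi = dotL2 muG u (psi 0).
  have [g gE] : exists g : L2 muG, g = phi :> (borel E -> R).
    by apply: (bounded_L2 (M := M) mT mphi) => x; have /andP[p0 p1] := phiM x; rewrite ger0_norm.
  rewrite -gE; apply: ae_eq_dotL2; first exact: ae_eq_refl.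
  have FF : Filter (nbhs (almost_everywhere muG)) by exact: ae_filter_ringOfSetsType.
  have := negligible_outside mu oG; apply: filterS => x Gx _.
  rewrite psiE// (alive_start X closed_pt KP WP KWS GW)//=; first by rewrite gE.
    exact: measurable_lift.
  by apply: lift_ge0 => y; have /andP[] := phiM y.
rewrite phi_ae.
have mP h v : 0 < h -> measurable_fun setT (killed_semigroup X G h v : borel E -> R).
  by move=> h0; apply: (measurable_killed_semigroup X oG closed_pt KP WP KWS KG GW (ltW h0)).
have sym := alive_dot_symmetric hX closed_pt KP WP KWS KG GW mphi M0 phiM psiE.
apply: le_trans (orbit_bound mT mP hS psiK sym (ltW xi0) (ltW t0) xit uxi) _.
rewrite ler_wpM2r ?nrm_ge0// ler_wpM2l//.
apply: nrm_le_sqrt.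
have mom0 : (0 <= exit_moment X mu G r)%E.
  by apply: integral_ge0 => x _; apply: integral_ge0 => w _; exact: poweR_ge0.
rewrite -lee_fin (EFinM (_ * _) (fine _)) fineK ?ge0_fin_numE//.
have tr : t `^ (- r) = (2 * xi) `^ r.
  by rewrite /t -(powR_inv1 (mulr_ge0 _ (ltW xi0)))// -powRrM mulN1r opprK.
rewrite -tr.
exact: (orbit_decay closed_pt KP KWS KG mphi M0 phiM psiE t0 r0).
Qed.

(** The pairing of [u = S xi f] with [f] is the square of the norm of [u], and by
    [dot_low_frequency_le], for the positive and negative parts of [f], it is at most
    a small multiple of the norm of [u]. *)
Lemma low_frequency_le (f : L2 muG) (M xi r : R) :
  0 <= M -> (\forall x \ae muG, `|f x| <= M) ->
  0 < xi -> 0 < r -> (exit_moment X mu G r < +oo)%E ->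
  dotL2 muG (S xi f) f <=
  16 * (M ^+ 2 * (2 * xi) `^ r * fine (exit_moment X mu G r)).
Proof.
move=> M0 fM xi0 r0 mom.
set A := (X in 16 * X).
have mom0 : (0 <= exit_moment X mu G r)%E.
  by apply: integral_ge0 => x _; apply: integral_ge0 => w _; exact: poweR_ge0.
have A0 : 0 <= A by rewrite !mulr_ge0 ?sqr_ge0 ?powR_ge0 ?fine_ge0.
have mf : measurable_fun setT f by [].
(* Truncation at [M] changes nothing almost everywhere and gives a bound valid
   everywhere. *)
pose phi1 x := Num.min (pos_part f x) M; pose phi2 x := Num.min (neg_part f x) M.
have phi1M x : 0 <= phi1 x <= M by rewrite le_min pos_part_ge0 M0 ge_min lexx orbT.
have phi2M x : 0 <= phi2 x <= M by rewrite le_min neg_part_ge0 M0 ge_min lexx orbT.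
have m1 : measurable_fun setT (phi1 : borel E -> R).
  by apply: measurable_minr => //; exact: measurable_pos_part.
have m2 : measurable_fun setT (phi2 : borel E -> R).
  by apply: measurable_minr => //; exact: measurable_neg_part.
have [g1 g1E] : exists g : L2 muG, g = phi1 :> (borel E -> R).
  by apply: (bounded_L2 (M := M) mT m1) => x; have /andP[p0 p1] := phi1M x; rewrite ger0_norm.
have [g2 g2E] : exists g : L2 muG, g = phi2 :> (borel E -> R).
  by apply: (bounded_L2 (M := M) mT m2) => x; have /andP[p0 p1] := phi2M x; rewrite ger0_norm.
have FF : Filter (nbhs (almost_everywhere muG)) by exact: ae_filter_ringOfSetsType.
have fE : f = g1 - g2 %[ae muG].
  apply: filterS fM => x fxM _.
  rewrite -[RHS]/(g1 x - g2 x) g1E g2E /phi1 /phi2 /pos_part /neg_part.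
  move: fxM; rewrite ler_norml => /andP[].
  by case: (leP (f x) 0); case: (leP (- f x) 0); rewrite /Order.min/=;
    do ?case: ifPn; rewrite -?leNgt; lra.
set u := S xi f.
have uxi : S xi u = u %[ae muG] by exact: sf_idempotent (ltW xi0).
have uu : nrm u ^+ 2 = dotL2 muG u f by rewrite nrm_sqr sf_dot_idem// ltW.
have b1 := dot_low_frequency_le m1 M0 phi1M xi0 r0 mom uxi.
have b2 := dot_low_frequency_le m2 M0 phi2M xi0 r0 mom uxi.
have key : nrm u ^+ 2 <= 4 * Num.sqrt A * nrm u.
  have -> : nrm u ^+ 2 = dotL2 muG u (g1 - g2).
    by rewrite uu; apply: ae_eq_dotL2 fE; exact: ae_eq_refl.
  rewrite dotL2Br g1E g2E.
  apply: le_trans (ler_norm _) _; apply: le_trans (ler_normB _ _) _.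
  apply: le_trans (lerD b1 b2) _; rewrite -/A; lra.
have uA : nrm u <= 4 * Num.sqrt A.
  have [->|u0] := eqVneq (nrm u) 0; first by rewrite mulr_ge0 ?sqrtr_ge0.
  have up : 0 < nrm u by rewrite lt_neqAle eq_sym u0 nrm_ge0.
  by move: key; rewrite expr2 ler_pM2r.
rewrite -uu (_ : 16 * A = (4 * Num.sqrt A) ^+ 2); last first.
  by rewrite exprMn sqr_sqrtr//; congr (_ * _); ring.
by rewrite ler_pXn2r ?nnegrE ?nrm_ge0 ?mulr_ge0 ?sqrtr_ge0.
Qed.

End LowFrequency.

(** * The Nash inequality *)

Section SupNorm.
Context d (T : measurableType d) (R : realType).
Variable m : {measure set T -> \bar R}.
Implicit Types u v : L2 m.

Lemma ae_eq_Linfty u v : u = v %[ae m] ->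
  ('N[m]_+oo[EFin \o u] = 'N[m]_+oo[EFin \o v])%E.
Proof.
move=> uv; rewrite unlock; case: ifPn => // _; apply: eq_ess_sup.
by apply: filterS uv => x /= /(_ I) ->.
Qed.

Lemma LinftyZ (c : R) u :
  ('N[m]_+oo[EFin \o (c *: u : L2 m)] = `|c|%:E * 'N[m]_+oo[EFin \o u])%E.
Proof.
rewrite unlock; case: ifPn => [mT0|_]; last by rewrite mule0.
rewrite -ess_supZl//; apply: eq_ess_sup; apply: nearW => x /=.
by rewrite -EFinM -normrM.
Qed.

Lemma Linfty_ae u : ('N[m]_+oo[EFin \o u] < +oo)%E ->
  \forall x \ae m, `|u x| <= fine ('N[m]_+oo[EFin \o u])%E.
Proof.
move=> Noo.
have := ess_sup_ge m (abse \o EFin \o u).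
have NE : ('N[m]_+oo[EFin \o u])%E \is a fin_num.
  by rewrite ge0_fin_numE// Lnorm_ge0.
move: NE Noo; rewrite unlock; case: ifPn => [m0 NE _|].
  by apply: filterS => x ux; rewrite -lee_fin; move: NE => /fineK ->.
rewrite -leNgt measure_le0 => /eqP m0 _ _ _.
by exists setT; split.
Qed.

End SupNorm.

(** The choice [xi = (e / a) `^ (l + 2)^-1] makes [e / xi] and [xi `^ (l + 1) * a]
    equal. *)
Lemma nash_optimization (R : realType) (D e a c l : R) :
  0 < l -> 0 < e -> 0 < a ->
  (forall xi, 0 < xi -> D <= e / xi + c * (xi `^ (l + 1) * a)) ->
  D <= (1 + c) * (e `^ ((l + 2) / (l + 1))^-1 * a `^ (l + 2)^-1).
Proof.
move=> l0 e0 a0 DP.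
pose q := (l + 2)^-1.
have q0 : 0 < q by rewrite invr_gt0; lra.
have ql : (l + 1) * q = 1 - q by rewrite /q; field; lra.
have pE : ((l + 2) / (l + 1))^-1 = 1 - q by rewrite invf_div -ql.
rewrite pE -/q.
pose xi := e `^ q * a `^ (- q).
have xi0 : 0 < xi by rewrite mulr_gt0 ?powR_gt0.
have pDe (x r s : R) : 0 < x -> x `^ (r + s) = x `^ r * x `^ s.
  by move=> x0; rewrite powRD// (gt_eqF x0) implybT.
have E1 : e / xi = e `^ (1 - q) * a `^ q.
  by rewrite /xi invfM -!powRN opprK mulrA (pDe e)// powRr1// ltW.
have E2 : xi `^ (l + 1) * a = e `^ (1 - q) * a `^ q.
  rewrite /xi powRM ?powR_ge0// -!powRrM !(mulrC _ (l + 1)) mulrN ql.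
  rewrite -mulrA -[X in _ * (_ * X)](powRr1 (ltW a0)) -pDe//.
  by rewrite opprB subrK.
apply: le_trans (DP _ xi0) _.
by rewrite E1 E2 mulrDl mul1r.
Qed.

Theorem proposition2p5 (R : realType) (E : ptopologicalType) (hE : lccb E)
    (mu : probability (borel E) R) (hmu : radon mu)
    (d : measure_display) (Omega : measurableType d)
    (X : hunt_process R E Omega) (hX : symmetric_process X mu)
    (G : set E) (oG : open G)
    (htau : \forall x \ae mu,
       \forall w \ae hp_law X (Some x), (exit_time X G w < +oo)%E)
    (S : spectral_family (restrict_open mu oG))
    (hS : spectral_family_of_opp S (generator (killed_semigroup X G)))
    (l : R) (hl : 0 < l)
    (hmom : (exit_moment X mu G (l + 1) < +oo)%E) :
  let muG := restrict_open mu oG in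
  let p := (l + 2) / (l + 1) in
  let q := l + 2 in
  exists (C : R) (Phi : L2 muG -> \bar R),
    [/\ 0 < C,
        (forall f g : L2 muG, f = g %[ae muG] -> Phi f = Phi g) /\
        (forall f : L2 muG, (0 <= Phi f)%E),
        (forall (c : R) (f : L2 muG), Phi (c *: f) = ((c ^+ 2)%:E * Phi f)%E),
        (forall f : L2 muG, (spectral_energy S f < +oo)%E ->
           (normL2 muG (f - S 0 f)%R ^+ 2 <=
            C%:E * (spectral_energy S f `^ p^-1 * Phi f `^ q^-1))%E) &
        (forall f : L2 muG,
           (Phi f <= 'N[muG]_+oo[EFin \o f] ^+ 2 *
                     exit_moment X mu G (l + 1))%E)].
Proof.
move=> muG p q.
have [K [W [KP WP KWS KG GW]]] := compact_exhaustion hE oG.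
have hausE : hausdorff_space E by case: hE.
have closed_pt z := measurable_point z hausE.
have mT : (muG setT < +oo)%E := restrict_open_finite mu oG.
have l10 : 0 < l + 1 by lra.
set mom := exit_moment X mu G (l + 1) in hmom *.
have mom0 : (0 <= mom)%E.
  by apply: integral_ge0 => x _; apply: integral_ge0 => w _; exact: poweR_ge0.
have momE : (fine mom)%:E = mom by rewrite fineK// ge0_fin_numE.
pose c : R := 16 * 2 `^ (l + 1).
have c0 : 0 <= c by rewrite mulr_ge0 ?powR_ge0.
have low (f : L2 muG) (M xi : R) : 0 <= M -> (\forall x \ae muG, `|f x| <= M) -> 0 < xi ->
    dotL2 muG (S xi f) f <= c * (xi `^ (l + 1) * (M ^+ 2 * fine mom)).
  move=> M0 fM xi0.
  have := low_frequency_le hX closed_pt KP WP KWS KG GW hS M0 fM xi0 l10 hmom.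
  rewrite powRM ?(ltW xi0)// -/mom => /le_trans; apply.
  by rewrite le_eqVlt; apply/orP; left; apply/eqP; rewrite /c; ring.
(* The constant function [1] has no mass at any frequency if [mom = 0]. *)
have null_of_mom : mom = 0%E -> muG setT = 0%E.
  move=> momz.
  have [u uE] : exists u : L2 muG, u = cst 1 :> (borel E -> R).
    by apply: (bounded_L2 (M := 1) mT) => // x; rewrite /= normr1.
  have u1 : \forall x \ae muG, `|u x| <= 1.
    by exists set0; split => // x; rewrite /= uE normr1 lexx => /(_ isT).
  have nu : nrm u = 0.
    apply: (nrm_eq0_of_sf (S := S)) => xi xi0; have := low u 1 xi ler01 u1 xi0.
    by rewrite momz /= !mulr0.
  have := nrm_sqrE u; rewrite nu uE expr0n.
  by under eq_integral do rewrite expr1n; rewrite integral_cst// mul1e.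
exists (1 + c), (fun f => 'N[muG]_+oo[EFin \o f] ^+ 2 * mom)%E; split.
- by rewrite ltr_pwDl.
- split=> [f g fg|f]; first by rewrite (ae_eq_Linfty fg).
  by rewrite mule_ge0// expe2 mule_ge0// Lnorm_ge0.
- move=> k f; rewrite LinftyZ !expe2 muleACA -EFinM -normrM -expr2 ger0_norm ?sqr_ge0//.
  by rewrite -!muleA.
- move=> f eoo.
  have e0 : (0 <= spectral_energy S f)%E.
    by apply: integral_ge0 => x /=; rewrite in_itv/= andbT lee_fin.
  have eE : (fine (spectral_energy S f))%:E = spectral_energy S f.
    by rewrite fineK// ge0_fin_numE.
  rewrite normL2E.
  set N := ('N[muG]_+oo[EFin \o f])%E.
  have N0 : (0 <= N)%E by exact: Lnorm_ge0.
  have rhs0 : (0 <= (1 + c)%:E * (spectral_energy S f `^ p^-1 * (N ^+ 2 * mom) `^ q^-1))%E.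
    by rewrite mule_ge0 ?lee_fin ?addr_ge0// mule_ge0// poweR_ge0.
  have zero_lhs : nrm (f - S 0 f) = 0 ->
      ((nrm (f - S 0 f))%:E ^+ 2 <=
       (1 + c)%:E * (spectral_energy S f `^ p^-1 * (N ^+ 2 * mom) `^ q^-1))%E.
    by move=> ->; rewrite expe2 mule0.
  have [ez|en0] := eqVneq (spectral_energy S f) 0%E.
    exact/zero_lhs/spectral_energy0.
  have ep : 0 < fine (spectral_energy S f) by rewrite fine_gt0// lt0e en0 e0 eoo.
  have [momz|momn] := eqVneq mom 0%E.
    exact/zero_lhs/nrm_null/null_of_mom.
  have [Ny|Nfin] := eqVneq N +oo%E.
    rewrite Ny (expe2 +oo%E) mulyy gt0_mulye ?lt0e ?momn// poweRyr; last first.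
      by rewrite invr_eq0 /q gt_eqF//; lra.
    rewrite gt0_muley ?poweR_gt0 ?lt0e ?en0//.
    by rewrite gt0_muley ?leey// lte_fin ltr_pwDl.
  have Noo : (N < +oo)%E by rewrite ltey.
  have NE : (fine N)%:E = N by rewrite fineK// ge0_fin_numE.
  pose a : R := fine N ^+ 2 * fine mom.
  have a0 : 0 <= a by rewrite mulr_ge0 ?sqr_ge0 ?fine_ge0.
  have bound xi : 0 < xi -> nrm (f - S 0 f) ^+ 2 <=
      fine (spectral_energy S f) / xi + c * (xi `^ (l + 1) * a).
    move=> xi0; apply: le_trans (nrm_sub_sf_decomposition xi0 eoo) _.
    by rewrite lerD2l low ?fine_ge0//; exact: Linfty_ae.
  have [az|an] := eqVneq a 0.
    apply: zero_lhs; apply/eqP; rewrite -sqrf_eq0 eq_le sqr_ge0 andbT leNgt.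
    apply/negP => D0.
    (* Here [D <= e / xi] for every [xi]; this value gives [D <= D / 2]. *)
    set D := (X in 0 < X) in D0; set e := fine _ in ep bound.
    have := bound (2 * e / D) (divr_gt0 (mulr_gt0 (ltr0n R 2) ep) D0).
    rewrite az !mulr0 addr0 -/D.
    rewrite (_ : e / _ = D / 2); last by field; rewrite !gt_eqF.
    by move: D0; lra.
  have ap : 0 < a by rewrite lt0r an.
  have := nash_optimization hl ep ap bound.
  rewrite -/p -/q -lee_fin => /le_trans; apply.
  have aE : a%:E = (N ^+ 2 * mom)%E by rewrite /a EFinM momE expr2 EFinM NE expe2.
  by rewrite -aE -[in leRHS]eE !poweR_EFin -!EFinM.
- by [].
Qed.
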